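(* Let $M, N, K$ be positive integers with $K>1$ and $K = M/N$, let $B$ be the number of feedback bits per user, and let $P>0$. Let $R_{BD}(P)$ be the per-user ergodic rate of block diagonalization with perfect channel knowledge at the transmitter, let $R_{FB}(P)$ be the per-user rate of block diagonalization with finite rate feedback of $B$ bits per user, averaged over random codebooks, and let $D$ be the expected squared chordal quantization error of a random codebook of size $2^B$ (all three defined in the context). Then the rate loss per user incurred due to finite rate feedback with respect to perfect channel knowledge at the transmitter, using block diagonalization, can be bounded from above by $$\Delta R(P) = R_{BD}(P) - R_{FB}(P) \;\le\; N \log_2\left(1 + P D\right).$$
   Context: Channels: a transmitter with $M$ antennas serves $K$ users with $N$ antennas each. User $i$ receives $\mathbf y_i=\mathbf H_i^H\mathbf x+\mathbf n_i$, where $\mathbf x\in\mathbb C^M$ is the transmitted signal with $E\|\mathbf x\|^2\le P$, and $\mathbf n_i$ are independent complex Gaussian noise vectors of unit variance. The channel matrices $\mathbf H_1,\dots,\mathbf H_K\in\mathbb C^{M\times N}$ have i.i.d. (zero-mean) unit variance complex Gaussian entries and are independent across users. Each user knows its own channel perfectly; the transmitter knows only the quantized channels, which are fed back without delay or error. $(\cdot)^H$ denotes conjugate transpose, $|\cdot|$ denotes determinant when applied to a matrix, and $\mathbf I_N$ is the $N\times N$ identity matrix. Chordal distance: $d(\mathbf A,\mathbf W)=\sqrt{\sum_{k=1}^N \sin^2\theta_k}$, where $\theta_1,\dots,\theta_N$ are the principal angles between the column spaces of $\mathbf A,\mathbf W\in\mathbb C^{M\times N}$. Random codebooks: the quantization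 codebook used at each user is fixed beforehand and known to the transmitter and each user. A codebook $\mathcal C$ consists of $2^B$ matrices in $\mathbb C^{M\times N}$ with orthonormal columns, each chosen independently and uniformly distributed over the Grassmannian of $N$-dimensional subspaces of $\mathbb C^M$. The quantization of $\mathbf H_i$ is $\hat{\mathbf H}_i=\arg\min_{\mathbf W\in\mathcal C} d^2(\mathbf H_i,\mathbf W)$. The distortion is $D=E\left[d^2(\mathbf H,\hat{\mathbf H})\right]=E\left[\min_{\mathbf W\in\mathcal C} d^2(\mathbf H,\mathbf W)\right]$, where $\mathbf H$ is distributed as a user channel, $\hat{\mathbf H}$ is its quantization, and performance is averaged over random codebooks. Block diagonalization: the transmitter sends $\mathbf x=\sqrt{P/K}\sum_{i=1}^K\mathbf V_i\mathbf s_i$, where $\mathbf s_i\in\mathbb C^N$ contains the symbols of user $i$, $E\|\mathbf s_i\|^2\le 1$, and $\mathbf V_i\in\mathbb C^{M\times N}$ satisfies $\mathbf V_i^H\mathbf V_i=\mathbf I_N$. Perfect-knowledge rate: the precoding matrix of a user $i$ is chosen so that $\mathbf H_j^H\mathbf V_i=\mathbf 0$ for all $j\ne i$. Writing $\mathbf V_{BD}$ for this precoding matrix and $\mathbf H$ for the channel of that user, $$R_{BD}(P)=E\left[\log_2\left|\mathbf I_N+\tfrac{P}{K}\,\mathbf H^H\mathbf V_{BD}\mathbf V_{BD}^H\mathbf H\right|\right],$$ the expectation being over all channels. Finite-rate-feedback rate: each $\mathbf V_i$ is instead chosen so that $\hat{\mathbf H}_j^H\mathbf V_i=\mathbf 0$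 for all $j\ne i$. Then $$R_{FB}(P)=E\left[\log_2\left|\mathbf I_N+\tfrac{P}{K}\sum_{j=1}^K\mathbf H_i^H\mathbf V_j\mathbf V_j^H\mathbf H_i\right|\right]-E\left[\log_2\left|\mathbf I_N+\tfrac{P}{K}\sum_{j=1,\,j\ne i}^K\mathbf H_i^H\mathbf V_j\mathbf V_j^H\mathbf H_i\right|\right],$$ with expectation over all channels and random codebooks, where $i$ is any user between $1$ and $K$. *)

(* Defs.v *)
From HB Require Import structures.
From mathcomp Require Import all_boot all_order all_algebra.
From mathcomp Require Import complex sesquilinear spectral.
From mathcomp Require Import all_classical all_reals all_analysis.

Set Implicit Arguments.
Unset Strict Implicit.
Unset Printing Implicit Defensive.

Import Order.TTheory GRing.Theory Num.Theory.

Local Open Scope classical_set_scope.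
Local Open Scope ring_scope.
Local Open Scope complex_scope.
Local Open Scope sesquilinear_scope.

(* R[i] and the spaces of matrices carry their Borel sigma-algebras, generated
   by the real and imaginary parts, respectively by the entries. *)

HB.instance Definition _ (R : realType) := isPointed.Build R[i] 0.

HB.instance Definition _ (R : realType) :=
  @isMeasurable.Build default_measure_display R[i]
    <<s preimage_set_system setT (@complex.Re R) measurable `|`
        preimage_set_system setT (@complex.Im R) measurable >>
    (@sigma_algebra0 _ _ _) (@sigma_algebraC _ _) (@sigma_algebra_bigcup _ _ _).

HB.instance Definition _ d (T : measurableType d) (m n : nat) :=
  @isMeasurable.Build default_measure_display 'M[T]_(m, n)
    <<s \bigcup_(p in [set: 'I_m * 'I_n])
          preimage_set_system setT (fun X : 'M[T]_(m, n) => X p.1 p.2)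
            measurable >>
    (@sigma_algebra0 _ _ _) (@sigma_algebraC _ _) (@sigma_algebra_bigcup _ _ _).

Definition log2 (R : realType) (x : R) : R := ln x / ln 2.

Section grassmannian.
Variables (R : realType) (M N : nat).
Implicit Types A W U V : 'M[R[i]]_(M, N).

Definition orthonormal_cols U : Prop := U ^t* *m U = 1%:M.

Definition unit_cvec (u : 'cV[R[i]]_M) : Prop := u ^t* *m u = 1%:M.

Definition in_colspace A (u : 'cV[R[i]]_M) : Prop := (u^T <= A^T)%MS.

(* The columns u_0, u_1, ... of U and v_0, v_1, ... of V are principal vectors
   of the column spaces of A and W: recursively, (u_k, v_k) maximises |u^H v|
   over the unit vectors u of the first space orthogonal to u_0, ..., u_(k-1)
   and the unit vectors v of the second one orthogonal to v_0, ..., v_(k-1). *)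
Definition principal_vectors A W U V : Prop :=
  [/\ orthonormal_cols U, orthonormal_cols V,
      (forall k, in_colspace A (col k U)), (forall k, in_colspace W (col k V)) &
      forall (k : 'I_N) (u v : 'cV[R[i]]_M),
        unit_cvec u -> in_colspace A u ->
        (forall j : 'I_N, (j < k)%N -> (col j U) ^t* *m u = 0) ->
        unit_cvec v -> in_colspace W v ->
        (forall j : 'I_N, (j < k)%N -> (col j V) ^t* *m v = 0) ->
        `|(u ^t* *m v) 0 0| <= `|(U ^t* *m V) k k| ].

Definition principal_angles A W (theta : 'rV[R]_N) : Prop :=
  exists U V, principal_vectors A W U V /\
    forall k, theta 0 k = acos (complex.Re `|(U ^t* *m V) k k|).

(* The principal angles exist and are unique when A and W have rank N; for
   matrices of smaller rank the default value 0 is used. *)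
Definition chordal_dist A W : R :=
  Num.sqrt (\sum_(k < N) sin (xget 0 (principal_angles A W) 0 k) ^+ 2).

End grassmannian.

Section probability.
Variables (R : realType) (d : measure_display) (T : measurableType d).
Variable P : probability T R.

Definition sigma_of d' (S : measurableType d') (X : T -> S) : set (set T) :=
  preimage_set_system setT X measurable.

Definition mutually_independent (I : finType) (F : I -> set (set T)) : Prop :=
  forall (J : {set I}) (E : I -> set T), (forall i, i \in J -> F i (E i)) ->
    P (\bigcap_(i in [set` J]) E i) = (\prod_(i in J) P (E i))%E.

(* Circularly symmetric complex Gaussian variable with zero mean and
   E|X|^2 = 1: the real and imaginary parts are independent N(0, 1/2). The
   second parameter of normal_prob is the standard deviation. *)
Definition std_complex_gaussian (X : T -> R[i]) : Prop :=
  measurable_fun setT X /\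
  forall A B : set R, measurable A -> measurable B ->
    P [set w | A (complex.Re (X w)) /\ B (complex.Im (X w))] =
    (normal_prob 0 (Num.sqrt 2^-1) A * normal_prob 0 (Num.sqrt 2^-1) B)%E.

(* A subspace is identified with the orthogonal projector onto it, which is
   W W^H for a basis W with orthonormal columns; the uniform distribution on the
   Grassmannian is the one invariant under the action of the unitary group. *)
Definition uniform_grassmannian M N (W : T -> 'M[R[i]]_(M, N)) : Prop :=
  [/\ measurable_fun setT W, (forall w, orthonormal_cols (W w)) &
      forall (Q : 'M[R[i]]_M) (A : set 'M[R[i]]_M),
        Q \is unitarymx -> measurable A ->
        P [set w | A ((Q *m W w) *m (Q *m W w) ^t* )] =
        P [set w | A (W w *m (W w) ^t* )] ].

End probability.

Section system.
Variables (R : realType) (M N K B : nat).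

(* The 2 ^ B codewords of a codebook are indexed by the words of B bits. *)
Notation codebook := (B.-tuple bool -> 'M[R[i]]_(M, N)).

Definition quantize (C : codebook) (A : 'M[R[i]]_(M, N)) : 'M[R[i]]_(M, N) :=
  C [arg min_(b < [tuple of nseq B false]) chordal_dist A (C b) ^+ 2]%O.

Definition block_diagonalizing (G V : 'I_K -> 'M[R[i]]_(M, N)) : Prop :=
  forall i, orthonormal_cols (V i) /\
            forall j, j != i -> (G j) ^t* *m V i = 0.

Variables (d : measure_display) (T : measurableType d) (P : probability T R).
Variable H : 'I_K -> T -> 'M[R[i]]_(M, N).
Variable W : 'I_K -> B.-tuple bool -> T -> 'M[R[i]]_(M, N).

Definition sources (x : 'I_K * 'I_M * 'I_N + 'I_K * B.-tuple bool) :
    set (set T) :=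
  match x with
  | inl (k, i, j) => sigma_of (fun w => H k w i j)
  | inr (k, b) => sigma_of (W k b)
  end.

Definition Hhat (w : T) (i : 'I_K) : 'M[R[i]]_(M, N) :=
  quantize (fun b => W i b w) (H i w).

Definition distortion (i : 'I_K) : \bar R :=
  'E_P[fun w => chordal_dist (H i w) (Hhat w i) ^+ 2].

(* log2 |I_N + c S|; for c >= 0 and S positive semidefinite the determinant is
   a real number >= 1, which is read off through its real part *)
Definition log2_det (c : R) (S : 'M[R[i]]_N) : R :=
  log2 (complex.Re (\det (1%:M + c%:C *: S))).

Definition received_cov (A V : 'M[R[i]]_(M, N)) : 'M[R[i]]_N :=
  A ^t* *m V *m V ^t* *m A.

(* rho is the transmit power. *)
Variable rho : R.

(* V w i is the precoding matrix of user i at the sample point w *)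
Definition rate_BD (V : T -> 'I_K -> 'M[R[i]]_(M, N)) (i : 'I_K) : \bar R :=
  'E_P[fun w => log2_det (rho / K%:R) (received_cov (H i w) (V w i))].

Definition rate_FB (V : T -> 'I_K -> 'M[R[i]]_(M, N)) (i : 'I_K) : \bar R :=
  ('E_P[fun w => log2_det (rho / K%:R)
                   (\sum_j received_cov (H i w) (V w j))] -
   'E_P[fun w => log2_det (rho / K%:R)
                   (\sum_(j | j != i) received_cov (H i w) (V w j))])%E.

End system.

(* Main.v *)
(* After the channels and the codewords are replaced by the positive
   semidefinite matrices A = H H^H and the projectors W W^H, every quantity in
   the theorem is a function of independent matrices whose laws are invariant
   under conjugation by unitary matrices, and in generic position almost surely.

   - The projector onto the precoding subspace of user i is independent of A_i, so
     that the mean of log2 |I + c H_i^H V_i V_i^H H_i| is the same with perfect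
     knowledge and with feedback. It bounds the first term of the feedback rate
     from below.
   - The interference is treated as follows. Given the quantized channel Q_i, the
     precoding subspace of user j has dimension N and is isotropic in the
     (K - 1) N dimensional complement of Q_i, hence carries the fraction 1/(K - 1)
     of the energy of (1 - Q_i) A_i (1 - Q_i). Given A_i, the quantization error
     1 - Q_i is isotropic on the range of A_i and its mean trace there is D, so that
     the total mean energy of the interference is at most (D/N) M N = M D.
   - The concave function log is bounded by its tangent at a = 1 + P D, applied to
     the eigenvalues; the mean of the tangent is N log a.

   Invariance of the Gaussian matrix under unitary matrices comes from plane
   rotations, which are products of three shears, and generic position from
   replacing the entries of a matrix of full rank one at a time. *)
From HB Require Import structures.
Require Import Defs.
From mathcomp Require Import all_boot all_order all_algebra.
From mathcomp Require Import complex sesquilinear spectral.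
From mathcomp Require Import all_classical all_reals all_analysis.
From mathcomp Require Import ring lra.
From mathcomp Require Import measurable_realfun probability normal_distribution charge.

Set Implicit Arguments.
Unset Strict Implicit.
Unset Printing Implicit Defensive.

Import Order.TTheory GRing.Theory Num.Theory.
Import numFieldNormedType.Exports.

Local Open Scope classical_set_scope.
Local Open Scope ring_scope.
Local Open Scope sesquilinear_scope.

(** * Positive semidefinite matrices and kernel projectors *)

(** Two obstacles shape the proof. The precoders are arbitrary selections, determined only up to a
    unitary factor, and only when the other users leave exactly N dimensions. So everything is
    phrased through V V^H, which is almost surely the projector onto a kernel, and full rank has to
    hold almost surely for sums of channels and of selected codewords. The codewords are known only
    through their invariance; their generic position is borrowed from the Gaussian channels.
    Conditioning is replaced by Tonelli: some of the independent components are evaluated at a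
    second sample point, which is then frozen. This asks for joint measurability of kernel
    projectors, ranks and selected codewords, and for nonnegative integrands, but for no
    integrability, so that infinite means need attention only in the final subtraction. *)

Section adjoint.
Variable C : numClosedFieldType.

Lemma adjmxM m n p (A : 'M[C]_(m, n)) (B : 'M[C]_(n, p)) :
  (A *m B) ^t* = B ^t* *m A ^t*.
Proof. by rewrite trmx_mul map_mxM. Qed.

Lemma adjmx1 n : (1%:M : 'M[C]_n) ^t* = 1%:M.
Proof. by rewrite trmx1 map_mx1. Qed.

Lemma adjmx0 m n : (0 : 'M[C]_(m, n)) ^t* = 0.
Proof. by rewrite trmx0 map_mx0. Qed.

Lemma adjmxD m n (A B : 'M[C]_(m, n)) : (A + B) ^t* = A ^t* + B ^t*.
Proof. by rewrite linearD map_mxD. Qed.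

Lemma adjmxN m n (A : 'M[C]_(m, n)) : (- A) ^t* = - A ^t*.
Proof. by rewrite linearN map_mxN. Qed.

Lemma adjmxZ m n a (A : 'M[C]_(m, n)) : (a *: A) ^t* = a^* *: A ^t*.
Proof. by rewrite linearZ map_mxZ. Qed.

Lemma adjmx_diag n (r : 'rV[C]_n) : (diag_mx r) ^t* = diag_mx (map_mx Num.conj r).
Proof. by rewrite tr_diag_mx map_diag_mx. Qed.

Lemma unitarymx_adjl n (U : 'M[C]_n) : U \is unitarymx -> U ^t* *m U = 1%:M.
Proof. by move/unitarymxP/mulmx1C. Qed.

Lemma unitarymx_adjr n (U : 'M[C]_n) : U \is unitarymx -> U *m U ^t* = 1%:M.
Proof. by move/unitarymxP. Qed.

Definition normsq n (u : 'cV[C]_n) : C := (u ^t* *m u) 0 0.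

Lemma normsqE n (u : 'cV[C]_n) : normsq u = \sum_i `|u i 0| ^+ 2.
Proof.
rewrite /normsq mxE; apply: eq_bigr => i _.
by rewrite !mxE mulrC normCK.
Qed.

Lemma normsq_ge0 n (u : 'cV[C]_n) : 0 <= normsq u.
Proof. by rewrite normsqE sumr_ge0 // => i _; rewrite exprn_ge0. Qed.

Lemma normsq_eq0 n (u : 'cV[C]_n) : (normsq u == 0) = (u == 0).
Proof.
apply/eqP/eqP => [|->]; last by rewrite /normsq mulmx0 mxE.
rewrite normsqE => /psumr_eq0P u0; apply/colP => i.
have /eqP := u0 (fun j _ => exprn_ge0 2 (normr_ge0 (u j 0))) i isT.
by rewrite expf_eq0 /= normr_eq0 mxE => /eqP.
Qed.

Lemma normsqZ n a (u : 'cV[C]_n) : normsq (a *: u) = `|a| ^+ 2 * normsq u.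
Proof.
by rewrite /normsq adjmxZ -scalemxAl -scalemxAr scalerA mxE normCK [a^* * a]mulrC.
Qed.

Lemma mxtrace_adj_mul m n (A : 'M[C]_(m, n)) :
  \tr (A ^t* *m A) = \sum_j normsq (col j A).
Proof.
by apply: eq_bigr => j _; rewrite /normsq !mxE; apply: eq_bigr => i _; rewrite !mxE.
Qed.

Lemma normsq_unitary n (U : 'M[C]_n) (u : 'cV[C]_n) :
  U \is unitarymx -> normsq (U *m u) = normsq u.
Proof.
by move=> Uu; rewrite /normsq adjmxM mulmxA -(mulmxA (u ^t* )) unitarymx_adjl // mulmx1.
Qed.

Lemma adjmx_mul_eq0 m n (A : 'M[C]_(m, n)) : A ^t* *m A = 0 -> A = 0.
Proof.
move=> A0; apply/matrixP => i j; rewrite [RHS]mxE.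
have /eqP : normsq (col j A) = 0.
  have /matrixP/(_ j j) := A0; rewrite !mxE => <-.
  by rewrite /normsq [LHS]mxE; apply: eq_bigr => k _; rewrite !mxE.
by rewrite normsq_eq0 => /eqP/colP/(_ i); rewrite !mxE.
Qed.

Lemma unitarymx_complement n M (A : 'M[C]_(n, M)) : A \is unitarymx ->
  exists Z : 'M[C]_(M - n, M),
    [/\ Z \is unitarymx, A *m Z ^t* = 0 & A ^t* *m A + Z ^t* *m Z = 1%:M].
Proof.
move=> Au; have rA := mxrank_unitary Au.
pose A' := orthomx Num.conj (mx_of_hermitian (@hermitian1mx C M)) A.
pose Z0 := schmidt (row_base A').
have rA' : \rank A' = (M - n)%N by rewrite rank_ortho rA.
have Z0u : Z0 \is unitarymx by rewrite schmidt_unitarymx // rank_leq_col.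
have Z0A : (Z0 :=: A')%MS.
  by apply: (eqmx_trans (eqmx_schmidt_free (row_base_free _))); exact: eq_row_base.
have sAZ : (1%:M <= A + Z0)%MS.
  have := addsmx_ortho A; rewrite -/A' => e.
  have : (1%:M <= A + A')%MS by rewrite e.
  by move/submx_trans; apply; apply: addsmxS => //; rewrite Z0A.
have AZ : A *m Z0 ^t* = 0.
  by apply/orthomx1P; rewrite orthomx_sym Z0A submx_refl.
have e : A ^t* *m A + Z0 ^t* *m Z0 = 1%:M.
  have /sub_addsmxP[[D E] /= DE] := sAZ.
  rewrite -[LHS]mul1mx {1}DE mulmxDl !mulmxDr !mulmxA.
  rewrite -(mulmxA D) (unitarymxP Au) -(mulmxA D A (Z0 ^t*)) AZ.
  rewrite -(mulmxA E Z0 (Z0 ^t*)) (unitarymxP Z0u) -(mulmxA E Z0 (A ^t*)).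
  rewrite -[A in Z0 *m A ^t*]trmxCK trmxCK.
  have -> : Z0 *m A ^t* = 0 by rewrite -[LHS]trmxCK adjmxM trmxCK AZ adjmx0.
  by rewrite !(mulmx0, mulmx1, mul0mx, addr0, add0r) -DE.
(* The number of rows of [Z0] is the rank of [A']; it can be rewritten to M - n only once [Z0] is
   abstract. *)
clearbody Z0; move: Z0 {Z0A sAZ} Z0u AZ e; rewrite rA' => Z ? ? ?.
by exists Z.
Qed.

Lemma adjmx_inj m n : injective (fun A : 'M[C]_(m, n) => A ^t*).
Proof. by move=> A B /(congr1 (fun X => X ^t*)); rewrite !trmxCK. Qed.

(** Q sends the frame V to V' and a frame of the complement to a frame of the complement. This
    transitivity is what turns invariance of a law into equality of means over all subspaces. *)
Lemma orthonormal_transitive M n (V V' : 'M[C]_(M, n)) :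
  V ^t* *m V = 1%:M -> V' ^t* *m V' = 1%:M ->
  exists2 Q : 'M[C]_M, Q \is unitarymx & Q *m V = V'.
Proof.
move=> oV oV'.
have [|Z [Zu VZ VVZZ]] := @unitarymx_complement n M (V ^t*).
  by apply/unitarymxP; rewrite trmxCK.
have [|Z' [Zu' VZ' VVZZ']] := @unitarymx_complement n M (V' ^t*).
  by apply/unitarymxP; rewrite trmxCK.
have ZV : Z *m V = 0 by rewrite -[LHS]trmxCK adjmxM VZ adjmx0.
exists (V' *m V ^t* + Z' ^t* *m Z); last first.
  by rewrite mulmxDl -!mulmxA oV ZV mulmx1 mulmx0 addr0.
apply/unitarymxP; rewrite adjmxD !adjmxM !trmxCK mulmxDl !mulmxDr.
rewrite !mulmxA -(mulmxA V' (V ^t*) V) oV mulmx1 -(mulmxA V' (V ^t*) (Z ^t*)) VZ.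
rewrite -(mulmxA _ Z V) ZV -(mulmxA _ Z (Z ^t*)) (unitarymxP Zu).
by rewrite !(mulmx0, mul0mx, addr0, add0r, mulmx1) -{1}[V']trmxCK.
Qed.

Lemma gram_schmidt M n (h : 'M[C]_(M, n)) : \rank h = n ->
  exists V : 'M[C]_(M, n), exists2 T : 'M[C]_n,
    V ^t* *m V = 1%:M /\ T \in unitmx & h = V *m T.
Proof.
move=> rh; have rha : \rank (h ^t*) = n by rewrite mxrank_map mxrank_tr.
have nM : (n <= M)%N by rewrite -{1}rh rank_leq_row.
pose S := schmidt (h ^t*).
have Su : S \is unitarymx by rewrite schmidt_unitarymx.
have /submxP[D hD] : (h ^t* <= S)%MS by rewrite schmidt_sub.
exists (S ^t*), (D ^t*); last by rewrite -adjmxM -hD trmxCK.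
split; first by rewrite trmxCK (unitarymxP Su).
have rD : \rank D = n.
  apply/eqP; rewrite eqn_leq rank_leq_row -{1}rha hD mxrankM_maxl //.
by rewrite -row_free_unit /row_free mxrank_map mxrank_tr rD.
Qed.

Lemma orthonormal_rank M n (V : 'M[C]_(M, n)) : V ^t* *m V = 1%:M -> \rank V = n.
Proof.
move=> oV; have /mxrank_unitary : V ^t* \is unitarymx.
  by apply/unitarymxP; rewrite trmxCK.
by rewrite mxrank_map mxrank_tr.
Qed.

End adjoint.

Section psd.
Variable C : numClosedFieldType.

Definition psd n (A : 'M[C]_n) : Prop :=
  A ^t* = A /\ forall u : 'cV[C]_n, 0 <= (u ^t* *m A *m u) 0 0.

Lemma psd_mul_adj m n (A : 'M[C]_(m, n)) : psd (A *m A ^t*).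
Proof.
split=> [|u]; first by rewrite adjmxM trmxCK.
have := normsq_ge0 (A ^t* *m u).
by rewrite /normsq adjmxM trmxCK !mulmxA.
Qed.

Lemma psd0 n : psd (0 : 'M[C]_n).
Proof. by split=> [|u]; rewrite ?adjmx0 // mulmx0 mul0mx mxE. Qed.

Lemma psdD n (A B : 'M[C]_n) : psd A -> psd B -> psd (A + B).
Proof.
move=> [hA pA] [hB pB]; split=> [|u]; first by rewrite adjmxD hA hB.
by rewrite mulmxDr mulmxDl mxE addr_ge0.
Qed.

Lemma psd_sum n I (r : seq I) (Q : pred I) (F : I -> 'M[C]_n) :
  (forall i, Q i -> psd (F i)) -> psd (\sum_(i <- r | Q i) F i).
Proof. by move=> FP; apply: big_ind => //; [exact: psd0|exact: psdD]. Qed.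

Lemma psdZ n a (A : 'M[C]_n) : 0 <= a -> psd A -> psd (a *: A).
Proof.
move=> a0 [hA pA]; split=> [|u]; first by rewrite adjmxZ hA geC0_conj.
by rewrite -scalemxAr -scalemxAl mxE mulr_ge0.
Qed.

Lemma psd_conj m n (B : 'M[C]_(m, n)) (A : 'M[C]_m) :
  psd A -> psd (B ^t* *m A *m B).
Proof.
move=> [hA pA]; split=> [|u]; first by rewrite !adjmxM trmxCK hA mulmxA.
by have := pA (B *m u); rewrite adjmxM !mulmxA.
Qed.

Lemma psd1 n : psd (1%:M : 'M[C]_n).
Proof. by have := @psd_mul_adj n n 1%:M; rewrite adjmx1 mulmx1. Qed.

Lemma psd_spectral n (A : 'M[C]_n) : psd A ->
  exists U : 'M[C]_n, exists d : 'rV[C]_n,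
    [/\ U \is unitarymx, forall i, 0 <= d 0 i & A = U ^t* *m diag_mx d *m U].
Proof.
move=> [hA pA].
have /orthomx_spectralP : A \is normalmx by apply/normalmxP; rewrite hA.
have := spectral_unitarymx A.
set U := spectralmx A => Uu; rewrite invmx_unitary // => eA.
exists U, (spectral_diag A); split=> // i; clearbody U.
have := pA (U ^t* *m delta_mx i 0).
move: (spectral_diag A) eA => d eA; rewrite eA adjmxM trmxCK !mulmxA mulmxtVK // -(mulmxA _ U) (unitarymxP Uu) mulmx1.
have -> : (delta_mx i 0 : 'cV[C]_n) ^t* = delta_mx 0 i.
  by rewrite trmx_delta map_delta_mx.
by rewrite -rowE -colE !mxE eqxx mulr1n.
Qed.

Lemma psd_det1D n (A : 'M[C]_n) : psd A -> 1 <= \det (1%:M + A).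
Proof.
move=> /psd_spectral[U [d [Uu d0 ->]]].
rewrite -(unitarymx_adjl Uu) -[X in X *m U + _]mulmx1 -mulmxDl -mulmxDr.
rewrite !det_mulmx mulrAC -det_mulmx unitarymx_adjl // det1 mul1r.
rewrite -diag_const_mx -linearD det_diag.
elim/big_rec: _ => // i x _ x1.
by rewrite mulr_ege1 // !mxE lerDl.
Qed.

(** Factoring out 1 + A = (S U)^H (S U), with S the square roots of its eigenvalues, reduces the
    claim to [psd_det1D] for the congruent matrix [B']. *)
Lemma psd_det_le n (A B : 'M[C]_n) : psd A -> psd B ->
  \det (1%:M + A) <= \det (1%:M + A + B).
Proof.
move=> pA pB; have [U [d [Uu d0 eA]]] := psd_spectral pA.
have d1 i : 0 < 1 + d 0 i by rewrite ltr_wpDr.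
pose S : 'M[C]_n := diag_mx (\row_i sqrtC (1 + d 0 i)).
pose S' : 'M[C]_n := diag_mx (\row_i (sqrtC (1 + d 0 i))^-1).
have s0 i : sqrtC (1 + d 0 i) != 0 by rewrite sqrtC_eq0 gt_eqF.
have hS : S ^t* = S.
  rewrite adjmx_diag; congr diag_mx; apply/rowP => i; rewrite !mxE.
  by rewrite geC0_conj // sqrtC_ge0 ltW.
have hS' : S' ^t* = S'.
  rewrite adjmx_diag; congr diag_mx; apply/rowP => i; rewrite !mxE.
  by rewrite geC0_conj // invr_ge0 sqrtC_ge0 ltW.
have SS' : S *m S' = 1%:M.
  rewrite mulmx_diag -diag_const_mx; congr diag_mx; apply/rowP => i.
  by rewrite !mxE divff.
have S'S : S' *m S = 1%:M by apply: mulmx1C.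
have e1 : 1%:M + A = (S *m U) ^t* *m (S *m U).
  rewrite adjmxM hS !mulmxA -(mulmxA _ S S) mulmx_diag eA.
  rewrite -{1}(unitarymx_adjl Uu) -[X in X *m U + _]mulmx1 -mulmxDl -mulmxDr.
  congr (_ *m _ *m _); rewrite -diag_const_mx -linearD; congr diag_mx.
  by apply/rowP => i; rewrite !mxE -expr2 sqrtCK.
pose B' := (U ^t* *m S') ^t* *m B *m (U ^t* *m S').
have e2 : 1%:M + A + B = (S *m U) ^t* *m (1%:M + B') *m (S *m U).
  rewrite mulmxDr mulmxDl mulmx1 -e1; congr (_ + _).
  rewrite /B' !adjmxM trmxCK hS hS' -!mulmxA (mulmxA S' S) S'S mul1mx.
  rewrite (mulmxA S S') SS' mul1mx (mulmxA (U^t*) U) unitarymx_adjl //.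
  by rewrite mul1mx mulmx1.
rewrite e2 !det_mulmx mulrAC -!det_mulmx -e1.
have pB' : psd B' by exact: psd_conj.
by rewrite det_mulmx ler_peMr ?psd_det1D // (le_trans _ (psd_det1D pA)).
Qed.

Lemma psd_mxtrace_ge0 n (A : 'M[C]_n) : psd A -> 0 <= \tr A.
Proof.
move=> [_ pA]; apply: sumr_ge0 => i _; have := pA (delta_mx i 0).
have -> : (delta_mx i 0 : 'cV[C]_n) ^t* = delta_mx 0 i.
  by rewrite trmx_delta map_delta_mx.
by rewrite -rowE -colE !mxE.
Qed.

Lemma psd_ker n (A : 'M[C]_n) (u : 'cV[C]_n) : psd A ->
  (u ^t* *m A *m u) 0 0 = 0 -> A *m u = 0.
Proof.
move=> /psd_spectral[U [d [Uu d0 ->]]] u0.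
suff dv : diag_mx d *m (U *m u) = 0 by rewrite -!mulmxA dv mulmx0.
have : ((U *m u) ^t* *m (diag_mx d *m (U *m u))) 0 0 = 0.
  by rewrite -[RHS]u0 adjmxM !mulmxA.
set v := U *m u; rewrite mul_diag_mx mxE => /psumr_eq0P v0.
apply/colP => i; rewrite [RHS]mxE mxE.
have pos j : 0 <= v ^t* 0 j * (\matrix_(i, j0) (d 0 i * v i j0)) j 0.
  by rewrite !mxE mulrCA mulr_ge0 // mulrC mul_conjC_ge0.
have /eqP := v0 (fun j _ => pos j) i isT.
rewrite !mxE mulrCA mulf_eq0 mulf_eq0 conjC_eq0 orbb => /orP[]/eqP->;
  by rewrite ?mulr0 ?mul0r.
Qed.

(** A sum of two nonnegative forms vanishes only where both do, so the kernel of A + B is the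
    intersection of the two kernels. *)
Lemma psd_addl_ker n p (A B : 'M[C]_n) (X : 'M[C]_(n, p)) : psd A -> psd B ->
  (A + B) *m X = 0 -> A *m X = 0.
Proof.
move=> pA pB AB0; apply/matrixP => i j; rewrite [RHS]mxE.
have ABu : (A + B) *m col j X = 0 by rewrite colE mulmxA AB0 mul0mx.
suff /psd_ker-/(_ pA)/colP/(_ i) : ((col j X) ^t* *m A *m col j X) 0 0 = 0.
  by rewrite colE mulmxA -colE !mxE.
have : ((col j X) ^t* *m (A + B) *m col j X) 0 0 = 0.
  by rewrite -mulmxA ABu mulmx0 mxE.
rewrite mulmxDr mulmxDl mxE => /eqP.
by rewrite paddr_eq0 ?(proj2 pA) ?(proj2 pB) // => /andP[/eqP].
Qed.

Lemma mxtrace_adj_mul_eq0 m n (A : 'M[C]_(m, n)) : \tr (A ^t* *m A) = 0 -> A = 0.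
Proof.
rewrite mxtrace_adj_mul => /psumr_eq0P A0; apply/matrixP => i j.
have /eqP := A0 (fun j _ => normsq_ge0 (col j A)) j isT.
by rewrite normsq_eq0 => /eqP/colP/(_ i); rewrite !mxE.
Qed.

(** For positive semidefinite A, the orthogonal projector onto the kernel: each eigenvalue is
    replaced by the indicator of its vanishing. *)
Definition kerproj n (A : 'M[C]_n) : 'M[C]_n :=
  (spectralmx A) ^t* *m diag_mx (\row_i (spectral_diag A 0 i == 0)%:R)
    *m spectralmx A.

Lemma diag_mul_eq0 n p (d : 'rV[C]_n) (X : 'M[C]_(n, p)) :
  diag_mx d *m X = 0 -> diag_mx (\row_i (d 0 i == 0)%:R) *m X = X.
Proof.
move=> dX; rewrite mul_diag_mx; apply/matrixP => i j; rewrite !mxE.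
have /matrixP/(_ i j) := dX; rewrite mul_diag_mx !mxE.
by case: eqVneq => [_ _|d0 /eqP]; rewrite ?mul1r // mulf_eq0 (negbTE d0) /= => /eqP->;
   rewrite mulr0.
Qed.

Lemma kerprojP n (A : 'M[C]_n) : psd A ->
  [/\ (kerproj A) ^t* = kerproj A, A *m kerproj A = 0
   & forall p (X : 'M[C]_(n, p)), A *m X = 0 -> kerproj A *m X = X].
Proof.
move=> [hA _]; rewrite /kerproj.
have /orthomx_spectralP : A \is normalmx by apply/normalmxP; rewrite hA.
have := spectral_unitarymx A; set U := spectralmx A => Uu.
rewrite invmx_unitary //; move: (spectral_diag A) => d eA; clearbody U.
split=> [||p X].
- rewrite !adjmxM trmxCK adjmx_diag !mulmxA; congr (_ *m diag_mx _ *m _).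
  by apply/rowP => i; rewrite !mxE conjC_nat.
- rewrite eA !mulmxA -(mulmxA _ U) unitarymx_adjr // mulmx1 -(mulmxA _ (diag_mx d)).
  rewrite mulmx_diag; suff -> : \row_j (d 0 j * (\row_i (d 0 i == 0)%:R) 0 j) = 0.
    by rewrite linear0 mulmx0 mul0mx.
  by apply/rowP => i; rewrite !mxE; case: eqVneq => [->|_]; rewrite ?mul0r ?mulr0.
- rewrite {1}eA => AX0; rewrite -!mulmxA diag_mul_eq0.
    by rewrite mulmxA unitarymx_adjl // mul1mx.
  have := congr1 (mulmx U) AX0.
  by rewrite !mulmxA unitarymx_adjr // mul1mx mulmx0 -!mulmxA.
Qed.

Lemma kerproj_uniq n (A P : 'M[C]_n) : psd A -> P ^t* = P -> A *m P = 0 ->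
  (forall p (X : 'M[C]_(n, p)), A *m X = 0 -> P *m X = X) -> P = kerproj A.
Proof.
move=> /kerprojP[hk Ak kX] hP AP PX.
by rewrite -hP -(kX _ _ AP) adjmxM hP hk PX.
Qed.

Lemma kerproj_conj n (Q A : 'M[C]_n) : Q \is unitarymx -> psd A ->
  kerproj (Q *m A *m Q ^t*) = Q *m kerproj A *m Q ^t*.
Proof.
move=> Qu pA; have [hk Ak kX] := kerprojP pA.
apply/esym/kerproj_uniq; move: (kerproj A) hk Ak kX => k hk Ak kX.
- by have := psd_conj (Q ^t*) pA; rewrite trmxCK.
- by rewrite !adjmxM trmxCK hk mulmxA.
- by rewrite !mulmxA (mulmxKtV (Q *m A) Qu erefl) -(mulmxA Q A) Ak mulmx0 mul0mx.
- move=> p X e; rewrite -mulmxA -mulmxA kX.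
    by rewrite mulmxA unitarymx_adjr // mul1mx.
  have := congr1 (mulmx (Q ^t*)) e.
  by rewrite !mulmxA unitarymx_adjl // mul1mx mulmx0 -!mulmxA.
Qed.

Lemma kerproj_idem n (A : 'M[C]_n) : psd A -> kerproj A *m kerproj A = kerproj A.
Proof. by move=> /kerprojP[hk Ak kX]; exact: kX. Qed.

Lemma kerproj_mull n (A : 'M[C]_n) : psd A -> kerproj A *m A = 0.
Proof.
by move=> pA; have [hk Ak _] := kerprojP pA;
   rewrite -[LHS]trmxCK adjmxM hk (proj1 pA) Ak adjmx0.
Qed.

Lemma proj_factor n (P : 'M[C]_n) : P ^t* = P -> P *m P = P ->
  exists2 V : 'M[C]_(n, \rank P), V ^t* *m V = 1%:M & V *m V ^t* = P.
Proof.
move=> hP PP; pose S := schmidt (row_base P).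
have Su : S \is unitarymx by rewrite schmidt_unitarymx // rank_leq_col.
have SP : (S :=: P)%MS.
  by apply: (eqmx_trans (eqmx_schmidt_free (row_base_free _))); exact: eq_row_base.
have /submxP[D eS] : (S <= P)%MS by rewrite SP.
have /submxP[E eP] : (P <= S)%MS by rewrite SP.
exists (S ^t*); rewrite trmxCK; first exact/unitarymxP.
have SP1 : S *m P = S by rewrite eS -mulmxA PP.
have PSS : P *m (S ^t* *m S) = P.
  by rewrite {1}eP mulmxA -(mulmxA E) (unitarymxP Su) mulmx1 -eP.
have := congr1 (fun X => X ^t*) PSS.
by rewrite !adjmxM trmxCK hP -mulmxA SP1.
Qed.

Lemma proj_mxtrace n (P : 'M[C]_n) : P ^t* = P -> P *m P = P ->
  \tr P = (\rank P)%:R.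
Proof.
move=> hP PP; have [V VV eV] := proj_factor hP PP.
by rewrite -{1}eV mxtrace_mulC VV mxtrace1.
Qed.

Lemma kerproj_rank n (A : 'M[C]_n) : psd A -> \rank (kerproj A) = (n - \rank A)%N.
Proof.
move=> pA; have [hk Ak kX] := kerprojP pA; rewrite -mxrank_ker.
apply/eqmx_rank/andP; split.
  by apply/sub_kermxP; exact: kerproj_mull.
have /kX : A *m (kermx A) ^t* = 0.
  by rewrite -{1}(proj1 pA) -adjmxM mulmx_ker adjmx0.
move=> /(congr1 (fun X => X ^t*)); rewrite adjmxM trmxCK hk => <-.
exact: submxMl.
Qed.

Lemma kerproj_mxtrace n (A : 'M[C]_n) : psd A ->
  \tr (kerproj A) = (n - \rank A)%:R.
Proof.
move=> pA; have [hk _ _] := kerprojP pA.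
by rewrite proj_mxtrace ?kerproj_rank ?kerproj_idem.
Qed.

(** The difference of two nested projectors is a projector; here its trace is N - N = 0, and a
    projector of trace 0 vanishes. This identifies a precoding subspace with a kernel. *)
Lemma kerproj_orthonormal M N (A : 'M[C]_M) (V : 'M[C]_(M, N)) : psd A ->
  \rank A = (M - N)%N -> (N <= M)%N -> V ^t* *m V = 1%:M -> A *m V = 0 ->
  V *m V ^t* = kerproj A.
Proof.
move=> pA rA NM VV AV; have [hk Ak kX] := kerprojP pA.
set k := kerproj A; pose D := k - V *m V ^t*.
have kV : k *m V = V by exact: kX.
have Vk : V ^t* *m k = V ^t* by rewrite -[k in LHS]hk -adjmxM kV.
have hD : D ^t* = D by rewrite /D adjmxD adjmxN hk adjmxM trmxCK.
have DD : D *m D = D.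
  rewrite /D mulmxBl !mulmxBr kerproj_idem // mulmxA kV -mulmxA Vk.
  by rewrite mulmxA -(mulmxA V (V ^t*) V) VV mulmx1 subrr subr0.
suff : D = 0 by move/eqP; rewrite subr_eq0 => /eqP.
apply: mxtrace_adj_mul_eq0; rewrite hD DD /D linearB /= kerproj_mxtrace // rA.
by rewrite subKn // mxtrace_mulC VV mxtrace1 subrr.
Qed.

Lemma kerproj_basis M N (A : 'M[C]_M) : psd A -> (\rank A + N <= M)%N ->
  exists2 V : 'M[C]_(M, N), V ^t* *m V = 1%:M & A *m V = 0.
Proof.
move=> pA rA; have [hk Ak kX] := kerprojP pA.
have [V0 V0V e0] := proj_factor hk (kerproj_idem pA).
have rN : (N <= \rank (kerproj A))%N by rewrite kerproj_rank // leq_subRL // (leq_trans _ rA) // leq_addr.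
pose E : 'M[C]_(\rank (kerproj A), N) := pid_mx N.
have EE : E ^t* *m E = 1%:M.
  rewrite /E tr_pid_mx map_pid_mx mul_pid_mx minnn (minn_idPr rN).
  by rewrite pid_mx_1.
exists (V0 *m E).
  by rewrite adjmxM !mulmxA -(mulmxA _ _ V0) V0V mulmx1.
have : A *m (V0 *m V0 ^t* *m V0) = 0 by rewrite e0 mulmxA Ak mul0mx.
by rewrite -mulmxA V0V mulmx1 mulmxA => ->; rewrite mul0mx.
Qed.

(** By [psd_addl_ker] the rows of the sum span the rows of A together with those of X^H. A row b X^H
    that is also a row combination of A is killed by V, and X^H V is invertible, so b = 0: the two
    spaces are in direct sum. *)
Lemma psd_rank_add M N (A : 'M[C]_M) (V X : 'M[C]_(M, N)) : psd A ->
  A *m V = 0 -> V ^t* *m X \in unitmx ->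
  \rank (A + X *m X ^t*)%R = (\rank A + N)%N.
Proof.
move=> pA AV uVX; have pX := psd_mul_adj X.
have e : ((A + X *m X ^t*)%R :=: A + X ^t*)%MS.
  apply/eqmxP/andP; split.
    by apply: addmx_sub; rewrite ?addsmxSl // (submx_trans _ (addsmxSr _ _)) ?submxMl.
  rewrite addsmx_sub !submxE; apply/andP; split; apply/eqP.
    by apply: (psd_addl_ker pA pX); rewrite mulmx_coker.
  have e : X *m X ^t* *m cokermx (A + X *m X ^t*) = 0.
    by apply: (psd_addl_ker pX pA); rewrite addrC mulmx_coker.
  apply: adjmx_mul_eq0; rewrite adjmxM trmxCK !mulmxA -!mulmxA.
  by rewrite (mulmxA X) e mulmx0.
have uXV : X ^t* *m V \in unitmx.
  by rewrite -[V]trmxCK -adjmxM -row_free_unit /row_free mxrank_map mxrank_tr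
     -/(row_free _) row_free_unit.
rewrite e; have := mxrank_sum_cap A (X ^t*).
suff -> : (A :&: X ^t*)%MS = 0.
  rewrite mxrank0 addn0 => ->; congr (_ + _)%N.
  apply/eqP; rewrite eqn_leq rank_leq_row /=.
  by rewrite -{1}(mxrank_unit uXV) mxrankM_maxl.
apply/eqP/rowV0P => v; rewrite sub_capmx => /andP[/submxP[a ->] /submxP[b e1]].
have : a *m A *m V = 0 by rewrite -mulmxA AV mulmx0.
rewrite e1 -mulmxA => /(congr1 (fun Y => Y *m invmx (X ^t* *m V))).
by rewrite mulmxK // mul0mx => ->; rewrite mul0mx.
Qed.

(** The choice of a spectral basis comes with no measurability in A, whereas the resolvent is a
    rational function of the entries. In a common eigenbasis the eigenvalues 1 / (1 + t d) tend to
    the indicator of d = 0 as t grows, which makes [kerproj] a limit of measurable functions. *)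
Lemma kerproj_limit n (A : 'M[C]_n) : psd A ->
  exists U : 'M[C]_n, exists d : 'rV[C]_n,
    [/\ forall i, 0 <= d 0 i,
        kerproj A = U ^t* *m diag_mx (\row_i (d 0 i == 0)%:R) *m U
      & forall t, 0 <= t -> invmx (1%:M + t *: A) =
          U ^t* *m diag_mx (\row_i (1 + t * d 0 i)^-1) *m U].
Proof.
move=> pA; have [U [d [Uu d0 eA]]] := psd_spectral pA.
exists U, d; split=> // [|t t0].
  apply/esym/kerproj_uniq => //.
  - rewrite !adjmxM trmxCK adjmx_diag !mulmxA; congr (_ *m diag_mx _ *m _).
    by apply/rowP => i; rewrite !mxE conjC_nat.
  - rewrite eA !mulmxA -(mulmxA _ U) unitarymx_adjr // mulmx1 -(mulmxA _ (diag_mx d)).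
    rewrite mulmx_diag; suff -> : \row_j (d 0 j * (\row_i (d 0 i == 0)%:R) 0 j) = 0.
      by rewrite linear0 mulmx0 mul0mx.
    by apply/rowP => i; rewrite !mxE; case: eqVneq => [->|_]; rewrite ?mul0r ?mulr0.
  - move=> p X; rewrite {1}eA => AX0; rewrite -!mulmxA diag_mul_eq0.
      by rewrite mulmxA unitarymx_adjl // mul1mx.
    have := congr1 (mulmx U) AX0.
    by rewrite !mulmxA unitarymx_adjr // mul1mx mulmx0 -!mulmxA.
have e : 1%:M + t *: A = U ^t* *m diag_mx (\row_i (1 + t * d 0 i)) *m U.
  rewrite eA -{1}(unitarymx_adjl Uu) -[X in X *m U + _]mulmx1 scalemxAl scalemxAr.
  rewrite -mulmxDl -mulmxDr; congr (_ *m _ *m _).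
  rewrite -diag_const_mx -linearZ -linearD; congr diag_mx.
  by apply/rowP => i; rewrite !mxE.
set B := U ^t* *m diag_mx (\row_i (1 + t * d 0 i)^-1) *m U.
have : (1%:M + t *: A) *m B = 1%:M.
  rewrite e /B !mulmxA mulmxtVK // -(mulmxA (U ^t*)) mulmx_diag.
  rewrite (_ : \row_j _ = const_mx 1) ?diag_const_mx ?mulmx1 ?unitarymx_adjl //.
  apply/rowP => i; rewrite !mxE divff // gt_eqF // ltr_wpDr // mulr_ge0 //.
move=> e1; have [u1 _] := mulmx1_unit e1.
by rewrite -[RHS](mulKmx u1) e1 mulmx1.
Qed.

End psd.

(** * Principal angles and the chordal distance *)

Section svd.
Variable C : numClosedFieldType.

(** Induction on the number of zero columns of F. With none, the columns are normalised. Otherwise F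
    is singular, and a unit vector x orthogonal to all its columns is put in place of a zero column
    k. *)
Lemma orthogonal_cols_complete n (F : 'M[C]_n) (d : 'rV[C]_n) :
  (forall i, 0 <= d 0 i) -> F ^t* *m F = diag_mx d ->
  exists2 X : 'M[C]_n, X \is unitarymx & F = X *m diag_mx (map_mx sqrtC d).
Proof.
have [m] := ubnP #|[pred i | d 0 i == 0]|; elim: m F d => // m IH F d dm d0 FF.
have [/forallP d_neq0|/forallPn[k /negPn/eqP dk0]] := boolP [forall i, d 0 i != 0].
  pose S := diag_mx (map_mx (fun x => (sqrtC x)^-1) d).
  have s0 i : sqrtC (d 0 i) != 0 by rewrite sqrtC_eq0.
  have SS : S *m diag_mx (map_mx sqrtC d) = 1%:M.
    rewrite mulmx_diag -diag_const_mx; congr diag_mx; apply/rowP => i.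
    by rewrite !mxE mulVf.
  exists (F *m S); last by rewrite -mulmxA SS mulmx1.
  suff /mulmx1C FS : (F *m S) ^t* *m (F *m S) = 1%:M by apply/unitarymxP.
  rewrite adjmxM !mulmxA -(mulmxA _ (F ^t*)) FF adjmx_diag !mulmx_diag.
  rewrite -diag_const_mx; congr diag_mx; apply/rowP => i; rewrite !mxE.
  rewrite geC0_conj ?invr_ge0 ?sqrtC_ge0 // -{2}[d 0 i]sqrtCK expr2 mulrA.
  by rewrite mulVf // mul1r divff.
have Fk : F *m delta_mx k 0 = 0 :> 'cV_n.
  rewrite -colE; apply/eqP; rewrite -normsq_eq0 /normsq.
  have /matrixP/(_ k k) := FF; rewrite [in RHS]mxE eqxx dk0 mul0rn => <-.
  by rewrite !mxE; apply/eqP; apply: eq_bigr => i _; rewrite !mxE.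
have detF : \det F = 0.
  apply/eqP; apply/negPn/negP => F0.
  have uF : F \in unitmx by rewrite unitmxE unitfE.
  have := congr1 (mulmx (invmx F)) Fk; rewrite mulKmx // mulmx0.
  by move/matrixP/(_ k 0)/eqP; rewrite !mxE !eqxx oner_eq0.
have [v v0 vF] : exists2 v : 'rV_n, v != 0 & v *m F = 0 by apply/det0P/eqP.
pose x := (sqrtC (normsq (v ^t*)))^-1 *: v ^t*.
have nv0 : normsq (v ^t*) != 0.
  by rewrite normsq_eq0; apply: contra v0 => /eqP e; rewrite -[v]trmxCK e adjmx0.
have xx : x ^t* *m x = 1%:M.
  apply/matrixP => i j; rewrite !ord1 [RHS]mxE.
  have : normsq x = 1; last by rewrite /normsq => ->.
  rewrite normsqZ normrV ?unitfE ?sqrtC_eq0 // ger0_norm ?sqrtC_ge0 ?normsq_ge0 //.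
  by rewrite exprVn sqrtCK mulVf.
have Fx : F ^t* *m x = 0.
  by rewrite /x -scalemxAr -adjmxM vF adjmx0 scaler0.
have xF : x ^t* *m F = 0 by rewrite -[LHS]trmxCK adjmxM trmxCK Fx adjmx0.
pose e : 'rV[C]_n := delta_mx 0 k.
have ee : e ^t* *m e = diag_mx (delta_mx 0 k).
  apply/matrixP => i j; rewrite !mxE big_ord1 !mxE eqxx /=.
  rewrite conjC_nat -natrM mulnb; case: (i =P j) => [->|ij] /=.
    by rewrite andbb.
  by case: eqP => // ik; case: eqP => // jk; case: ij; rewrite ik jk.
pose F' := F + x *m e.
pose d' : 'rV[C]_n := d + delta_mx 0 k.
have [|||X Xu eF'] := IH F' d'.
- rewrite -ltnS (leq_trans _ dm) // ltnS [X in (_ < X)%N](cardD1 k) inE dk0 eqxx.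
  rewrite add1n ltnS; apply: subset_leq_card; apply/fintype.subsetP => i.
  rewrite !inE !mxE eqxx /=; have [->|_] := eqVneq i k => /=.
    by rewrite dk0 add0r oner_eq0.
  by rewrite addr0.
- by move=> i; rewrite !mxE addr_ge0 // ler0n.
- rewrite adjmxD adjmxM mulmxDl !mulmxDr FF !mulmxA Fx mul0mx addr0.
  rewrite -(mulmxA _ _ F) xF mulmx0 add0r -(mulmxA _ _ x) xx mulmx1 ee.
  by rewrite -linearD.
exists X => //.
have -> : F = F' *m diag_mx (const_mx 1 - delta_mx 0 k).
  rewrite /F' linearB /= diag_const_mx mulmxBr mulmx1 mulmxDl.
  have -> : F *m diag_mx (delta_mx 0 k) = 0.
    rewrite -ee -[X in _ *m (X *m _)](_ : delta_mx k 0 = _).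
      by rewrite mulmxA Fk mul0mx.
    by rewrite /e trmx_delta map_delta_mx.
  rewrite add0r -ee (mulmxA (x *m e)) -(mulmxA x e).
  have -> : e *m e ^t* = 1%:M.
    apply/matrixP => i j; rewrite !ord1 mxE (bigD1 k) //= big1 ?addr0.
      by rewrite !mxE !eqxx conjC1 mulr1.
    by move=> l lk; rewrite !mxE (negbTE lk) andbF mul0r.
  by rewrite mulmx1 addrK.
rewrite eF' -mulmxA mulmx_diag; congr (_ *m diag_mx _); apply/rowP => i.
rewrite !mxE eqxx /=; have [->|_] := eqVneq i k.
  by rewrite subrr mulr0 dk0 sqrtC0.
by rewrite subr0 mulr1 addr0.
Qed.

(** The columns of A U^H, for U diagonalising A^H A, are orthogonal and are completed to a unitary
    matrix even when A is singular. The decreasing order matches the recursive definition of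
    principal vectors. *)
Lemma singular_value_decomposition n (A : 'M[C]_n) :
  exists X Y : 'M[C]_n, exists s : 'rV[C]_n,
    [/\ X \is unitarymx, Y \is unitarymx, X ^t* *m A *m Y = diag_mx s,
        forall i, 0 <= s 0 i & forall i j : 'I_n, (i <= j)%N -> s 0 j <= s 0 i].
Proof.
have [|U [d [Uu d0 eA]]] := @psd_spectral C n (A ^t* *m A).
  by have := psd_mul_adj (A ^t*); rewrite trmxCK.
have [|X Xu eF] := orthogonal_cols_complete (F := A *m U ^t*) d0.
  rewrite adjmxM trmxCK !mulmxA -(mulmxA U (A ^t*)) eA !mulmxA.
  by rewrite unitarymx_adjr // mul1mx mulmxtVK.
pose s : 'rV[C]_n := map_mx sqrtC d.
have s0 i : 0 <= s 0 i by rewrite mxE sqrtC_ge0.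
pose ge_s := fun i j : 'I_n => s 0 j <= s 0 i.
pose l := sort ge_s (enum 'I_n).
have sl : size l = n by rewrite size_sort size_enum_ord.
pose f (i : 'I_n) := nth i l i.
have f_inj : injective f.
  move=> i j; rewrite /f (set_nth_default i j) ?sl // => /eqP.
  rewrite nth_uniq ?sl // ?sort_uniq ?enum_uniq // => /eqP.
  exact: val_inj.
have f_s (i j : 'I_n) : (i <= j)%N -> s 0 (f j) <= s 0 (f i).
  move=> ij; rewrite /f (set_nth_default i j) ?sl //.
  have : sorted ge_s l by apply: sort_sorted => ? ?; rewrite /ge_s ger_leVge.
  move=> /(sorted_leq_nth _ _ i) srt.
  apply: (srt _ _ i j) => //; rewrite ?inE ?sl //; last by move=> k; exact: lexx.
  by move=> a b c h1 h2; exact: le_trans h2 h1.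
have adjsub m (Z : 'M[C]_(m, n)) : (colsub f Z) ^t* = rowsub f (Z ^t*).
  by apply/matrixP => i j; rewrite !mxE.
have subu (Z : 'M[C]_n) : Z \is unitarymx -> colsub f Z \is unitarymx.
  move=> Zu; apply/unitarymxP/mulmx1C; rewrite adjsub mul_rowsub_mx mulmx_colsub.
  rewrite unitarymx_adjl //; apply/matrixP => i j; rewrite !mxE.
  by rewrite (inj_eq f_inj).
exists (colsub f X), (colsub f (U ^t*)), (\row_i s 0 (f i)).
split; [exact: subu | by apply: subu; rewrite trmxC_unitary | |
        by move=> i; rewrite mxE | by move=> i j ij; rewrite mxE [leRHS]mxE f_s].
rewrite -mulmxA mulmx_colsub eF adjsub mul_rowsub_mx mulmx_colsub mulmxA.
rewrite unitarymx_adjl // mul1mx; apply/matrixP => i j; rewrite !mxE.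
by rewrite (inj_eq f_inj).
Qed.

(* [2 |x y| <= |x|^2 + |y|^2] termwise. *)
Lemma normr_dot_le n (u v : 'cV[C]_n) (s : 'rV[C]_n) (c : C) :
  (forall i, 0 <= s 0 i) -> (forall i, u i 0 != 0 -> s 0 i <= c) ->
  normsq u = 1 -> normsq v = 1 ->
  `|(u ^t* *m diag_mx s *m v) 0 0| <= c.
Proof.
move=> s0 sc u1 v1; rewrite -mulmxA mul_diag_mx mxE.
apply: le_trans (ler_norm_sum _ _ _) _.
have -> : c = \sum_i (c * ((`|u i 0| ^+ 2 + `|v i 0| ^+ 2) / 2)).
  rewrite -mulr_sumr -mulr_suml big_split /= -!normsqE u1 v1.
  by rewrite -[1 + 1]/(2%:R) divff ?mulr1 ?pnatr_eq0.
have [i0 ui0] : exists i, u i 0 != 0.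
  apply/existsP; apply: contraTT isT => /existsPn u0.
  have : normsq u = 0.
    rewrite normsqE big1 // => i _.
    by have /negPn/eqP-> := u0 i; rewrite normr0 expr0n.
  by rewrite u1 => /eqP; rewrite oner_eq0.
have c0 : 0 <= c := le_trans (s0 i0) (sc _ ui0).
apply: ler_sum => i _; rewrite !mxE normrM normrM norm_conjC (ger0_norm (s0 i)).
have [->|ui] := eqVneq (u i 0) 0.
  rewrite normr0 mul0r mulr_ge0 // divr_ge0 ?ler0n // addr_ge0 ?exprn_ge0 //.
rewrite mulrCA ler_pM // ?s0 ?mulr_ge0 // ?sc //.
rewrite ler_pdivlMr ?ltr0n // -subr_ge0.
rewrite (_ : _ - _ = (`|u i 0| - `|v i 0|) ^+ 2); last first.
  by rewrite sqrrB addrAC mulr_natr.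
by rewrite -realEsqr rpredB // ger0_real.
Qed.

Lemma normr_dot_le1 n (u v : 'cV[C]_n) : normsq u = 1 -> normsq v = 1 ->
  `|(u ^t* *m v) 0 0| <= 1.
Proof.
move=> u1 v1; have := @normr_dot_le n u v (const_mx 1) 1 _ _ u1 v1.
by rewrite diag_const_mx mulmx1; apply => i; rewrite mxE ?ler01.
Qed.

Lemma normsq_pair n (j k : 'I_n) (a b : C) : j != k ->
  normsq (a *: delta_mx j 0 + b *: delta_mx k 0) = `|a| ^+ 2 + `|b| ^+ 2.
Proof.
move=> jk; rewrite normsqE (bigD1 j) //= (bigD1 k) ?(eq_sym k) //= big1 ?addr0.
  rewrite !mxE !eqxx (negbTE jk) (eq_sym k) (negbTE jk) /=.
  by rewrite !mulr1 !mulr0 addr0 add0r.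
move=> l /andP[lj lk]; rewrite !mxE (negbTE lj) (negbTE lk) /= !mulr0 addr0.
by rewrite normr0 expr0n.
Qed.

Lemma normsq_orthonormal m n (V : 'M[C]_(m, n)) (u : 'cV[C]_n) :
  V ^t* *m V = 1%:M -> normsq (V *m u) = normsq u.
Proof.
by move=> oV; rewrite /normsq adjmxM mulmxA -(mulmxA (u ^t*)) oV mulmx1.
Qed.

End svd.

Section complex_parts.
Variable R : rcfType.
Implicit Types x y : R[i].

Lemma Re_add x y : complex.Re (x + y) = complex.Re x + complex.Re y.
Proof. by case: x y => [? ?] [? ?]. Qed.

Lemma Im_add x y : complex.Im (x + y) = complex.Im x + complex.Im y.
Proof. by case: x y => [? ?] [? ?]. Qed.

Lemma Re_opp x : complex.Re (- x) = - complex.Re x.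
Proof. by case: x. Qed.

Lemma Re_mul x y :
  complex.Re (x * y) = complex.Re x * complex.Re y - complex.Im x * complex.Im y.
Proof. by case: x y => [? ?] [? ?]. Qed.

Lemma Im_mul x y :
  complex.Im (x * y) = complex.Re x * complex.Im y + complex.Im x * complex.Re y.
Proof. by case: x y => [? ?] [? ?]. Qed.

Lemma Re_cconj x : complex.Re (Num.conj x) = complex.Re x.
Proof. by case: x. Qed.

Lemma Im_cconj x : complex.Im (Num.conj x) = - complex.Im x.
Proof. by case: x. Qed.

Lemma Re_sum I (r : seq I) (Q : pred I) (F : I -> R[i]) :
  complex.Re (\sum_(i <- r | Q i) F i) = \sum_(i <- r | Q i) complex.Re (F i).
Proof. by apply: (big_morph _ Re_add). Qed.

Lemma Re_nat n : complex.Re (n%:R : R[i]) = n%:R.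
Proof. by elim: n => // n IH; rewrite -!natr1 Re_add IH. Qed.

Lemma normCR2 x : `|x| ^+ 2 = ((complex.Re x ^+ 2 + complex.Im x ^+ 2)%:C)%C.
Proof. by rewrite -add_Re2_Im2. Qed.

End complex_parts.

Section chordal.
Variables (R : realType) (M N : nat).
Implicit Types A W U V : 'M[R[i]]_(M, N).

Lemma in_colspaceP A (u : 'cV[R[i]]_M) :
  in_colspace A u <-> exists x : 'cV_N, u = A *m x.
Proof.
split=> [/submxP[D e]|[x ->]]; last by rewrite /in_colspace trmx_mul submxMl.
by exists D^T; rewrite -[u]trmxK e trmx_mul trmxK.
Qed.

Lemma unit_cvecE (u : 'cV[R[i]]_M) : unit_cvec u <-> normsq u = 1.
Proof.
split=> [e|e]; first by rewrite /normsq e mxE.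
by apply/matrixP => i j; rewrite !ord1 [RHS]mxE -e.
Qed.

Lemma colspace_sub A U : (forall k, in_colspace A (col k U)) ->
  exists T : 'M[R[i]]_N, U = A *m T.
Proof.
move=> sU; have /submxP[D e] : (U^T <= A^T)%MS.
  by apply/row_subP => k; rewrite -tr_col; exact: sU.
by exists D^T; rewrite -[U]trmxK e trmx_mul trmxK.
Qed.

Lemma orthonormal_col U k : orthonormal_cols U -> normsq (col k U) = 1.
Proof.
move=> oU; have <- : (U ^t* *m U) k k = 1 by rewrite oU mxE eqxx.
by rewrite /normsq !mxE; apply: eq_bigr => i _; rewrite !mxE.
Qed.

Lemma adj_col_mulE m U (X : 'M[R[i]]_(M, m)) j :
  (col j U) ^t* *m X = row j (U ^t* *m X).
Proof. by rewrite row_mul; congr (_ *m _); apply/rowP => i; rewrite !mxE. Qed.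

(** N orthonormal vectors in the column space of A must span it. In particular a matrix of rank
    below N has no principal vectors at all. *)
Lemma orthonormal_proj A U : orthonormal_cols U ->
  (forall k, in_colspace A (col k U)) ->
  \rank A = N /\ 1%:M - U *m U ^t* = kerproj (A *m A ^t*).
Proof.
move=> oU /colspace_sub[T eU]; have rU := orthonormal_rank oU.
have rA : \rank A = N.
  apply/eqP; rewrite eqn_leq rank_leq_col -{1}rU eU -(mxrank_tr (A *m T)) -(mxrank_tr A).
  by rewrite trmx_mul mxrankM_maxr.
have uT : T \in unitmx.
  rewrite -row_free_unit /row_free eqn_leq rank_leq_row -{1}rU eU.
  by rewrite mxrankM_maxr.
have eA : A = U *m invmx T by rewrite eU mulmxK.
split=> //; apply: kerproj_uniq; first exact: psd_mul_adj.
- by rewrite adjmxD adjmxN adjmx1 adjmxM trmxCK.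
- have UA : A ^t* *m (U *m U ^t*) = A ^t*.
    by rewrite eA adjmxM !mulmxA -(mulmxA _ _ U) oU mulmx1.
  by rewrite mulmxBr mulmx1 -mulmxA UA subrr.
- move=> p X AX; have A'X : A ^t* *m X = 0.
    by apply: adjmx_mul_eq0; rewrite adjmxM trmxCK -mulmxA (mulmxA A) AX mulmx0.
  rewrite mulmxBl mul1mx -mulmxA.
  have -> : U ^t* *m X = 0 by rewrite eU adjmxM -mulmxA A'X mulmx0.
  by rewrite mulmx0 subr0.
Qed.

Lemma ler_normr_normc (x : R[i]) (y : R[i]) : 0 <= x -> x <= y -> complex.Re x <= complex.Re y.
Proof. by move=> _; rewrite lecE => /andP[]. Qed.

(** If c_jk were nonzero for some k > j, the unit combination of v_j and v_k with weights
    proportional to the conjugates of c_jj and c_jk would be admissible at step j and reach sqrt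
    (|c_jj|^2 + |c_jk|^2), above the maximum |c_jj|. *)
Lemma principal_offdiag A W U V (j k : 'I_N) : principal_vectors A W U V -> j != k ->
  (U ^t* *m V) j k = 0.
Proof.
move=> [oU oV sU sV mx].
(* The case k < j follows by exchanging the two spaces, which replaces U^H V by its adjoint. *)
wlog jk : A W U V oU oV sU sV mx j k / (j < k)%N => [wlg|] jk'.
  have [lt|gt|/val_inj e] := ltngtP j k; first exact: (wlg A W).
    have := wlg W A V U oV oU sV sU _ k j gt.
    rewrite eq_sym jk' => /(_ _ isT) e.
    have : (V ^t* *m U) k j = 0.
      apply: e => l u v u1 Wu ul v1 Av vl; rewrite -(norm_conjC (_ 0 0)) -[leRHS]norm_conjC.
      have := mx l v u v1 Av vl u1 Wu ul.
      have -> : (v ^t* *m u) 0 0 = ((u ^t* *m v) 0 0)^*.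
        by rewrite -[v ^t* *m u]trmxCK adjmxM trmxCK !mxE.
      have -> // : (U ^t* *m V) l l = ((V ^t* *m U) l l)^*.
      by rewrite -[U ^t* *m V]trmxCK adjmxM trmxCK !mxE.
    move=> e2; rewrite -[U ^t* *m V]trmxCK adjmxM trmxCK mxE mxE e2.
    by rewrite conjC0.
  by rewrite e eqxx in jk'.
set c := U ^t* *m V; pose n2 := `|c j j| ^+ 2 + `|c j k| ^+ 2.
apply/eqP; apply/negPn/negP => cjk.
have n2gt : 0 < n2 by rewrite ltr_wpDl ?exprn_ge0 // exprn_gt0 // normr_gt0.
have s2 : sqrtC n2 ^+ 2 = n2 by rewrite sqrtCK.
have s0 : 0 < sqrtC n2 by rewrite sqrtC_gt0.
pose x : 'cV[R[i]]_N := (sqrtC n2)^-1 *: ((c j j)^* *: delta_mx j 0 + (c j k)^* *: delta_mx k 0).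
have Vx l : (U ^t* *m (V *m x)) l 0 = (sqrtC n2)^-1 * ((c j j)^* * c l j + (c j k)^* * c l k).
  rewrite mulmxA -/c /x -scalemxAr mulmxDr -!scalemxAr -!colE !mxE.
  by [].
have x1 : normsq x = 1.
  rewrite /x normsqZ normrV ?unitfE ?gt_eqF // gtr0_norm // exprVn s2.
  by rewrite normsq_pair // !norm_conjC mulVf // gt_eqF.
have := mx j (col j U) (V *m x).
rewrite adj_col_mulE mxE Vx.
have -> : (sqrtC n2)^-1 * ((c j j)^* * c j j + (c j k)^* * c j k) = sqrtC n2.
  by rewrite mulrC [_^* * _]mulrC [_^* * c j k]mulrC -!normCK -/n2 -{1}s2 expr2 mulfK ?gt_eqF.
move=> h.
have : `|sqrtC n2| <= `|c j j|.
  apply: h => //.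
  - by apply/unit_cvecE; exact: orthonormal_col.
  - move=> l lj; rewrite adj_col_mulE colE mulmxA oU mul1mx.
    apply/matrixP => a b; rewrite !ord1 !mxE.
    by rewrite (_ : l == j = false) //; apply: contraTF lj => /eqP->; rewrite ltnn.
  - by apply/unit_cvecE; rewrite normsq_orthonormal.
  - have [Z eV] := colspace_sub sV.
    by apply/in_colspaceP; exists (Z *m x); rewrite eV mulmxA.
  - move=> l lj; rewrite adj_col_mulE mulmxA oV mul1mx; apply/matrixP => a b.
    rewrite !ord1 !mxE (_ : l == j = false); last first.
      by apply: contraTF lj => /eqP->; rewrite ltnn.
    rewrite (_ : l == k = false) /= ?mulr0 ?addr0 ?mulr0 //.
    by apply: contraTF (ltn_trans lj jk) => /eqP->; rewrite ltnn.
rewrite gtr0_norm // -(ler_pXn2r (n := 2)) ?nnegrE ?normr_ge0 ?(ltW s0) // s2.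
rewrite /n2 gerDl; apply/negP; rewrite lt_geF // exprn_gt0 // normr_gt0 //.
Qed.

(** The singular vectors of V0^H W, in decreasing order, are principal: a competitor u at step k has
    no coordinate of index below k, and [normr_dot_le] bounds it by the k-th singular value. *)
Lemma principal_vectors_exist A W : \rank A = N -> orthonormal_cols W ->
  exists U V, principal_vectors A W U V.
Proof.
move=> /gram_schmidt[V0 [T [oV0 uT] eA]] oW.
have [X [Y [s [Xu Yu e s0 s_dec]]]] := singular_value_decomposition (V0 ^t* *m W).
have oU : orthonormal_cols (V0 *m X).
  by rewrite /orthonormal_cols adjmxM mulmxA -(mulmxA (X ^t*)) oV0 mulmx1 unitarymx_adjl.
have oV : orthonormal_cols (W *m Y).
  by rewrite /orthonormal_cols adjmxM mulmxA -(mulmxA (Y ^t*)) oW mulmx1 unitarymx_adjl.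
have UV : (V0 *m X) ^t* *m (W *m Y) = diag_mx s by rewrite adjmxM -e !mulmxA.
have eV0 : V0 = A *m invmx T by rewrite eA mulmxK.
exists (V0 *m X), (W *m Y); split=> // [k|k|k u v].
- apply/in_colspaceP; exists (invmx T *m X *m delta_mx k 0).
  by rewrite colE !mulmxA -eV0.
- by apply/in_colspaceP; exists (Y *m delta_mx k 0); rewrite colE mulmxA.
move=> /unit_cvecE u1 /in_colspaceP[a0 ua] ul /unit_cvecE v1 /in_colspaceP[b0 vb] vl.
pose a := (V0 *m X) ^t* *m u; pose b := (W *m Y) ^t* *m v.
have eu : u = V0 *m X *m a.
  rewrite /a adjmxM !mulmxA -(mulmxA V0) unitarymx_adjr // mulmx1 ua eA.
  by rewrite !mulmxA -(mulmxA V0 _ V0) oV0 mulmx1.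
have ev : v = W *m Y *m b.
  rewrite /b adjmxM !mulmxA -(mulmxA W) unitarymx_adjr // mulmx1 vb.
  by rewrite !mulmxA -(mulmxA W _ W) oW mulmx1.
have a1 : normsq a = 1.
  by rewrite -(normsq_orthonormal a oU) -eu.
have b1 : normsq b = 1.
  by rewrite -(normsq_orthonormal b oV) -ev.
have -> : u ^t* *m v = a ^t* *m diag_mx s *m b.
  by rewrite eu ev adjmxM !mulmxA -(mulmxA (a ^t*) _ W) -(mulmxA (a ^t*)) -(mulmxA _ W) UV.
rewrite UV [X in _ <= `|X|]mxE eqxx mulr1n (ger0_norm (s0 k)); apply: normr_dot_le => // l al.
apply: s_dec; rewrite leqNgt; apply: contra al => lk.
have := ul l lk; rewrite adj_col_mulE -/a => /matrixP/(_ 0 0).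
by rewrite !mxE => ->.
Qed.

Lemma sin_acos_sqr (x : R) : 0 <= x <= 1 -> sin (acos x) ^+ 2 = 1 - x ^+ 2.
Proof.
move=> /andP[x0 x1].
have x11 : -1 <= x <= 1 by rewrite x1 (le_trans _ x0) // lerN10.
by rewrite -[X in 1 - X ^+ 2](acosK x11) sin2cos2.
Qed.

(** The off-diagonal entries of c = U^H V vanish, so the sum of the squared cosines |c_kk|^2 is the
    whole trace of U U^H V V^H. The value therefore does not depend on the choice of principal
    vectors. *)
Lemma principal_angles_sum A W (t : 'rV[R]_N) : orthonormal_cols W ->
  principal_angles A W t ->
  \sum_(k < N) sin (t 0 k) ^+ 2 =
  complex.Re (\tr (kerproj (A *m A ^t*) *m (W *m W ^t*))).
Proof.
move=> oW [U [V [pv tE]]]; have [oU oV sU sV _] := pv.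
have [rA <-] := orthonormal_proj oU sU.
have [_ eV] := orthonormal_proj oV sV.
have [_ eW] : \rank W = N /\ 1%:M - W *m W ^t* = kerproj (W *m W ^t*).
  by apply: orthonormal_proj => // k; apply/in_colspaceP; exists (delta_mx k 0); rewrite colE.
have VW : V *m V ^t* = W *m W ^t*.
  by have /addrI/oppr_inj := etrans eV (esym eW).
rewrite -VW mulmxBl mul1mx linearB /= mxtrace_mulC oV mxtrace1.
set c := U ^t* *m V.
have -> : \tr (U *m U ^t* *m (V *m V ^t*)) = \sum_k `|c k k| ^+ 2.
  rewrite -mulmxA mxtrace_mulC -!mulmxA (mulmxA (U ^t*)) -/c.
  have -> : V ^t* *m U = c ^t* by rewrite /c adjmxM trmxCK.
  apply: eq_bigr => k _; rewrite [(_ *m _) k k]mxE (bigD1 k) //= big1 ?addr0.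
    by rewrite [(c ^t*) k k]mxE [c^T k k]mxE normCK.
  by move=> j jk; rewrite (principal_offdiag pv) ?mul0r // eq_sym.
have c01 k : 0 <= complex.Re `|c k k| <= 1.
  have : 0 <= `|c k k| <= 1.
    rewrite normr_ge0 /= /c.
    have -> : (U ^t* *m V) k k = ((col k U) ^t* *m col k V) 0 0.
      by rewrite adj_col_mulE !mxE; apply: eq_bigr => i _; rewrite !mxE.
    by apply: normr_dot_le1; exact: orthonormal_col.
  by rewrite !lecE => /andP[/andP[_ ->] /andP[_ ->]].
under eq_bigr => k _ do rewrite tE sin_acos_sqr ?c01 //.
rewrite -/c sumrB sumr_const card_ord Re_add Re_opp Re_sum Re_nat; congr (_ - _).
by apply: eq_bigr => k _; rewrite [in RHS]expr2 Re_mul (ger0_Im (normr_ge0 _)) mul0r subr0.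
Qed.

(** Below rank N no row of principal angles exists and [xget] returns the zero row, whose sines
    vanish; this is the second branch. *)
Lemma chordal_dist_sqr A W : orthonormal_cols W ->
  chordal_dist A W ^+ 2 =
  if \rank A == N then complex.Re (\tr (kerproj (A *m A ^t*) *m (W *m W ^t*))) else 0.
Proof.
move=> oW; rewrite /chordal_dist sqr_sqrtr; last first.
  by apply: sumr_ge0 => k _; rewrite sqr_ge0.
case: eqP => [rA|rA].
  have [U [V pv]] := principal_vectors_exist rA oW.
  apply: principal_angles_sum => //.
  apply: (@xgetI _ 0 _ (\row_k acos (complex.Re `|(U ^t* *m V) k k|))).
  by exists U, V; split=> // k; rewrite mxE.
rewrite xgetPN ?big1 // => [k _|t]; first by rewrite mxE sin0 expr0n.
by move=> [U [V [[oU _ sU _ _] _]]]; apply: rA; have [] := orthonormal_proj oU sU.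
Qed.

End chordal.

(** * Measurability of matrix-valued functions *)

Section complex_measurability.
Context d (S : measurableType d) (R : realType).
Implicit Types f g : S -> R[i].

Definition cmeasurable f :=
  measurable_fun setT (fun s => complex.Re (f s)) /\
  measurable_fun setT (fun s => complex.Im (f s)).

Lemma cmeasurable_cst (z : R[i]) : cmeasurable (fun=> z).
Proof. by split; exact: measurable_cst. Qed.

Lemma cmeasurableD f g : cmeasurable f -> cmeasurable g ->
  cmeasurable (fun s => f s + g s).
Proof.
move=> [rf mf] [rg mg]; split.
  by under eq_fun do rewrite Re_add; exact: measurable_funD.
by under eq_fun do rewrite Im_add; exact: measurable_funD.
Qed.

Lemma cmeasurableM f g : cmeasurable f -> cmeasurable g ->
  cmeasurable (fun s => f s * g s).
Proof.
move=> [rf mf] [rg mg]; split.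
  by under eq_fun do rewrite Re_mul; apply: measurable_funB; exact: measurable_funM.
by under eq_fun do rewrite Im_mul; apply: measurable_funD; exact: measurable_funM.
Qed.

Lemma cmeasurable_conj f : cmeasurable f -> cmeasurable (fun s => Num.conj (f s)).
Proof.
move=> [rf mf]; split; first by under eq_fun do rewrite Re_cconj.
by under eq_fun do rewrite Im_cconj; exact: measurable_funN.
Qed.

Lemma cmeasurable_sum I (r : seq I) (Q : pred I) (F : I -> S -> R[i]) :
  (forall i, Q i -> cmeasurable (F i)) ->
  cmeasurable (fun s => \sum_(i <- r | Q i) F i s).
Proof.
move=> mF; elim: r => [|i r IH].
  by under eq_fun do rewrite big_nil; exact: cmeasurable_cst.
under eq_fun do rewrite big_cons.
by case: (boolP (Q i)) => [/mF mi|_] //; exact: cmeasurableD.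
Qed.

Lemma cmeasurable_prod I (r : seq I) (Q : pred I) (F : I -> S -> R[i]) :
  (forall i, Q i -> cmeasurable (F i)) ->
  cmeasurable (fun s => \prod_(i <- r | Q i) F i s).
Proof.
move=> mF; elim: r => [|i r IH].
  by under eq_fun do rewrite big_nil; exact: cmeasurable_cst.
under eq_fun do rewrite big_cons.
by case: (boolP (Q i)) => [/mF mi|_] //; exact: cmeasurableM.
Qed.

Lemma cmeasurableV f : cmeasurable f -> cmeasurable (fun s => (f s)^-1).
Proof.
move=> [rf mf].
pose n s := (complex.Re (f s)) ^+ 2 + (complex.Im (f s)) ^+ 2.
(* Written as a real power the inverse is measurable, also where [n s] is 0: both conventions give 0
   there. *)
have mn : measurable_fun setT (fun s => (n s)^-1).
  have -> : (fun s => (n s)^-1) = (fun s => powR (n s) (-1)).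
    by apply/funext => s; rewrite powR_inv1 // addr_ge0 ?sqr_ge0.
  apply: (measurableT_comp (measurable_powR (-1))).
  by apply: measurable_funD; exact: measurable_funX.
split.
  rewrite (_ : (fun s => _) = (fun s => complex.Re (f s) * (n s)^-1)).
    exact: measurable_funM.
  by apply/funext => s; rewrite /n; case: (f s).
rewrite (_ : (fun s => _) = (fun s => - (complex.Im (f s) * (n s)^-1))).
  by apply: measurable_funN; exact: measurable_funM.
by apply/funext => s; rewrite /n; case: (f s).
Qed.

Lemma cmeasurable_if (b : S -> bool) f g : measurable_fun setT b ->
  cmeasurable f -> cmeasurable g -> cmeasurable (fun s => if b s then f s else g s).
Proof.
move=> mb [rf mf] [rg mg]; split.
  rewrite (_ : (fun s => _) = (fun s => if b s then complex.Re (f s) else complex.Re (g s))).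
    exact: measurable_fun_ifT.
  by apply/funext => s; case: (b s).
rewrite (_ : (fun s => _) = (fun s => if b s then complex.Im (f s) else complex.Im (g s))).
  exact: measurable_fun_ifT.
by apply/funext => s; case: (b s).
Qed.

Lemma cmeasurableP f : measurable_fun setT f <-> cmeasurable f.
Proof.
split=> [mf|[rf mf]]; last first.
  apply: (measurability (preimage_set_system setT (@complex.Re R) measurable `|`
        preimage_set_system setT (@complex.Im R) measurable)) => //.
  move=> _ [A [[B mB <-]|[B mB <-]] <-]; rewrite !setTI.
    by rewrite -[X in measurable X]setTI; exact: rf.
  by rewrite -[X in measurable X]setTI; exact: mf.
split=> _ B mB.
  rewrite setTI -[X in measurable X]setTI.
  apply: (mf measurableT (@complex.Re R @^-1` B)).
  by apply: sub_sigma_algebra; left; exists B; rewrite ?setTI.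
rewrite setTI -[X in measurable X]setTI.
apply: (mf measurableT (@complex.Im R @^-1` B)).
by apply: sub_sigma_algebra; right; exists B; rewrite ?setTI.
Qed.

Definition mxmeasurable m n (F : S -> 'M[R[i]]_(m, n)) :=
  forall i j, cmeasurable (fun s => F s i j).

Lemma mxmeasurableP m n (F : S -> 'M[R[i]]_(m, n)) :
  measurable_fun setT F <-> mxmeasurable F.
Proof.
split=> [mF i j|mF].
  apply/cmeasurableP => _ B mB; rewrite setTI -[X in measurable X]setTI.
  apply: (mF measurableT ((fun X : 'M[R[i]]_(m, n) => X i j) @^-1` B)).
  by apply: sub_sigma_algebra; exists (i, j) => //; exists B; rewrite ?setTI.
apply: (measurability (\bigcup_(p in [set: 'I_m * 'I_n])
          preimage_set_system setT (fun X : 'M[R[i]]_(m, n) => X p.1 p.2)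
            measurable)) => //.
move=> _ [A [[i j] _ [B mB <-]] <-]; rewrite !setTI.
rewrite -[X in measurable X]setTI.
by have /cmeasurableP := mF i j; exact.
Qed.

Lemma mxmeasurable_cst m n (A : 'M[R[i]]_(m, n)) : mxmeasurable (fun=> A).
Proof. by move=> i j; exact: cmeasurable_cst. Qed.

Lemma mxmeasurable_mul m n p (F : S -> 'M[R[i]]_(m, n)) (G : S -> 'M[R[i]]_(n, p)) :
  mxmeasurable F -> mxmeasurable G -> mxmeasurable (fun s => F s *m G s).
Proof.
move=> mF mG i j; under eq_fun do rewrite mxE.
by apply: cmeasurable_sum => k _; exact: cmeasurableM.
Qed.

Lemma mxmeasurable_add m n (F G : S -> 'M[R[i]]_(m, n)) :
  mxmeasurable F -> mxmeasurable G -> mxmeasurable (fun s => F s + G s).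
Proof.
by move=> mF mG i j; under eq_fun do rewrite mxE; exact: cmeasurableD.
Qed.

Lemma mxmeasurable_scale m n (f : S -> R[i]) (F : S -> 'M[R[i]]_(m, n)) :
  cmeasurable f -> mxmeasurable F -> mxmeasurable (fun s => f s *: F s).
Proof.
by move=> mF mG i j; under eq_fun do rewrite mxE; exact: cmeasurableM.
Qed.

Lemma mxmeasurable_sum m n I (r : seq I) (Q : pred I) (F : I -> S -> 'M[R[i]]_(m, n)) :
  (forall i, Q i -> mxmeasurable (F i)) ->
  mxmeasurable (fun s => \sum_(i <- r | Q i) F i s).
Proof.
move=> mF i j; under eq_fun do rewrite summxE.
by apply: cmeasurable_sum => k /mF; exact.
Qed.

Lemma mxmeasurable_adj m n (F : S -> 'M[R[i]]_(m, n)) :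
  mxmeasurable F -> mxmeasurable (fun s => (F s) ^t*).
Proof.
move=> mF i j; under eq_fun do rewrite !mxE.
exact: cmeasurable_conj.
Qed.

Lemma cmeasurable_trace n (F : S -> 'M[R[i]]_n) :
  mxmeasurable F -> cmeasurable (fun s => \tr (F s)).
Proof. by move=> mF; apply: cmeasurable_sum => i _; exact: mF. Qed.

Lemma cmeasurable_det n (F : S -> 'M[R[i]]_n) :
  mxmeasurable F -> cmeasurable (fun s => \det (F s)).
Proof.
move=> mF; apply: cmeasurable_sum => p _.
apply: cmeasurableM; first exact: cmeasurable_cst.
by apply: cmeasurable_prod => i _; exact: mF.
Qed.

Lemma mxmeasurable_inv n (F : S -> 'M[R[i]]_n) : (forall s, F s \in unitmx) ->
  mxmeasurable F -> mxmeasurable (fun s => invmx (F s)).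
Proof.
move=> uF mF i j.
rewrite (_ : (fun s => _) = (fun s => (\det (F s))^-1 * (\adj (F s)) i j)); last first.
  by apply/funext => s; rewrite /invmx uF mxE.
apply: cmeasurableM; first by apply: cmeasurableV; exact: cmeasurable_det.
under eq_fun do rewrite mxE; apply: cmeasurableM; first exact: cmeasurable_cst.
apply: cmeasurable_det => k l; under eq_fun do rewrite !mxE; exact: mF.
Qed.

Lemma cmeasurable_lim (f_ : nat -> S -> R[i]) f :
  (forall n, cmeasurable (f_ n)) ->
  (forall s, (complex.Re (f_ n s) @[n --> \oo] --> complex.Re (f s))%classic) ->
  (forall s, (complex.Im (f_ n s) @[n --> \oo] --> complex.Im (f s))%classic) ->
  cmeasurable f.
Proof.
move=> mf rf imf; split.
  apply: (measurable_fun_cvg (h := fun n s => complex.Re (f_ n s))) => [n|s _].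
    by case: (mf n).
  exact: rf.
apply: (measurable_fun_cvg (h := fun n s => complex.Im (f_ n s))) => [n|s _].
  by case: (mf n).
exact: imf.
Qed.

End complex_measurability.

Lemma cvg_resolvent (R : realType) (r : R) : 0 <= r ->
  ((1 + n%:R * r)^-1 @[n --> \oo] --> ((r == 0)%:R : R))%classic.
Proof.
move=> r0; have [->|rn0] := eqVneq r 0.
  by under eq_fun do rewrite mulr0 addr0 invr1; exact: cvg_cst.
have r_gt0 : 0 < r by rewrite lt_def rn0.
apply/cvgrPdist_lt => e e0 /=.
near=> n.
rewrite sub0r normrN ger0_norm ?invr_ge0 ?addr_ge0 ?mulr_ge0 ?ler0n //.
have n0 : 0 <= n%:R * r by rewrite mulr_ge0 ?ler0n.
rewrite invf_plt ?posrE //; last by rewrite (lt_le_trans ltr01) // lerDl.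
apply: (@lt_trans _ _ (n%:R * r)); last by rewrite addrC ltrDl ltr01.
rewrite -ltr_pdivrMr //; near: n; exact: nbhs_infty_gtr.
Unshelve. all: by end_near.
Qed.

Section spectral_parts.
Variables (R : realType) (n : nat).

Lemma spectral_entry (U : 'M[R[i]]_n) (d : 'rV[R[i]]_n) i j :
  (U ^t* *m diag_mx d *m U) i j = \sum_k (U ^t*) i k * U k j * d 0 k.
Proof.
by rewrite mxE; apply: eq_bigr => k _; rewrite mul_mx_diag mxE mulrAC.
Qed.

(** [part] stands for the real or the imaginary part. The eigenvalues being real, additivity and
    homogeneity for real factors are enough to treat both at once. *)
Lemma cvg_spectral (part : R[i] -> R) (U : 'M[R[i]]_n) (d : 'rV[R[i]]_n) i j :
  (forall x y, part (x + y) = part x + part y) -> part 0 = 0 ->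
  (forall z (x : R), part (z * (x%:C)%C) = part z * x) -> (forall k, 0 <= d 0 k) ->
  (part ((U ^t* *m diag_mx (\row_k (1 + m%:R * d 0 k)^-1) *m U) i j) @[m --> \oo] -->
   part ((U ^t* *m diag_mx (\row_k (d 0 k == 0)%:R) *m U) i j))%classic.
Proof.
move=> pD p0 pM d0; pose r k := complex.Re (d 0 k).
have dr k : d 0 k = ((r k)%:C)%C.
  by rewrite /r; case: (d 0 k) (ger0_Im (d0 k)) => a b /= ->.
have r0 k : 0 <= r k by have := d0 k; rewrite dr lecR.
have pS (F : 'I_n -> R[i]) : part (\sum_k F k) = \sum_k part (F k).
  exact: (big_morph part pD p0).
have toR k m : (\row_k (1 + m%:R * d 0 k)^-1 : 'rV[R[i]]_n) 0 k =
    (((1 + m%:R * r k)^-1)%:C)%C.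
  by rewrite mxE dr -(rmorph_nat (real_complex R)) -rmorphM -(rmorph1 (real_complex R))
     -rmorphD -fmorphV.
rewrite spectral_entry pS.
under eq_fun do rewrite spectral_entry pS.
apply: cvg_big => [|k _]; first exact: add_continuous.
rewrite [X in part (_ * X)]mxE dr.
have -> : ((((r k)%:C)%C == 0)%:R : R[i]) = (((r k == 0)%:R : R)%:C)%C.
  by rewrite eq_complex /= eqxx andbT; case: eqP.
rewrite pM; under eq_fun do rewrite toR pM.
by apply: cvgM; [exact: cvg_cst|exact: cvg_resolvent].
Qed.

End spectral_parts.

Section kerproj_measurability.
Context d (S : measurableType d) (R : realType).

Lemma mxmeasurable_kerproj n (F : S -> 'M[R[i]]_n) : (forall s, psd (F s)) ->
  mxmeasurable F -> mxmeasurable (fun s => kerproj (F s)).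
Proof.
move=> pF mF i j.
apply: (cmeasurable_lim (f_ := fun k s => invmx (1%:M + k%:R *: F s) i j)).
- move=> k; apply: mxmeasurable_inv => [s|].
    rewrite unitmxE unitfE gt_eqF // (lt_le_trans ltr01) // psd_det1D //.
    by apply: psdZ; rewrite ?ler0n.
  apply: mxmeasurable_add; first exact: mxmeasurable_cst.
  by apply: mxmeasurable_scale => //; exact: cmeasurable_cst.
- move=> s; have [U [e [e0 -> eI]]] := kerproj_limit (pF s).
  under eq_fun do rewrite eI ?ler0n //.
  by apply: cvg_spectral => // [x y|z x]; rewrite ?Re_add // Re_mul /= mulr0 subr0.
- move=> s; have [U [e [e0 -> eI]]] := kerproj_limit (pF s).
  under eq_fun do rewrite eI ?ler0n //.
  by apply: cvg_spectral => // [x y|z x]; rewrite ?Im_add // Im_mul /= mulr0 add0r.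
Qed.

End kerproj_measurability.

(** * Independence *)

Section decoupling.
Context d (T : measurableType d) (R : realType) (P : probability T R).
Variables (I : finType) (F : I -> set (set T)).
Hypothesis F_indep : mutually_independent P F.
Hypothesis F_meas : forall x, F x `<=` measurable.
Hypothesis F_setT : forall x, F x setT.
Hypothesis F_setI : forall x, setI_closed (F x).
Implicit Types J : {set I}.

Definition joint_sets J : set (set T) := \bigcup_(x in [set` J]) F x.

(** Intersections with one set per source: a pi-system whose sigma-algebra contains the joint
    one. *)
Let rect J : set (set T) :=
  [set A | exists2 E, (forall x, F x (E x)) & A = \bigcap_(x in [set` J]) E x].

Let rect_joint J : <<s joint_sets J >> `<=` <<s rect J >>.
Proof.
apply: smallest_sub; first exact: smallest_sigma_algebra.
move=> A [x /= Jx FA]; apply: sub_gen_smallest; exists (fun y => if y == x then A else setT).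
  by move=> y; case: eqP => [->|].
apply/seteqP; split=> [w Aw y _|w Ew] /=; first by case: eqP.
by have := Ew x Jx; rewrite eqxx.
Qed.

Let rect_setI J : setI_closed (rect J).
Proof.
move=> _ _ [E FE ->] [E' FE' ->]; exists (fun x => E x `&` E' x) => [x|].
  exact: F_setI.
apply/seteqP; split=> [w [EJ E'J] x Jx|w EE]; first by split; [exact: EJ|exact: E'J].
by split=> x /EE[].
Qed.

Let rect_meas J : rect J `<=` measurable.
Proof.
move=> _ [E FE ->]; apply: fin_bigcap_measurable => // x _.
exact: (F_meas (FE x)).
Qed.

Let rect_setT J : rect J setT.
Proof. by exists (fun=> setT) => //; rewrite bigcapT. Qed.

Lemma joint_sets_meas J : <<s joint_sets J >> `<=` measurable.
Proof.
apply: smallest_sub; first exact: sigma_algebra_measurable.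
by move=> A [x _ /F_meas].
Qed.

Let rect_indep J J' A B : (forall x, x \in J -> x \notin J') -> rect J A -> rect J' B ->
  (P (A `&` B) = P A * P B)%E.
Proof.
move=> JJ' [E FE ->] [E' FE' ->].
pose E'' x := if x \in J then E x else E' x.
have -> : \bigcap_(x in [set` J]) E x `&` \bigcap_(x in [set` J']) E' x =
          \bigcap_(x in [set` J :|: J']) E'' x.
  apply/seteqP; split=> [w [EJ EJ'] x|w EE].
    rewrite /= inE /E''; case: ifP => [Jx _|_ /= Jx']; first exact: EJ.
    exact: EJ'.
  split=> x /= Jx; have := EE x; rewrite /= inE Jx ?orbT => /(_ isT).
    by rewrite /E'' Jx.
  by rewrite /E''; case: ifP => // Jx'; have := JJ' x Jx'; rewrite Jx.
rewrite !F_indep // => [|x xJ]; last by rewrite /E''; case: ifP.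
rewrite !(big_mkcond (fun x => x \in _)) -big_split; apply: eq_bigr => x _ /=.
rewrite inE /E''; case: (boolP (x \in J)) => [Jx|_] /=; last by rewrite mul1e.
by rewrite (negbTE (JJ' x Jx)) mule1.
Qed.

(** For fixed B the measures sending A to P (A [&] B) and to P A * P B agree on the pi-system G,
    hence on the sigma-algebra it generates. Applied once to each side, this carries independence
    from rectangles to sigma-algebras. *)
Let prob_indep_extend G G' : G `<=` measurable -> setI_closed G -> G setT ->
  G' `<=` measurable ->
  (forall A B, G A -> G' B -> (P (A `&` B) = P A * P B)%E) ->
  forall A B, <<s G >> A -> G' B -> (P (A `&` B) = P A * P B)%E.
Proof.
move=> Gm GI GT G'm ind A B sA G'B.
have mB := G'm _ G'B.
have PB : P B = (fine (P B))%:E by rewrite fineK // fin_num_measure.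
have PB0 : (0 <= fine (P B))%R by rewrite fine_ge0.
suff : mrestr P mB A = mscale (NngNum PB0) P A by rewrite /mscale /= -PB muleC.
apply: (g_sigma_algebra_measure_unique G Gm (fun=> setT)) => //.
- by rewrite bigcup_const //; exists 0%N.
- move=> C GC; change (P (C `&` B) = (fine (P B))%:E * P C)%E.
  by rewrite -PB muleC; exact: ind.
- by move=> _; change (P (setT `&` B) < +oo)%E; rewrite setTI PB ltry.
Qed.

Lemma joint_sets_indep J J' A B : (forall x, x \in J -> x \notin J') ->
  <<s joint_sets J >> A -> <<s joint_sets J' >> B -> (P (A `&` B) = P A * P B)%E.
Proof.
move=> JJ' /rect_joint sA /rect_joint sB.
rewrite setIC muleC.
apply: (prob_indep_extend (G := rect J') (G' := <<s rect J >>)) => //.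
  by apply: smallest_sub; first exact: sigma_algebra_measurable.
move=> {sA sB A B} B A rB sA; rewrite setIC muleC.
apply: (prob_indep_extend (G := rect J) (G' := rect J')) => //.
by move=> ? ?; exact: rect_indep.
Qed.

Notation sigma J := (g_sigma_algebraType (joint_sets J)).

Lemma joint_sets_id J : measurable_fun setT (id : T -> sigma J).
Proof. by move=> _ B /= sB; rewrite setTI; exact: (joint_sets_meas (J := J)). Qed.

(* The common sample point may be replaced by two independent ones. *)
Lemma decouple J J' (f : sigma J * sigma J' -> \bar R) : (forall x, x \in J -> x \notin J') ->
  measurable_fun setT f -> (forall z, 0 <= f z)%E ->
  (\int[P]_w f (w, w) = \int[P]_w' \int[P]_w f (w, w'))%E.
Proof.
move=> JJ' mf f0.
have mJ := @joint_sets_id J; have mJ' := @joint_sets_id J'.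
(* X and Y are the identity map into T with a coarser sigma-algebra. Independence says that the law
   of the diagonal map is the product of their laws, and Tonelli gives the iterated integral. *)
pose X : {RV P >-> sigma J} := HB.pack (id : T -> sigma J) (isMeasurableFun.Build _ _ _ _ _ mJ).
pose Y : {RV P >-> sigma J'} := HB.pack (id : T -> sigma J') (isMeasurableFun.Build _ _ _ _ _ mJ').
have mXY : measurable_fun setT (fun w : T => (w, w) : sigma J * sigma J').
  exact: measurable_fun_pair.
pose XY : {RV P >-> (sigma J * sigma J')%type} := HB.pack (fun w : T => (w, w) : sigma J * sigma J') (isMeasurableFun.Build _ _ _ _ _ mXY).
have XYE := product_measure_unique (m1 := distribution P X) (m2 := distribution P Y) (m' := distribution P XY).
transitivity (\int[distribution P XY]_z f z)%E.
  by rewrite ge0_integral_distribution.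
transitivity (\int[distribution P X \x distribution P Y]_z f z)%E.
  apply: eq_measure_integral => A mA _; apply/esym/XYE => // C B mC mB.
  exact: (joint_sets_indep JJ').
rewrite fubini_tonelli2 // ge0_integral_distribution //.
- apply: eq_integral => w' _ /=; rewrite /fubini_G ge0_integral_distribution //.
  have m2 : measurable_fun setT (fun y : sigma J => (y, w') : sigma J * sigma J').
    by apply: measurable_fun_pair => //; exact: measurable_cst.
  exact: (measurableT_comp mf m2).
- exact: measurable_fun_fubini_tonelli_G.
- by move=> w'; apply: integral_ge0.
Qed.

End decoupling.

(** * Rotation invariance of the normal law *)

(** Multiplied by e^y, the claim reads f 0 <= f y for f x = e^(2x) - 2 x e^x, whose derivative 2 e^x
    (e^x - 1 - x) is nonnegative. *)
Lemma expR_subN_ge (R : realType) (y : R) : 0 <= y -> 2 * y <= expR y - expR (- y).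
Proof.
move=> y0; pose f : R -> R := expR * expR - (cst 2 * id) * expR.
have df (x : R) : is_derive x (1 : R) f (2 * expR x * (expR x - 1 - x)).
  apply: is_derive_eq; rewrite /GRing.scale /= (_ : (cst 2 * id) x = 2 * x) //; ring.
have fy : f 0 <= f y.
  apply: (@ger0_derive1_le_cc _ f 0 y) => //; rewrite ?in_itv /= ?lexx ?y0 //.
  - by move=> x _; rewrite derive1E derive_val mulr_ge0 ?mulr_ge0 ?expR_ge0 //
       -addrA -opprD subr_ge0 expR_ge1Dx.
  - by apply: derivable_within_continuous => x _.
have : expR (- y) * f 0 <= expR (- y) * f y by apply: ler_wpM2l fy; exact: expR_ge0.
rewrite /f !fctE expR0 mulr0 mul0r subr0 mulr1 mulrBr.
have e : expR (- y) * expR y = 1 by rewrite mulrC expRxMexpNx_1.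
rewrite mulr1 (mulrA _ (expR y)) e mul1r mulrCA e mulr1.
by rewrite lerBrDr lerBrDl.
Qed.

(** e^t + e^(-t) - 2 is the square of e^(t/2) - e^(-t/2), which is at least t for nonnegative t. *)
Lemma expR_addN_ge (R : realType) (t : R) : 2 + t ^+ 2 <= expR t + expR (- t).
Proof.
wlog t0 : t / 0 <= t.
  have [|t0] := leP 0 t; first by move=> t0 /(_ t t0).
  move=> /(_ (- t)); rewrite opprK sqrrN oppr_ge0 (ltW t0) => /(_ isT).
  by rewrite [expR (- t) + _]addrC.
have := @expR_subN_ge R (t / 2); rewrite divr_ge0 // => /(_ isT).
rewrite mulrC divfK ?pnatr_eq0 // => ft.
have : t ^+ 2 <= (expR (t / 2) - expR (- (t / 2))) ^+ 2.
  by rewrite ler_sqr ?nnegrE // (le_trans t0).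
have e : expR (t / 2) * expR (- (t / 2)) = 1 by rewrite expRxMexpNx_1.
rewrite sqrrB -!expRM_natr e mulNr divfK ?pnatr_eq0 //.
lra.
Qed.

Section gaussian_pair.
Variable R : realType.
Notation mu := (@lebesgue_measure R).
Local Open Scope ereal_scope.

Lemma ge0_integral_normal_prob (m s : R) (f : R -> \bar R) :
  measurable_fun setT f -> (forall x, 0 <= f x) ->
  \int[normal_prob m s]_x f x = \int[mu]_x (f x * (normal_pdf m s x)%:E).
Proof.
move=> mf f0; have dom := @normal_prob_dominates R m s.
rewrite -(Radon_Nikodym_SigmaFinite.change_of_variables dom) //.
apply: ge0_ae_eq_integral => //.
- apply: emeasurable_funM => //.
  exact: measurable_int (Radon_Nikodym_SigmaFinite.f_integrable _).
- apply: emeasurable_funM => //.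
  by apply/measurable_EFinP; exact: measurable_normal_pdf.
- by move=> x _; rewrite mule_ge0 ?f0 ?Radon_Nikodym_SigmaFinite.f_ge0.
- by move=> x _; rewrite mule_ge0 ?f0 // lee_fin normal_pdf_ge0.
apply: ae_eqe_mul2l; apply: integral_ae_eq => //.
- exact: Radon_Nikodym_SigmaFinite.f_integrable.
- by apply/measurable_EFinP; exact: measurable_normal_pdf.
- move=> A _ mA; rewrite -Radon_Nikodym_SigmaFinite.f_integral //.
Qed.

Lemma ge0_integral_translation (a : R) (f : R -> \bar R) :
  measurable_fun setT f -> (forall x, 0 <= f x) ->
  \int[mu]_x f (x + a)%R = \int[mu]_x f x.
Proof.
move=> mf f0.
have mt : measurable_fun setT ((fun x => x + a)%R : R -> measurableTypeR R).
  exact: measurable_funD.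
pose h : {mfun R >-> measurableTypeR R} :=
  HB.pack ((fun x => x + a)%R : R -> measurableTypeR R)
    (isMeasurableFun.Build _ _ _ _ _ mt).
transitivity (\int[pushforward mu h]_x f x).
  by rewrite ge0_integral_pushforward.
apply: eq_measure_integral => /= A mA _; apply/esym.
apply: (lebesgue_measure_unique (mu := pushforward mu h)) => // _ [[b c] _ <-].
transitivity (mu `](b - a)%R, (c - a)%R]%classic).
  by rewrite !lebesgue_measure_itv /= !lte_fin ltrD2r -!EFinB opprD opprK addrACA addNr addr0.
rewrite /pushforward; congr (mu _).
by apply/seteqP; split=> x /=; rewrite !in_itv /= ltrBlDr lerBrDr.
Qed.

Lemma ge0_integral_shearl (t : R) (f : R * R -> \bar R) :
  measurable_fun setT f -> (forall z, 0 <= f z) ->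
  \int[mu]_y \int[mu]_x f (x + t * y, y)%R = \int[mu]_y \int[mu]_x f (x, y).
Proof.
move=> mf f0; apply: eq_integral => y _.
by rewrite (ge0_integral_translation (t * y)%R (f := fun x : R => f (x, y : R))) //;
   exact: (measurableT_comp mf (pair2_measurable (y : R))).
Qed.

Lemma ge0_integral_shearr (t : R) (f : R * R -> \bar R) :
  measurable_fun setT f -> (forall z, 0 <= f z) ->
  \int[mu]_y \int[mu]_x f (x, y + t * x)%R = \int[mu]_y \int[mu]_x f (x, y).
Proof.
move=> mf f0.
have mS : measurable_fun setT (fun z : R * R => (z.1, z.2 + t * z.1)%R).
  apply: measurable_fun_pair; first exact: measurable_fst.
  apply: measurable_funD; first exact: measurable_snd.
  by apply: measurable_funM => //; exact: measurable_fst.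
transitivity (\int[mu]_x \int[mu]_y f (x, y + t * x)%R).
  apply/esym; apply: (fubini_tonelli (m1 := mu) (m2 := mu)
    (fun z : R * R => f (z.1, z.2 + t * z.1)%R)) => //.
  exact: (measurableT_comp mf mS).
transitivity (\int[mu]_x \int[mu]_y f (x, y)); last first.
  exact: (fubini_tonelli (m1 := mu) (m2 := mu) f).
apply: eq_integral => x _.
by rewrite (ge0_integral_translation (t * x)%R (f := fun y : R => f (x : R, y))) //;
   exact: (measurableT_comp mf (pair1_measurable (x : R))).
Qed.

(* [s != 0]: only then is the rotation a product of three shears. *)
Lemma ge0_integral_rotation (c s : R) (f : R * R -> \bar R) :
  (c ^+ 2 + s ^+ 2 = 1)%R -> s != 0%R ->
  measurable_fun setT f -> (forall z, 0 <= f z) ->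
  \int[mu]_y \int[mu]_x f (c * x - s * y, s * x + c * y)%R =
  \int[mu]_y \int[mu]_x f (x, y).
Proof.
(* For c = cos x and s = sin x this is t = - tan (x / 2): the rotation is the horizontal shear by t,
   the vertical shear by s, and the first shear again. *)
move=> cs s0 mf f0; pose t := ((c - 1) / s)%R.
have st : (1 + s * t = c)%R by rewrite /t mulrCA divff // mulr1 addrC subrK.
have tct : (t + t * c = - s)%R.
  rewrite /t -[X in (X + _)%R]mulr1 -mulrDr mulrAC.
  have -> : ((c - 1) * (1 + c) = - s ^+ 2)%R.
    by rewrite [(1 + c)%R]addrC -subr_sqr expr1n -cs opprD addrA subrr add0r.
  by rewrite mulNr expr2 mulfK.
have mS u : measurable_fun setT (fun z : R * R => (z.1 + u * z.2, z.2)%R).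
  apply: measurable_fun_pair; last exact: measurable_snd.
  apply: measurable_funD; first exact: measurable_fst.
  by apply: measurable_funM => //; exact: measurable_snd.
have mS' u : measurable_fun setT (fun z : R * R => (z.1, z.2 + u * z.1)%R).
  apply: measurable_fun_pair; first exact: measurable_fst.
  apply: measurable_funD; first exact: measurable_snd.
  by apply: measurable_funM => //; exact: measurable_fst.
pose f1 z := f (z.1 + t * z.2, z.2)%R.
pose f2 z := f1 (z.1, z.2 + s * z.1)%R.
have mf1 : measurable_fun setT f1 by exact: (measurableT_comp mf (mS t)).
have mf2 : measurable_fun setT f2 by exact: (measurableT_comp mf1 (mS' s)).
rewrite -(ge0_integral_shearl t mf f0) -/(f1 (_, _)).
rewrite -(ge0_integral_shearr s mf1) => [|z]; last exact: f0.
rewrite -(ge0_integral_shearl t mf2) => [|z]; last exact: f0.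
apply: eq_integral => y _; apply: eq_integral => x _; rewrite /f2 /f1 /=.
have e2 : (y + s * (x + t * y) = s * x + c * y)%R.
  by rewrite -st mulrDr mulrDl mul1r addrCA mulrA.
rewrite e2; congr (f (_, _)).
have -> : (x + t * y + t * (s * x + c * y) = (1 + s * t) * x + (t + t * c) * y)%R.
  by ring.
by rewrite st tct mulNr.
Qed.

Lemma normal_pdf_rotation (c s sigma x y : R) : (c ^+ 2 + s ^+ 2 = 1)%R ->
  sigma != 0%R ->
  (normal_pdf 0 sigma (c * x - s * y) * normal_pdf 0 sigma (s * x + c * y) =
   normal_pdf 0 sigma x * normal_pdf 0 sigma y)%R.
Proof.
move=> cs s0; rewrite !normal_pdfE // /normal_fun !subr0.
set k := normal_peak sigma; set v := (sigma ^+ 2 *+ 2)%R.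
have e (a b : R) : (k * expR (- a / v) * (k * expR (- b / v)) =
    k * k * expR (- (a + b) / v))%R.
  by rewrite mulrACA -expRD -mulrDl -opprD.
have -> : (y ^+ 2 = (s * x + c * y) ^+ 2 + (c * x - s * y) ^+ 2 - x ^+ 2)%R.
  transitivity ((c ^+ 2 + s ^+ 2) * (x ^+ 2 + y ^+ 2) - x ^+ 2)%R; last by ring.
  by rewrite cs; ring.
by rewrite !e addrCA subrr addr0 addrC.
Qed.

Lemma ge0_integral_density_rotation (nu : probability (measurableTypeR R) R) (p : R -> R) (c s : R)
    (f : R * R -> \bar R) :
  measurable_fun setT p -> (forall x, 0 <= p x)%R ->
  (forall g : R -> \bar R, measurable_fun setT g -> (forall x, 0 <= g x) ->
    \int[nu]_x g x = \int[mu]_x (g x * (p x)%:E)) ->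
  (forall x y, p (c * x - s * y) * p (s * x + c * y) = p x * p y)%R ->
  (c ^+ 2 + s ^+ 2 = 1)%R -> s != 0%R ->
  measurable_fun setT f -> (forall z, 0 <= f z) ->
  \int[nu]_y \int[nu]_x f (c * x - s * y, s * x + c * y)%R =
  \int[nu]_y \int[nu]_x f (x, y).
Proof.
move=> mp p0 nuE p_rot cs s0 mf f0.
have pE0 x : 0 <= (p x)%:E by rewrite lee_fin.
have mpE : measurable_fun setT (fun x => (p x)%:E) by apply/measurable_EFinP.
have e (g : R * R -> \bar R) : measurable_fun setT g -> (forall z, 0 <= g z) ->
  \int[nu]_y \int[nu]_x g (x, y) = \int[mu]_y \int[mu]_x (g (x, y) * (p x * p y)%:E).
  move=> mg g0; have mg1 (y : R) : measurable_fun setT (fun x : R => g (x, y)).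
    exact: (measurableT_comp mg (pair2_measurable y)).
  rewrite nuE; last 2 first.
  - exact: (measurable_fun_fubini_tonelli_G (m1 := nu) g).
  - by move=> y; apply: integral_ge0.
  apply: eq_integral => y _; rewrite nuE //.
  rewrite muleC -ge0_integralZl //.
  - by apply: eq_integral => x _; rewrite EFinM muleCA [(p y)%:E * _]muleC.
  - by apply: emeasurable_funM => //; exact: mg1.
  - by move=> x _; rewrite mule_ge0.
have mp2 : measurable_fun setT (fun z : R * R => (p z.1 * p z.2)%:E).
  apply/measurable_EFinP; apply: measurable_funM.
    by apply: (measurableT_comp mp); exact: measurable_fst.
  by apply: (measurableT_comp mp); exact: measurable_snd.
have mrot : measurable_fun setT (fun z : R * R => (c * z.1 - s * z.2, s * z.1 + c * z.2)%R).
  apply: measurable_fun_pair.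
    by apply: measurable_funB; apply: measurable_funM.
  by apply: measurable_funD; apply: measurable_funM.
pose g z := f z * (p z.1 * p z.2)%:E.
have mg : measurable_fun setT g by exact: emeasurable_funM.
have g0 z : 0 <= g z by rewrite mule_ge0 // EFinM mule_ge0.
pose fr z := f (c * z.1 - s * z.2, s * z.1 + c * z.2)%R.
have mfr : measurable_fun setT fr by exact: (measurableT_comp mf mrot).
have fr0 z : 0 <= fr z by exact: f0.
transitivity (\int[nu]_y \int[nu]_x fr (x, y)); first by [].
transitivity (\int[mu]_y \int[mu]_x g (c * x - s * y, s * x + c * y)%R).
  apply: etrans (e fr mfr fr0) _.
  apply: eq_integral => y _; apply: eq_integral => x _; congr (_ * _%:E).
  by rewrite /= p_rot.
by apply: etrans (ge0_integral_rotation cs s0 mg g0) _; exact/esym/(e f mf f0).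
Qed.

Lemma ge0_integral_normal_rotation (c s sigma : R) (f : R * R -> \bar R) :
  (c ^+ 2 + s ^+ 2 = 1)%R -> s != 0%R -> sigma != 0%R ->
  measurable_fun setT f -> (forall z, 0 <= f z) ->
  \int[normal_prob 0 sigma]_y \int[normal_prob 0 sigma]_x
     f (c * x - s * y, s * x + c * y)%R =
  \int[normal_prob 0 sigma]_y \int[normal_prob 0 sigma]_x f (x, y).
Proof.
move=> cs s0 sg0 mf f0.
apply: (ge0_integral_density_rotation (p := normal_pdf 0 sigma)) => //.
- exact: measurable_normal_pdf.
- exact: normal_pdf_ge0.
- exact: ge0_integral_normal_prob.
- by move=> x y; exact: normal_pdf_rotation.
Qed.

(* Compares the density with the average of its translates by [a] and [-a], and
   lets [a] tend to [0]. *)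
Lemma normal_second_moment_le :
  \int[normal_prob 0 (Num.sqrt (2^-1)%R)]_x ((x : R) ^+ 2)%:E <= (2^-1 : R)%:E.
Proof.
set sg := Num.sqrt (2^-1)%R; pose p := normal_pdf 0 sg.
have sg0 : sg != 0%R by rewrite gt_eqF // sqrtr_gt0 invr_gt0 ltr0n.
have v1 : (sg ^+ 2 *+ 2 = 1)%R.
  by rewrite sqr_sqrtr ?invr_ge0 ?ler0n // -mulr_natr mulVf.
pose k := normal_peak sg.
have pE x : p x = (k * expR (- x ^+ 2))%R.
  by rewrite /p normal_pdfE // /normal_fun v1 subr0 divr1.
have k0 : (0 <= k)%R by exact: normal_peak_ge0.
have p0 x : (0 <= p x)%R by exact: normal_pdf_ge0.
have mp : measurable_fun setT p by exact: measurable_normal_pdf.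
have m2 : measurable_fun setT (fun x : R => x ^+ 2)%R by exact: exprn_measurable.
have mpE : measurable_fun setT (fun x => (p x)%:E) by apply/measurable_EFinP.
have mJ : measurable_fun setT (fun x : R => (x ^+ 2)%:E * (p x)%:E).
  by apply: emeasurable_funM => //; apply/measurable_EFinP.
rewrite ge0_integral_normal_prob //; last 2 first.
- exact/measurable_EFinP.
- by move=> x; rewrite lee_fin sqr_ge0.
set J := integral _ _ _.
have J0 : 0 <= J.
  by apply: integral_ge0 => x _; rewrite mule_ge0 // lee_fin ?sqr_ge0.
have shift1 a : \int[mu]_x (p ((x : R) + a)%R)%:E = 1.
  rewrite (ge0_integral_translation a (f := fun x => (p x)%:E)) //.
  exact: integral_normal_pdf.
have mshift a : measurable_fun setT (fun x : R => (p (x + a)%R)%:E).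
  by apply/measurable_EFinP; apply: measurableT_comp => //; exact: measurable_funD.
(* Translating the density by a and -a multiplies it by e^(-a^2) e^(-2ax) and e^(-a^2) e^(2ax). The
   sum of the two translates integrates to 2, and e^(2ax) + e^(-2ax) is at least 2 + (2ax)^2. *)
have key (a : R) : (expR (- a ^+ 2))%:E * (2%:E + (4 * a ^+ 2)%:E * J) <= 2%:E.
  have e2 : 2%:E = \int[mu]_x ((p ((x : R) + a)%R)%:E + (p (x - a)%R)%:E) :> \bar R.
    rewrite ge0_integralD //; [by rewrite !shift1|by move=> x _; rewrite lee_fin|exact: mshift|
      by move=> x _; rewrite lee_fin|exact: mshift].
  have a2 : 0 <= (4 * a ^+ 2)%:E by rewrite lee_fin mulr_ge0 ?sqr_ge0.
  have p_ge0 x : 0 <= (p x)%:E by rewrite lee_fin.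
  have J_ge0 x : 0 <= (x ^+ 2)%:E * (p x)%:E by rewrite mule_ge0 // lee_fin sqr_ge0.
  have m2p : measurable_fun setT (fun x : R => 2%:E * (p x)%:E).
    by apply: emeasurable_funM => //; exact: measurable_cst.
  have m4 : measurable_fun setT (fun x : R => (4 * a ^+ 2)%:E * ((x ^+ 2)%:E * (p x)%:E)).
    by apply: emeasurable_funM => //; exact: measurable_cst.
  have msum : measurable_fun setT
     (fun x : R => 2%:E * (p x)%:E + (4 * a ^+ 2)%:E * ((x ^+ 2)%:E * (p x)%:E)).
    exact: emeasurable_funD.
  have s_ge0 (x : R) : 0 <= 2%:E * (p x)%:E + (4 * a ^+ 2)%:E * ((x ^+ 2)%:E * (p x)%:E).
    by rewrite adde_ge0 // mule_ge0 // lee_fin.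
  rewrite {2}e2.
  have -> : 2%:E + (4 * a ^+ 2)%:E * J =
      \int[mu]_x (2%:E * (p x)%:E + (4 * a ^+ 2)%:E * ((x ^+ 2)%:E * (p x)%:E)).
    rewrite ge0_integralD //; last 2 first.
    - by move=> x _; rewrite mule_ge0 // lee_fin.
    - by move=> x _; rewrite mule_ge0.
    rewrite !ge0_integralZl // ?lee_fin //.
    by rewrite integral_normal_pdf mule1.
  rewrite -ge0_integralZl ?lee_fin ?expR_ge0 //.
  apply: ge0_le_integral => //.
  - by move=> x _; rewrite mule_ge0 // lee_fin expR_ge0.
  - by apply: emeasurable_funM => //; exact: measurable_cst.
  - by apply: emeasurable_funD; exact: mshift.
  move=> x _; change ((expR (- a ^+ 2) * (2 * p x + 4 * a ^+ 2 * (x ^+ 2 * p x)))%:E <=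
    (p (x + a)%R + p (x - a)%R)%:E).
  rewrite lee_fin !pE.
  have -> : (k * expR (- (x + a) ^+ 2) + k * expR (- (x - a) ^+ 2) =
      expR (- a ^+ 2) * (k * expR (- x ^+ 2)) * (expR (2 * a * x) + expR (- (2 * a * x))))%R.
    have -> : (expR (- (x + a) ^+ 2) = expR (- a ^+ 2) * expR (- x ^+ 2) * expR (- (2 * a * x)))%R.
      by rewrite -!expRD; congr expR; ring.
    have -> : (expR (- (x - a) ^+ 2) = expR (- a ^+ 2) * expR (- x ^+ 2) * expR (2 * a * x))%R.
      by rewrite -!expRD; congr expR; ring.
    ring.
  have -> : (expR (- a ^+ 2) * (2 * (k * expR (- x ^+ 2)) + 4 * a ^+ 2 * (x ^+ 2 * (k * expR (- x ^+ 2)))) =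
     expR (- a ^+ 2) * (k * expR (- x ^+ 2)) * (2 + (2 * a * x) ^+ 2))%R by ring.
  by apply: ler_wpM2l (expR_addN_ge _); rewrite !mulr_ge0 ?expR_ge0.
(* At a = 1 an infinite J would contradict the bound. *)
have Jfin : J \is a fin_num.
  rewrite ge0_fin_numE // ltey; apply/negP => /eqP Jy; have := key 1%R.
  have -> : (4 * 1 ^+ 2)%:E * J = +oo by rewrite Jy gt0_muley // lte_fin mulr_gt0.
  by rewrite addey // gt0_muley // lte_fin expR_gt0.
rewrite -(fineK Jfin) lee_fin.
(* With a^2 = h and e^(-h) >= 1 - h the bound becomes 2 J (1 - h) <= 1, and small h forces J <=
   1/2. *)
have {}key (h : R) : (0 < h < 1)%R -> (2 * fine J <= (1 - h)^-1)%R.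
  move=> /andP[h0 h1]; have := key (Num.sqrt h).
  rewrite sqr_sqrtr ?(ltW h0) // -{1}(fineK Jfin) => ke'.
  have ke : (expR (- h) * (2 + 4 * h * fine J) <= 2)%R by exact: ke'.
  have e1 : (1 - h <= expR (- h))%R by exact: expR_ge1Dx.
  have h10 : (0 < 1 - h)%R by rewrite subr_gt0.
  have J0' : (0 <= fine J)%R by exact: fine_ge0.
  have : ((1 - h) * (2 + 4 * h * fine J) <= 2)%R.
    by apply: le_trans ke; apply: ler_wpM2r e1; rewrite addr_ge0 ?mulr_ge0 ?(ltW h0).
  move=> {}ke; rewrite -[((1 - h)^-1)%R]mul1r ler_pdivlMr //.
  suff : (h * (2 * fine J * (1 - h)) <= h * 1)%R by rewrite ler_pM2l.
  nra.
have [//|J12] := leP (fine J) 2^-1%R.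
(* This makes 1 - h the midpoint of 1 and 1 / (2 J), hence larger than 1 / (2 J) when J > 1/2,
   against the bound. *)
pose h := ((1 - (2 * fine J)^-1) / 2)%R.
have J2 : (1 < 2 * fine J)%R by rewrite mulrC -ltr_pdivrMr ?ltr0n // mul1r.
have J20 : (0 < 2 * fine J)%R by exact: lt_trans ltr01 J2.
have iJ : ((2 * fine J)^-1 < 1)%R by rewrite invf_lt1.
have iJ0 : (0 < (2 * fine J)^-1)%R by rewrite invr_gt0.
have h01 : (0 < h < 1)%R by rewrite /h; apply/andP; split; lra.
have := key h h01; rewrite -[X in (X <= _)%R]invrK lef_pV2 ?posrE ?subr_gt0 //; last by case/andP: h01.
by rewrite /h => ?; exfalso; lra.
Qed.

End gaussian_pair.

(** * Generation of the unitary group by plane rotations *)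

Section givens.
Variables (C : numClosedFieldType) (M : nat).

Definition phase_mx (a : 'I_M) (z : C) : 'M[C]_M :=
  diag_mx (\row_i if i == a then z else 1).

Definition givens_mx (a b : 'I_M) (c s : C) : 'M[C]_M :=
  \matrix_(i, j) if i == a then c * (j == a)%:R - s * (j == b)%:R
                 else if i == b then s * (j == a)%:R + c * (j == b)%:R
                 else (i == j)%:R.

Lemma phase_mulE n a z (A : 'M[C]_(M, n)) i j :
  (phase_mx a z *m A) i j = if i == a then z * A i j else A i j.
Proof. by rewrite mul_diag_mx !mxE; case: ifP; rewrite ?mul1r. Qed.

Lemma sum_delta (f : 'I_M -> C) k : \sum_j (j == k)%:R * f j = f k.
Proof.
rewrite (bigD1 k) //= eqxx mul1r big1 ?addr0 // => i /negbTE->.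
by rewrite mul0r.
Qed.

Lemma givens_mulE n a b c s (A : 'M[C]_(M, n)) i j : a != b ->
  (givens_mx a b c s *m A) i j =
  if i == a then c * A a j - s * A b j
  else if i == b then s * A a j + c * A b j else A i j.
Proof.
move=> ab; rewrite mxE; have [->|ia] := eqVneq i a.
  under eq_bigr do rewrite mxE eqxx mulrDl mulNr -!mulrA.
  by rewrite big_split sumrN /= -!mulr_sumr !sum_delta.
have [->|ib] := eqVneq i b.
  under eq_bigr do rewrite mxE eqxx (eq_sym b) (negbTE ab) mulrDl -!mulrA.
  by rewrite big_split /= -!mulr_sumr !sum_delta.
under eq_bigr do rewrite mxE (negbTE ia) (negbTE ib) eq_sym.
exact: sum_delta.
Qed.

Lemma phase_unitary a z : `|z| = 1 -> phase_mx a z \is unitarymx.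
Proof.
move=> z1; apply/unitarymxP; rewrite adjmx_diag mulmx_diag -diag_const_mx.
congr diag_mx; apply/rowP => i; rewrite !mxE.
by case: ifP; rewrite -normCK ?z1 ?normr1 expr1n.
Qed.

Lemma givens_adj a b c s : a != b -> c^* = c -> s^* = s ->
  (givens_mx a b c s) ^t* = givens_mx a b c (- s).
Proof.
move=> ab cr sr; apply/matrixP => i j; rewrite !mxE.
have ba : (b == a) = false by rewrite eq_sym (negbTE ab).
have [->|ja] := eqVneq j a.
  rewrite (negbTE ab) rmorphB !rmorphM !rmorph_nat /= cr sr.
  have [->|ia] := eqVneq i a; first by rewrite (negbTE ab) !mulr1 !mulr0 subr0.
  have [_|ib] := eqVneq i b; first by rewrite !(mulr1, mulr0) sub0r addr0.
  by rewrite !mulr0 subr0.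
have [->|jb] := eqVneq j b.
  rewrite rmorphD !rmorphM !rmorph_nat /= cr sr.
  have [->|ia] := eqVneq i a; first by rewrite (negbTE ab) !(mulr1, mulr0) addr0 sub0r opprK.
  have [_|ib] := eqVneq i b; first by rewrite !(mulr1, mulr0) add0r.
  by rewrite !mulr0 addr0.
rewrite rmorph_nat eq_sym.
have [ia|ia] := eqVneq i a; first by rewrite ia eq_sym (negbTE ja) !mulr0 subr0.
have [ib|ib] := eqVneq i b; first by rewrite ib eq_sym (negbTE jb) !mulr0 addr0.
by [].
Qed.

Lemma givens_unitary a b c s : a != b -> c^* = c -> s^* = s ->
  c ^+ 2 + s ^+ 2 = 1 -> givens_mx a b c s \is unitarymx.
Proof.
move=> ab cr sr cs; apply/unitarymxP; rewrite givens_adj //; apply/matrixP => i j.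
have ba : (b == a) = false by rewrite eq_sym (negbTE ab).
have e1 : c * c + s * s = 1 by rewrite -!expr2.
rewrite givens_mulE // !mxE !eqxx ba.
have [->|ia] := eqVneq i a.
  rewrite (eq_sym a j); have [->|ja] := eqVneq j a.
    by rewrite (negbTE ab) /= !(mulr1, mulr0) subr0 addr0 mulrN opprK.
  by rewrite !mulr0 ?sub0r add0r mulNr opprK mulrCA !mulrA subrr.
have [->|ib] := eqVneq i b.
  rewrite (eq_sym b j); have [->|ja] := eqVneq j a.
    by rewrite (negbTE ab) /= !(mulr1, mulr0) subr0 addr0 mulrN mulrC subrr.
  rewrite !mulr0 sub0r add0r mulNr opprK !mulrA -mulrDl addrC e1 mul1r.
  by rewrite eq_sym.
by [].
Qed.

End givens.

Section unitary_generation.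
Variables (R : rcfType) (M : nat) (Q : 'M[R[i]]_M -> Prop).
Hypothesis Q1 : Q 1%:M.
Hypothesis QM : forall A B, Q A -> Q B -> Q (A *m B).
Hypothesis Qadj : forall A, A \is unitarymx -> Q A -> Q (A ^t*).
Hypothesis Q_givens : forall (a b : 'I_M) (c s : R), a != b -> s != 0 ->
  c ^+ 2 + s ^+ 2 = 1 -> Q (givens_mx a b (c%:C)%C (s%:C)%C).
Hypothesis Q_phase : forall (a : 'I_M) (c s : R), s != 0 ->
  c ^+ 2 + s ^+ 2 = 1 -> Q (phase_mx a (Complex c s)).

(** Frees the phase from the condition s != 0: z = 1 gives the identity, and z = -1 is the square of
    the phase i. *)
Let Q_phase1 a (z : R[i]) : `|z| = 1 -> Q (phase_mx a z).
Proof.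
move=> z1; case: z z1 => c s z1.
have cs : c ^+ 2 + s ^+ 2 = 1.
  have := normCR2 (Complex c s); rewrite z1 expr1n /= => e.
  by have /(congr1 (@complex.Re R)) /= -> := e.
have [s0|s0] := eqVneq s 0; last exact: Q_phase.
move: cs; rewrite s0 expr0n addr0 => /eqP; rewrite sqrf_eq1 => /orP[]/eqP->.
  suff -> : phase_mx a (Complex (1:R) 0) = 1%:M by [].
  by rewrite -diag_const_mx; congr diag_mx; apply/rowP => i; rewrite !mxE; case: ifP.
suff -> : phase_mx a (Complex (-1:R) 0) = phase_mx a (Complex (0:R) 1) *m phase_mx a (Complex (0:R) 1).
  by apply: QM; apply: Q_phase; rewrite ?oner_eq0 // expr0n expr1n add0r.
rewrite mulmx_diag; congr diag_mx; apply/rowP => i; rewrite !mxE.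
case: ifP => _; last by rewrite mulr1.
by apply/eqP; rewrite eq_complex /= !mul0r !mul1r sub0r addr0 !eqxx.
Qed.

Let QU A := Q A /\ A \is unitarymx.

Let QU_M A B : QU A -> QU B -> QU (A *m B).
Proof. by move=> [qa ua] [qb ub]; split; [exact: QM|exact: (mul_unitarymx ua ub)]. Qed.

(** Phases turn the entries n0 and r of u into their moduli X and Y, and the plane rotation sending
    (X, Y) to (rho, 0) clears entry r. The other rows are untouched, so that entries can be cleared
    one after the other. *)
Let zero_one (n0 r : 'I_M) (u : 'cV[R[i]]_M) : n0 != r ->
  exists G, [/\ QU G, (G *m u) r 0 = 0 &
    forall n (A : 'M[R[i]]_(M, n)) k j, k != n0 -> k != r -> (G *m A) k j = A k j].
Proof.
move=> nr; set x := u n0 0; set y := u r 0.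
have [y0|y0] := eqVneq y 0.
  exists 1%:M; split=> [||n A k j _ _]; rewrite ?mul1mx //.
  by split=> //; apply/unitarymxP; rewrite adjmx1 mulmx1.
pose al := if x == 0 then 1 else x^* / `|x|.
pose be := y^* / `|y|.
have be1 : `|be| = 1 by rewrite normrM norm_conjC normfV normr_id divff // normr_eq0.
have al1 : `|al| = 1.
  rewrite /al; case: ifP => [_|/negbT x0]; first by rewrite normr1.
  by rewrite normrM norm_conjC normfV normr_id divff // normr_eq0.
have bey : be * y = `|y|.
  by rewrite /be mulrAC [_^* * _]mulrC -normCK expr2 mulfK // normr_eq0.
have alx : al * x = `|x|.
  rewrite /al; case: ifP => [/eqP->|/negbT x0]; first by rewrite mulr0 normr0.
  by rewrite mulrAC [_^* * _]mulrC -normCK expr2 mulfK // normr_eq0.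
pose X := complex.Re `|x|; pose Y := complex.Re `|y|.
have XE : `|x| = (X%:C)%C.
  by rewrite /X; case: `|x| (ger0_Im (normr_ge0 x)) => a b /= ->.
have YE : `|y| = (Y%:C)%C.
  by rewrite /Y; case: `|y| (ger0_Im (normr_ge0 y)) => a b /= ->.
have Y0 : Y != 0.
  by apply: contra y0 => /eqP e; rewrite -normr_eq0 YE e.
pose rho := Num.sqrt (X ^+ 2 + Y ^+ 2).
have rho2 : rho ^+ 2 = X ^+ 2 + Y ^+ 2 by rewrite sqr_sqrtr // addr_ge0 // sqr_ge0.
have rho0 : rho != 0.
  by rewrite sqrtr_eq0 -ltNge ltr_wpDl ?sqr_ge0 // exprn_even_gt0.
pose c := X / rho; pose s := - (Y / rho).
have s0 : s != 0 by rewrite oppr_eq0 mulf_neq0 // invr_eq0.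
have cs : c ^+ 2 + s ^+ 2 = 1.
  by rewrite sqrrN !exprMn -mulrDl -rho2 -exprMn divff // expr1n.
have cr (t : R) : ((t%:C)%C)^* = (t%:C)%C by exact: conjc_real.
exists (givens_mx n0 r (c%:C)%C (s%:C)%C *m (phase_mx n0 al *m phase_mx r be)); split.
- apply: QU_M; last by apply: QU_M; split; [exact: Q_phase1|exact: phase_unitary|exact: Q_phase1|exact: phase_unitary].
  split; first exact: Q_givens.
  apply: givens_unitary; rewrite ?cr //.
  by rewrite -!rmorphXn -rmorphD cs.
- rewrite -mulmxA givens_mulE // eq_sym (negbTE nr) eqxx -mulmxA !phase_mulE !eqxx.
  rewrite (negbTE nr) eq_sym (negbTE nr) -/x -/y alx bey XE YE -!rmorphM -rmorphD.
  by rewrite (_ : s * X + c * Y = 0) // /c /s mulNr mulrAC [X in _ + X]mulrAC (mulrC Y) addNr.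
- move=> n A k j kn kr; rewrite -mulmxA givens_mulE // (negbTE kn) (negbTE kr).
  by rewrite -mulmxA !phase_mulE (negbTE kn) (negbTE kr).
Qed.

Let zero_list (n0 : 'I_M) (l : seq 'I_M) (u : 'cV[R[i]]_M) : n0 \notin l ->
  exists G, [/\ QU G, forall r, r \in l -> (G *m u) r 0 = 0 &
    forall n (A : 'M[R[i]]_(M, n)) k j, k != n0 -> k \notin l -> (G *m A) k j = A k j].
Proof.
elim: l => [_|r l IH].
  exists 1%:M; split=> // [|n A k j _ _]; last by rewrite mul1mx.
  by split=> //; apply/unitarymxP; rewrite adjmx1 mulmx1.
rewrite inE negb_or => /andP[nr nl].
have [G [QG Gl Gk]] := IH nl.
have [G' [QG' G'r G'k]] := zero_one (G *m u) nr.
exists (G' *m G); split; first exact: QU_M.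
- move=> k; rewrite inE -mulmxA; have [->|kr] /= := eqVneq k r; first by [].
  move=> kl; rewrite G'k ?Gl //.
  by apply: contra nl => /eqP <-.
- move=> n A k j kn; rewrite inE negb_or => /andP[kr kl].
  by rewrite -mulmxA G'k // Gk.
Qed.

(** n counts the columns not yet known to be standard. In column n0 the entries below the diagonal
    are cleared, those above vanish because A is unitary with standard first columns, and the
    remaining diagonal entry has modulus 1 and is turned into 1 by a phase. *)
Let unitary_step (n : nat) (A : 'M[R[i]]_M) : (n <= M)%N -> A \is unitarymx ->
  (forall j : 'I_M, (j < M - n)%N -> col j A = delta_mx j 0) -> Q A.
Proof.
elim: n A => [|n IH] A nM Au Aj.
  suff -> : A = 1%:M by [].
  apply/matrixP => i j; have /colP/(_ i) : col j A = delta_mx j 0 by apply: Aj; rewrite subn0.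
  by rewrite !mxE eqxx andbT.
have n0M : (M - n.+1 < M)%N by rewrite ltn_subrL (leq_trans _ nM).
pose n0 := Ordinal n0M.
have fixr (B : 'M[R[i]]_M) (j k : 'I_M) : B \is unitarymx -> col j B = delta_mx j 0 ->
    k != j -> B j k = 0.
  move=> Bu Bj kj; have /matrixP/(_ j k) := unitarymx_adjl Bu.
  rewrite mxE [RHS]mxE eq_sym (negbTE kj) (bigD1 j) //= big1.
    rewrite addr0 !mxE => e; have /colP/(_ j) := Bj; rewrite !mxE !eqxx => e2.
    by move: e; rewrite e2 conjC1 mul1r.
  move=> l lj; have /colP/(_ l) := Bj; rewrite !mxE (negbTE lj) => ->.
  by rewrite conjC0 mul0r.
pose l := [seq r : 'I_M <- enum 'I_M | (n0 < r)%N].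
have [|G [[QG Gu] Gl Gk]] := zero_list (col n0 A) (n0 := n0) (l := l).
  by rewrite mem_filter ltnn.
have nl (k : 'I_M) : (k < n0)%N -> k \notin l.
  by move=> kn; rewrite mem_filter negb_and -leqNgt ltnW.
have G_row (j k : 'I_M) : (j < n0)%N -> G j k = (j == k)%:R.
  move=> jn; rewrite -[G]mulmx1 Gk ?nl // ?mxE //.
  by apply: contraTneq jn => ->; rewrite ltnn.
have G_col (j : 'I_M) : (j < n0)%N -> col j G = delta_mx j 0.
  move=> jn; apply/colP => k; rewrite !mxE andbT.
  have [->|kj] := eqVneq k j; first by rewrite G_row // eqxx.
  have /matrixP/(_ k j) := unitarymx_adjr Gu; rewrite mxE [RHS]mxE (negbTE kj).
  rewrite (bigD1 j) //= big1 ?addr0; first by rewrite !mxE (G_row j j) // eqxx conjC1 mulr1.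
  by move=> i ij; rewrite !mxE (G_row j i) // (eq_sym j) (negbTE ij) conjC0 mulr0.
have GA_col (j : 'I_M) : (j < n0)%N -> col j (G *m A) = delta_mx j 0.
  by move=> jn; rewrite colE -mulmxA -colE Aj // -colE G_col.
set v := G *m col n0 A in Gl.
have v_lt (k : 'I_M) : (k < n0)%N -> v k 0 = 0.
  move=> kn; rewrite /v Gk ?nl //; last by apply: contraTneq kn => ->; rewrite ltnn.
  rewrite mxE (fixr A) ?Aj //; by apply: contraTneq kn => <-; rewrite ltnn.
have v_neq (k : 'I_M) : k != n0 -> v k 0 = 0.
  move=> kn; have [|nk|/val_inj e] := ltngtP k n0; first exact: v_lt.
    by apply: Gl; rewrite mem_filter nk mem_enum.
  by rewrite e eqxx in kn.
have v1 : `|v n0 0| = 1.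
  have : normsq v = 1.
    rewrite /v normsq_unitary //.
    have /matrixP/(_ n0 n0) := unitarymx_adjl Au; rewrite [RHS]mxE eqxx => e; apply: etrans e.
    by rewrite /normsq !mxE; apply: eq_bigr => k _; rewrite !mxE.
  rewrite normsqE (bigD1 n0) //= big1 ?addr0.
    by move/eqP; rewrite sqrp_eq1 // => /eqP.
  by move=> k kn; rewrite v_neq // normr0 expr0n.
pose z := (v n0 0)^*.
have z1 : `|z| = 1 by rewrite norm_conjC.
pose D := phase_mx n0 z.
have Du : D \is unitarymx by exact: phase_unitary.
have QA' : Q (D *m (G *m A)).
  apply: IH; [exact: ltnW | exact: (mul_unitarymx Du (mul_unitarymx Gu Au)) | move=> j jn].
  rewrite colE -mulmxA -colE; apply/colP => k; rewrite phase_mulE [RHS]mxE andbT.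
  have : (j <= n0)%N by rewrite -ltnS /n0 /= -subSn // subSS.
  rewrite leq_eqVlt => /orP[/eqP/val_inj->|jn0].
    rewrite colE -mulmxA -colE -/v; have [->|kn] := eqVneq k n0.
      by rewrite mulrC -normCK v1 expr1n.
    by rewrite v_neq.
  rewrite GA_col // mxE andbT; case: (eqVneq k n0) => [->|//].
  by rewrite (_ : n0 == j = false) ?mulr0 //; apply: contraTF jn0 => /eqP<-; rewrite ltnn.
have -> : A = G ^t* *m (D ^t* *m (D *m (G *m A))).
  by rewrite (mulmxA (D ^t*)) (unitarymx_adjl Du) mul1mx mulmxA (unitarymx_adjl Gu) mul1mx.
by apply: QM; [exact: (Qadj Gu QG)|apply: (QM _ QA'); apply: (Qadj Du); exact: Q_phase1].
Qed.

Lemma unitary_generated A : A \is unitarymx -> Q A.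
Proof.
by move=> Au; apply: (unitary_step (n := M)) => // j; rewrite subnn.
Qed.

End unitary_generation.

(* Measurability for the product sigma-algebra, in a form which composes without
   a topology or a measurable structure on [I -> V]. *)
Definition jointly_measurable (I : Type) d1 (V : measurableType d1) d2
    (Z : measurableType d2) (f : (I -> V) -> Z) : Prop :=
  forall d (S : measurableType d) (F : I -> S -> V),
    (forall x, measurable_fun setT (F x)) ->
    measurable_fun setT (fun s => f (fun x => F x s)).

(** * Independent families and resampling *)

Section independence.
Context d (T : measurableType d) (R : realType) (P : probability T R).

Lemma mutually_independent_reindex (I I' : finType) (F : I -> set (set T))
    (e : I' -> I) : injective e -> mutually_independent P F ->
  mutually_independent P (fun x => F (e x)).
Proof.
move=> inj_e indF J E FE.
pose E' x := if [pick j | e j == x] is Some j then E j else setT.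
have E'e j : E' (e j) = E j.
  rewrite /E'; case: pickP => [k /eqP/inj_e -> //|/(_ j)].
  by rewrite eqxx.
have := indF (e @: J) E'; rewrite big_imset /=; last by move=> ? ? _ _; exact: inj_e.
under eq_bigr do rewrite E'e.
move=> <- => [|_ /imsetP[j jJ ->]]; last by rewrite E'e; exact: FE.
congr (P _); apply/seteqP; split=> [w Ew x /= /imsetP[j jJ ->]|w Ew j jJ].
  by rewrite E'e; exact: Ew.
by rewrite -E'e; apply: Ew; exact: imset_f.
Qed.

(** The induction carries along that the intersection over the blocks already treated lies in the
    joint sigma-algebra of their sources, so that [joint_sets_indep] can split off the next block;
    [p] assigns each source to its block. *)
Lemma mutually_independent_group (I I' : finType) (F : I -> set (set T))
    (p : I -> I') (F' : I' -> set (set T)) :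
  mutually_independent P F -> (forall x, F x `<=` measurable) ->
  (forall x, F x setT) -> (forall x, setI_closed (F x)) ->
  (forall y, F' y `<=` <<s joint_sets F [set x | p x == y] >>) ->
  mutually_independent P F'.
Proof.
move=> indF mF FT FI sF'.
have mono (J1 J2 : {set I}) : J1 \subset J2 ->
    <<s joint_sets F J1 >> `<=` <<s joint_sets F J2 >>.
  move=> /fintype.subsetP s12; apply: sub_smallest2r; first exact: smallest_sigma_algebra.
  by move=> A [x /= xJ FA]; exists x => //=; exact: s12.
have main (s : seq I') (E : I' -> set T) : uniq s -> (forall y, y \in s -> F' y (E y)) ->
    <<s joint_sets F [set x | p x \in s] >> (\bigcap_(y in [set` s]) E y) /\
    P (\bigcap_(y in [set` s]) E y) = (\prod_(y <- s) P (E y))%E.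
  elim: s => [_ _|y s IH /= /andP[ys us] FE].
    rewrite big_nil set_nil bigcap_set0 probability_setT; split=> //.
    exact: (@measurableT _ (g_sigma_algebraType (joint_sets F [set x | p x \in [::]]))).
  have [sE PE] := IH us (fun z zs => FE z (mem_behead (s := y :: s) zs)).
  have sy := sF' y _ (FE y (mem_head y s)).
  have -> : \bigcap_(z in [set` y :: s]) E z = E y `&` \bigcap_(z in [set` s]) E z.
    apply/seteqP; split=> [w Ew|w [Ey Es] z /=].
      split=> [|z zs]; first by apply: Ew; exact: mem_head.
      by apply: Ew; exact: (mem_behead (s := y :: s)).
    by rewrite inE => /orP[/eqP->//|]; exact: Es.
  rewrite big_cons -PE; split.
    apply: (@measurableI _ (g_sigma_algebraType (joint_sets F [set x | p x \in y :: s]))).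
      by apply: (mono _ _ _ _ sy); apply/fintype.subsetP => x; rewrite !inE => ->.
    by apply: (mono _ _ _ _ sE); apply/fintype.subsetP => x; rewrite !inE => ->; rewrite orbT.
  apply: (joint_sets_indep indF mF FT FI _ sy sE) => x; rewrite !inE => /eqP->.
  by [].
move=> J E FE; have [] := main (enum J) E (enum_uniq _).
  by move=> y; rewrite mem_enum; exact: FE.
rewrite big_enum /= => _ <-; congr (P _); congr (bigcap _ _).
by apply/seteqP; split=> y /=; rewrite mem_enum.
Qed.

Lemma sigma_of_setT d1 (V : measurableType d1) (X : T -> V) : sigma_of X setT.
Proof. by exists setT => //; rewrite setTI. Qed.

Lemma sigma_of_setI d1 (V : measurableType d1) (X : T -> V) :
  setI_closed (sigma_of X).
Proof.
move=> _ _ [A mA <-] [B mB <-]; exists (A `&` B); first exact: measurableI.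
by rewrite !setTI preimage_setI.
Qed.

Lemma sigma_of_meas d1 (V : measurableType d1) (X : T -> V) :
  measurable_fun setT X -> sigma_of X `<=` measurable.
Proof. by move=> mX _ [A mA <-]; exact: mX. Qed.

End independence.

Section family.
Context d (T : measurableType d) (R : realType) (P : probability T R).
Context (I : finType) d1 (V : measurableType d1) (X : I -> T -> V).
Hypothesis X_meas : forall x, measurable_fun setT (X x).
Hypothesis X_indep : mutually_independent P (fun x => sigma_of (X x)).

(** Integrating over w with w' fixed plays the role of the conditional expectation given the
    components outside J. *)
Definition resample (J : {set I}) (w w' : T) : I -> V :=
  fun x => if x \in J then X x w else X x w'.

Lemma integral_resample_meas J (f : (I -> V) -> \bar R) : jointly_measurable f ->
  (forall y, 0 <= f y)%E ->
  measurable_fun setT (fun w' => \int[P]_w f (resample J w w'))%E.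
Proof.
move=> mf f0.
apply: (measurable_fun_fubini_tonelli_G (m1 := P) (fun z => f (resample J z.1 z.2))) => //.
apply: (mf _ (T * T)%type (fun x z => if x \in J then X x z.1 else X x z.2)) => x.
by case: (x \in J); apply: measurableT_comp (X_meas x) _.
Qed.

Lemma ge0_integral_resample J (f : (I -> V) -> \bar R) : jointly_measurable f ->
  (forall y, 0 <= f y)%E ->
  (\int[P]_w f (fun x => X x w) = \int[P]_w' \int[P]_w f (resample J w w'))%E.
Proof.
move=> mf f0; pose F x := sigma_of (X x).
pose S J' := g_sigma_algebraType (joint_sets F J').
have mXJ (J' : {set I}) x : x \in J' -> measurable_fun setT (X x : S J' -> V).
  by move=> xJ _ B mB; apply: sub_gen_smallest; exists x => //; exists B.
have := @decouple _ T R P I F X_indep (fun x => sigma_of_meas (X_meas x))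
  (fun x => sigma_of_setT (X x)) (fun x => @sigma_of_setI _ _ _ _ (X x))
  J (~: J) (fun z => f (resample J z.1 z.2)).
rewrite /=; move=> <- //; last 2 first.
- by move=> x; rewrite inE negbK.
- apply: (mf _ (S J * S (~: J))%type (fun x z => if x \in J then X x z.1 else X x z.2)) => x.
  case: (boolP (x \in J)) => xJ.
    by apply: (measurableT_comp (mXJ J x xJ)).
  by apply: (measurableT_comp (mXJ (~: J) x _)); rewrite ?inE.
apply: eq_integral => w _; congr f; apply/funext => x.
by rewrite /resample; case: ifP.
Qed.

(* Replaces the integral over the components in [J] by its value [c], which need
   only be known for almost all values of the other components. *)
Lemma ge0_integral_resample_cst J (f : (I -> V) -> \bar R) c : jointly_measurable f ->
  (forall y, 0 <= f y)%E -> (0 <= c)%E ->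
  {ae P, forall w', \int[P]_w f (resample J w w') = c}%E ->
  (\int[P]_w f (fun x => X x w) = c)%E.
Proof.
move=> mf f0 c0 fc; rewrite (ge0_integral_resample J mf f0).
transitivity (\int[P]_w' (cst c w'))%E.
  apply: ge0_ae_eq_integral => //.
  - exact: integral_resample_meas.
  - by move=> w _; apply: integral_ge0.
  - by apply: filterS fc => w ->.
by rewrite integral_cst // -[RHS]mule1; congr (_ * _)%E; exact: probability_setT.
Qed.

End family.

(** * Gaussian matrices *)

Lemma det_col_affine (F : comNzRingType) n (j : 'I_n) (A D : 'M[F]_n) t :
  (forall i k, k != j -> D i k = 0) ->
  \det (A + t *: D) = (1 - t) * \det A + t * \det (A + D).
Proof.
move=> D0; rewrite -det_tr -[\det A]det_tr -[\det (A + D)]det_tr.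
apply: (determinant_multilinear (i0 := j)).
- by apply/rowP => i; rewrite !mxE; ring.
- by apply/matrixP => i k; rewrite !mxE D0 ?mulr0 ?addr0 // eq_sym neq_lift.
- by apply/matrixP => i k; rewrite !mxE D0 ?mulr0 ?addr0 // eq_sym neq_lift.
Qed.

Lemma cmeasurable_eq0 d (S : measurableType d) (R : realType) (f : S -> R[i]) :
  cmeasurable f -> measurable_fun setT (fun s => f s == 0).
Proof.
move=> [mr mi]; under eq_fun do rewrite eq_complex.
by apply: measurable_and; apply: measurable_fun_eqr => //; exact: measurable_cst.
Qed.

Lemma bool_measurable d (S : measurableType d) (R : realType) (b : S -> bool) :
  measurable_fun setT b -> measurable_fun setT (fun s => ((b s)%:R : R)%:E).
Proof.
move=> mb; apply/measurable_EFinP.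
rewrite (_ : (fun s => _) = (fun s => if b s then 1 else 0)).
  by apply: measurable_fun_ifT => //; exact: measurable_cst.
by apply/funext => s; case: (b s).
Qed.

Section null_events.
Context d (T : measurableType d) (R : realType) (P : probability T R).
Implicit Types b : T -> bool.

Lemma integral_bool b : measurable_fun setT b ->
  (\int[P]_w ((b w)%:R : R)%:E = P [set w | b w])%E.
Proof.
move=> mb.
have mB : measurable [set w | b w].
  by have := mb measurableT [set true] I; rewrite setTI.
rewrite -[X in P X]setIT -integral_indic //; apply: eq_integral => w _.
by rewrite indicE; case bw: (b w); [rewrite mem_set|rewrite memNset //= bw].
Qed.

Lemma integral_bool_eq0 b : measurable_fun setT b ->
  (\int[P]_w ((b w)%:R : R)%:E = 0)%E <-> {ae P, forall w, ~~ b w}.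
Proof.
move=> mb; have mB : measurable [set w | b w].
  by have := mb measurableT [set true] I; rewrite setTI.
rewrite integral_bool //; split=> [P0|[A [mA PA0 sA]]].
  by exists [set w | b w]; split=> // w /= /negP; rewrite negbK.
apply/eqP; rewrite -measure_le0 -PA0; apply: le_measure; rewrite ?inE //.
by move=> w bw; apply: sA => /= /negP.
Qed.

End null_events.

Section normal_family.
Context d (T : measurableType d) (R : realType) (P : probability T R).
Context (I : finType) (Z : I -> T -> R).
Notation nu := (normal_prob 0 (Num.sqrt 2^-1) : probability (measurableTypeR R) R).
Hypothesis Z_meas : forall x, measurable_fun setT (Z x).
Hypothesis Z_indep : mutually_independent P (fun x => sigma_of (Z x)).
Hypothesis Z_normal : forall x (A : set R), measurable A -> P (Z x @^-1` A) = nu A.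

Lemma integral_normal x (f : R -> \bar R) : measurable_fun setT f ->
  (forall y, 0 <= f y)%E -> (\int[P]_w f (Z x w) = \int[nu]_y f y)%E.
Proof.
move=> mf f0.
have mZ : measurable_fun setT (Z x : T -> measurableTypeR R) by exact: Z_meas.
pose h : {mfun T >-> measurableTypeR R} :=
  HB.pack (Z x : T -> measurableTypeR R) (isMeasurableFun.Build _ _ _ _ _ mZ).
transitivity (\int[pushforward P h]_y f y)%E.
  by rewrite ge0_integral_pushforward.
apply: eq_measure_integral => A mA _; exact: Z_normal.
Qed.

Lemma normal_neq x a : {ae P, forall w, Z x w != a}.
Proof.
exists (Z x @^-1` [set a]); split.
- by have := Z_meas x measurableT (measurable_set1 a); rewrite setTI.
- rewrite Z_normal //; have /null_content_dominatesP := @normal_prob_dominates R 0 (Num.sqrt 2^-1).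
  by apply=> //; exact: lebesgue_measure_set1.
- by move=> w /= /negP; rewrite negbK => /eqP.
Qed.

Lemma integral_normal_pair p q (g : R * R -> \bar R) : p != q ->
  measurable_fun setT g -> (forall y, 0 <= g y)%E ->
  (\int[P]_w g (Z p w, Z q w) = \int[nu]_y \int[nu]_x g (x, y))%E.
Proof.
move=> pq mg g0.
rewrite (ge0_integral_resample Z_meas Z_indep [set p] (f := fun z => g (z p, z q))) //; last first.
  by move=> d' S F mF; apply: measurableT_comp mg _; exact: measurable_fun_pair.
rewrite -(integral_normal q); last 2 first.
- exact: (measurable_fun_fubini_tonelli_G (m1 := nu) g).
- by move=> y; apply: integral_ge0.
apply: eq_integral => w' _.
rewrite -(integral_normal p (f := fun x => g (x, Z q w'))) //; last first.
  exact: (measurableT_comp mg (pair2_measurable (Z q w'))).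
by apply: eq_integral => w _; rewrite /resample !inE eqxx eq_sym (negbTE pq).
Qed.

Definition rotate p q (c s : R) (z : I -> R) : I -> R :=
  fun r => if r == p then c * z p - s * z q
           else if r == q then s * z p + c * z q else z r.

Lemma rotate_measurable p q (c s : R) d2 (V : measurableType d2) (f : (I -> R) -> V) :
  jointly_measurable f -> jointly_measurable (fun z => f (rotate p q c s z)).
Proof.
move=> mf d' S F mF.
apply: (mf _ S (fun x s' => rotate p q c s (fun r => F r s') x)) => x.
rewrite /rotate; case: (x == p).
  by apply: measurable_funB; apply: measurable_funM.
case: (x == q); last exact: mF.
by apply: measurable_funD; apply: measurable_funM.
Qed.

(** With all other coordinates frozen, only the pair at p and q is integrated, and its law is a
    product of two equal centred normal laws. *)
Lemma integral_rotate p q (c s : R) (f : (I -> R) -> \bar R) : p != q -> s != 0 ->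
  c ^+ 2 + s ^+ 2 = 1 -> jointly_measurable f -> (forall z, 0 <= f z)%E ->
  (\int[P]_w f (rotate p q c s (fun r => Z r w)) = \int[P]_w f (fun r => Z r w))%E.
Proof.
move=> pq s0 cs mf f0.
rewrite (ge0_integral_resample Z_meas Z_indep [set p; q] (rotate_measurable p q c s mf)) //.
rewrite (ge0_integral_resample Z_meas Z_indep [set p; q] mf) //.
apply: eq_integral => w' _.
pose g (y : R * R) := f (fun r => if r == p then y.1 else if r == q then y.2 else Z r w').
have mg : measurable_fun setT g.
  apply: (mf _ (R * R)%type (fun r y => if r == p then y.1 else if r == q then y.2 else Z r w')) => r.
  case: (r == p); first exact: measurable_fst.
  by case: (r == q); [exact: measurable_snd|exact: measurable_cst].
have sg0 : Num.sqrt (2^-1 : R) != 0 by rewrite gt_eqF // sqrtr_gt0 invr_gt0 ltr0n.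
have e := ge0_integral_normal_rotation cs s0 sg0 mg (fun _ => f0 _).
have mrot : measurable_fun setT (fun y : R * R => (c * y.1 - s * y.2, s * y.1 + c * y.2)).
  apply: measurable_fun_pair.
    by apply: measurable_funB; apply: measurable_funM.
  by apply: measurable_funD; apply: measurable_funM.
have g0 y : (0 <= g y)%E by exact: f0.
have e' := integral_normal_pair pq (measurableT_comp mg mrot) (fun _ => g0 _).
have {e}e' := etrans e' (etrans e (esym (integral_normal_pair pq mg g0))).
transitivity (\int[P]_w g (c * Z p w - s * Z q w, s * Z p w + c * Z q w)%R)%E.
  apply: eq_integral => w _; congr f; apply/funext => r; rewrite /rotate /resample /= !inE !eqxx orbT.
  have [//|rp] := eqVneq r p; have [//|rq] := eqVneq r q.
  by [].
apply: etrans e' _; apply: eq_integral => w _; congr f; apply/funext => r; rewrite /resample /= !inE.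
by have [->|rp] := eqVneq r p; [|have [->|rq] := eqVneq r q].
Qed.

Section parallel_rotations.
Variables (Key : eqType) (e1 e2 : Key -> I) (c s : R).
Hypothesis e12 : forall k l, e1 k != e2 l.

Definition rotations (L : seq Key) (z : I -> R) : I -> R :=
  foldr (fun k => rotate (e1 k) (e2 k) c s) z L.

Lemma integral_rotations L (f : (I -> R) -> \bar R) : s != 0 ->
  c ^+ 2 + s ^+ 2 = 1 -> jointly_measurable f -> (forall z, 0 <= f z)%E ->
  (\int[P]_w f (rotations L (fun r => Z r w)) = \int[P]_w f (fun r => Z r w))%E.
Proof.
move=> s0 cs; elim: L f => [//|k L IH] f mf f0 /=.
rewrite (IH (fun z => f (rotate (e1 k) (e2 k) c s z))) //; last exact: rotate_measurable.
exact: integral_rotate.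
Qed.

Hypotheses (e1_inj : injective e1) (e2_inj : injective e2).

Lemma rotationsE L z : uniq L ->
  [/\ forall k, rotations L z (e1 k) =
        if k \in L then c * z (e1 k) - s * z (e2 k) else z (e1 k),
      forall k, rotations L z (e2 k) =
        if k \in L then s * z (e1 k) + c * z (e2 k) else z (e2 k) &
      forall r, (forall k, r != e1 k) -> (forall k, r != e2 k) -> rotations L z r = z r].
Proof.
elim: L => [//|k L IH] /= /andP[kL uL]; have [E1 E2 E3] := IH uL.
split=> [l|l|r r1 r2]; last by rewrite /rotate (negbTE (r1 k)) (negbTE (r2 k)) E3.
- rewrite /rotate inE (inj_eq e1_inj); have [->|lk] /= := eqVneq l k.
    by rewrite E1 E2 (negbTE kL).
  by rewrite (negbTE (e12 _ _)) E1.
- rewrite /rotate inE (inj_eq e2_inj) eq_sym (negbTE (e12 _ _)).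
  have [->|lk] /= := eqVneq l k; first by rewrite E1 E2 (negbTE kL).
  by rewrite E2.
Qed.

End parallel_rotations.

End normal_family.

Section gaussian_matrix.
Context d (T : measurableType d) (R : realType) (P : probability T R).
Variables (M N : nat) (H : T -> 'M[R[i]]_(M, N)).
Hypothesis H_gaussian : forall i j, std_complex_gaussian P (fun w => H w i j).
Hypothesis H_indep : mutually_independent P
  (fun e : 'I_M * 'I_N => sigma_of (fun w => H w e.1 e.2)).
Notation nu := (normal_prob 0 (Num.sqrt 2^-1) : probability (measurableTypeR R) R).
Let Ix := ('I_M * 'I_N * bool)%type.

Definition matrix_part (x : Ix) (w : T) : R :=
  let z := H w x.1.1 x.1.2 in if x.2 then complex.Im z else complex.Re z.

Definition matrix_of_parts (z : Ix -> R) : 'M[R[i]]_(M, N) :=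
  \matrix_(i, j) Complex (z (i, j, false)) (z (i, j, true)).

Lemma matrix_partK w : matrix_of_parts (fun x => matrix_part x w) = H w.
Proof. by apply/matrixP => i j; rewrite mxE /matrix_part /=; case: (H w i j). Qed.

Lemma gaussian_matrix_meas : mxmeasurable H.
Proof. by move=> i j; apply/cmeasurableP; case: (H_gaussian i j). Qed.

Lemma matrix_part_meas x : measurable_fun setT (matrix_part x).
Proof.
by case: x => [[i j] b]; have [] := gaussian_matrix_meas i j; case: b.
Qed.

Lemma matrix_part_normal x (A : set R) : measurable A ->
  P (matrix_part x @^-1` A) = nu A.
Proof.
case: x => [[i j] b] mA; have [_ HP] := H_gaussian i j; case: b.
  have := HP setT A measurableT mA; rewrite probability_setT mul1e => e; apply: etrans e.
  by congr (P _); apply/seteqP; split=> w //= [].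
have := HP A setT mA measurableT; rewrite probability_setT mule1 => e; apply: etrans e.
by congr (P _); apply/seteqP; split=> w //= [].
Qed.

(** [H_indep] separates distinct entries, and the definition of a complex Gaussian separates the two
    parts of one entry; the events are therefore first grouped by entry. *)
Lemma matrix_part_indep : mutually_independent P (fun x => sigma_of (matrix_part x)).
Proof.
move=> J E FE; pose E' x := if x \in J then E x else setT.
have FE' x : sigma_of (matrix_part x) (E' x).
  by rewrite /E'; case: ifP => [/FE //|_]; exact: sigma_of_setT.
have EE' : \bigcap_(x in [set` J]) E x =
    \bigcap_(e in [set` [set: 'I_M * 'I_N]%SET]) (E' (e, true) `&` E' (e, false)).
  apply/seteqP; split=> [w Ew e _|w Ew [e b] xJ].
    by split; rewrite /E'; case: ifP => // xJ; exact: Ew.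
  have [|] := Ew e; first by rewrite /= inE.
  by move: (xJ); rewrite /E' /=; case: b {xJ} => -> //.
rewrite EE' H_indep; last first.
  move=> e _; have [A mA <-] := FE' (e, true); have [B mB <-] := FE' (e, false).
  have [mRe mIm] : cmeasurable (id : R[i] -> R[i]) by apply/cmeasurableP; exact: measurable_id.
  exists ((@complex.Im R) @^-1` A `&` (@complex.Re R) @^-1` B); last by rewrite !setTI.
  apply: measurableI; first by have := mIm measurableT A mA; rewrite setTI.
  by have := mRe measurableT B mB; rewrite setTI.
rewrite (eq_bigr (fun e => P (E' (e, true)) * P (E' (e, false)))%E); last first.
  move=> [i j] _; have [A mA <-] := FE' ((i, j), true); have [B mB <-] := FE' ((i, j), false).
  rewrite !setTI !matrix_part_normal // muleC.
  have [_ <- //] := H_gaussian i j.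
  by congr (P _); apply/seteqP; split=> w [].
transitivity (\prod_(x : Ix) P (E' x))%E.
  transitivity (\prod_(e : 'I_M * 'I_N) \prod_(b : bool) P (E' (e, b)))%E.
    by rewrite big_mkcond; apply: eq_bigr => e _; rewrite big_bool inE.
  by rewrite pair_big; apply: eq_bigr => -[e b] _.
rewrite [RHS]big_mkcond; apply: eq_bigr => x _.
by rewrite /E'; case: ifP => // _; rewrite probability_setT.
Qed.


Definition left_invariant (Q : 'M[R[i]]_M) : Prop :=
  forall phi : 'M[R[i]]_(M, N) -> \bar R, measurable_fun setT phi ->
    (forall A, 0 <= phi A)%E ->
    (\int[P]_w phi (Q *m H w) = \int[P]_w phi (H w))%E.

Let parts_measurable (phi : 'M[R[i]]_(M, N) -> \bar R) : measurable_fun setT phi ->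
  jointly_measurable (fun z => phi (matrix_of_parts z)).
Proof.
move=> mphi d' S F mF; apply: measurableT_comp mphi _; apply/mxmeasurableP => i j.
by split; under eq_fun do rewrite mxE; exact: mF.
Qed.

Let phi_mulmx (Q : 'M[R[i]]_M) (phi : 'M[R[i]]_(M, N) -> \bar R) : measurable_fun setT phi ->
  measurable_fun setT (fun A => phi (Q *m A)).
Proof.
move=> mphi; apply: measurableT_comp mphi _; apply/mxmeasurableP.
by apply: mxmeasurable_mul; [exact: mxmeasurable_cst|apply/mxmeasurableP; exact: measurable_id].
Qed.

(* [Q] acts on the parts of each column by a family of commuting plane
   rotations, listed by [Key]. *)
Let left_invariant_rotations (Key : finType) (e1 e2 : Key -> Ix) (c s : R) (Q : 'M[R[i]]_M) :
  (forall k l, e1 k != e2 l) -> s != 0 -> c ^+ 2 + s ^+ 2 = 1 ->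
  (forall z, matrix_of_parts (rotations e1 e2 c s (enum Key) z) = Q *m matrix_of_parts z) ->
  left_invariant Q.
Proof.
move=> e12 s0 cs EQ phi mphi phi0.
transitivity (\int[P]_w phi (matrix_of_parts
    (rotations e1 e2 c s (enum Key) (fun x => matrix_part x w))))%E.
  by apply: eq_integral => w _; rewrite EQ matrix_partK.
rewrite (integral_rotations matrix_part_meas matrix_part_indep matrix_part_normal e12 _ s0 cs
  (parts_measurable mphi)) //.
by apply: eq_integral => w _; rewrite matrix_partK.
Qed.

Lemma gaussian_matrix_left_invariant Q : Q \is unitarymx -> left_invariant Q.
Proof.
apply: unitary_generated => [phi _ _|Q1 Q2 I1 I2 phi mphi phi0|Q0 uQ I0 phi mphi phi0|a b c s ab s0 cs|a c s s0 cs].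
- by apply: eq_integral => w _; rewrite mul1mx.
- transitivity (\int[P]_w phi (Q1 *m (Q2 *m H w)))%E.
    by apply: eq_integral => w _; rewrite mulmxA.
  by rewrite (I2 (fun A => phi (Q1 *m A))) // ?I1 //; exact: phi_mulmx.
- rewrite -[LHS](I0 (fun A => phi (Q0 ^t* *m A))) //; last exact: phi_mulmx.
  by apply: eq_integral => w _; rewrite mulmxA (unitarymx_adjl uQ) mul1mx.
(* A real rotation of rows a and b turns, in each column, the real parts and the imaginary parts
   separately by the same angle; a key is a column and a part. *)
- apply: (@left_invariant_rotations ('I_N * bool)%type (fun k => (a, k.1, k.2))
    (fun k => (b, k.1, k.2)) c s) => // [[j p] [l q]|z].
    by rewrite !xpair_eqE (negbTE ab).
  have ei (x : 'I_M) : injective (fun k : 'I_N * bool => (x, k.1, k.2) : Ix).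
    by move=> [? ?] [? ?] [-> ->].
  have [|E1 E2 E3] := @rotationsE R Ix _ (fun k => (a, k.1, k.2)) (fun k => (b, k.1, k.2)) c s _
    (ei a) (ei b) (enum {: 'I_N * bool}) z (enum_uniq _).
    by move=> [j p] [l q]; rewrite !xpair_eqE (negbTE ab).
  apply/matrixP => i j; rewrite givens_mulE // !mxE.
  have E1' p : rotations (fun k => (a, k.1, k.2)) (fun k => (b, k.1, k.2)) c s
      (enum {: 'I_N * bool}) z (a, j, p) = c * z (a, j, p) - s * z (b, j, p).
    by rewrite (E1 (j, p)) mem_enum.
  have E2' p : rotations (fun k => (a, k.1, k.2)) (fun k => (b, k.1, k.2)) c s
      (enum {: 'I_N * bool}) z (b, j, p) = s * z (a, j, p) + c * z (b, j, p).
    by rewrite (E2 (j, p)) mem_enum.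
  have [->|ia] := eqVneq i a.
    by rewrite !E1'; apply/eqP; rewrite eq_complex /= !mul0r !subr0 !addr0 !eqxx.
  have [->|ib] := eqVneq i b.
    by rewrite !E2'; apply/eqP; rewrite eq_complex /= !mul0r !subr0 !addr0 !eqxx.
  by rewrite !E3 // => k; rewrite !xpair_eqE ?(negbTE ia) ?(negbTE ib).
(* A phase on row a turns, in each column, the real against the imaginary part of the entry; a key
   is a column. *)
- apply: (@left_invariant_rotations 'I_N (fun k => (a, k, false))
    (fun k => (a, k, true)) c s) => // [j l|z].
    by rewrite !xpair_eqE andbF.
  have ei (p : bool) : injective (fun k : 'I_N => (a, k, p) : Ix) by move=> ? ? [->].
  have [|E1 E2 E3] := @rotationsE R Ix _ (fun k => (a, k, false)) (fun k => (a, k, true)) c s _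
    (ei false) (ei true) (enum 'I_N) z (enum_uniq _).
    by move=> j l; rewrite !xpair_eqE andbF.
  apply/matrixP => i j; rewrite phase_mulE !mxE; have [->|ia] := eqVneq i a.
    by rewrite E1 E2 mem_enum; apply/eqP; rewrite eq_complex /= [X in _ && (X == _)]addrC !eqxx.
  by rewrite !E3 // => k; rewrite !xpair_eqE (negbTE ia).
Qed.


Lemma gaussian_entry_neq i j z : {ae P, forall w, H w i j != z}.
Proof.
apply: filterS (normal_neq matrix_part_meas matrix_part_normal (i, j, false) (complex.Re z)).
by move=> w; apply: contra_neq => <-.
Qed.

Section generic_determinant.
Variable V : 'M[R[i]]_(M, N).
Hypothesis V1 : V ^t* *m V = 1%:M.

Let mixed (L : seq ('I_M * 'I_N)) (y : 'I_M * 'I_N -> R[i]) : 'M[R[i]]_(M, N) :=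
  \matrix_(i, j) if (i, j) \in L then y (i, j) else V i j.

Let mixed_measurable L :
  jointly_measurable (fun y => \det (V ^t* *m mixed L y) == 0).
Proof.
move=> d' S F mF; apply: cmeasurable_eq0; apply: cmeasurable_det.
apply: mxmeasurable_mul; first exact: mxmeasurable_cst.
move=> i j; apply/cmeasurableP; under eq_fun do rewrite mxE.
by case: ((i, j) \in L); [exact: mF|exact: measurable_cst].
Qed.

(* The entries of [V] are replaced one at a time: the determinant is an affine
   function of the new entry, which is not constantly zero. *)
Let mixed_det_neq0 L : uniq L ->
  {ae P, forall w, \det (V ^t* *m mixed L (fun e => H w e.1 e.2)) != 0}.
Proof.
have X_meas (e : 'I_M * 'I_N) : measurable_fun setT (fun w => H w e.1 e.2).
  by case: (H_gaussian e.1 e.2).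
elim: L => [_|x L IH /= /andP[xL /IH {}IH]].
  apply: aeW => w; rewrite (_ : mixed [::] _ = V) ?V1 ?det1 ?oner_eq0 //.
  by apply/matrixP => i j; rewrite mxE.
pose b y := \det (V ^t* *m mixed (x :: L) y) == 0.
have mb := mixed_measurable (x :: L) : jointly_measurable b.
have mX := mb _ T (fun e w => H w e.1 e.2) X_meas.
apply/(integral_bool_eq0 P mX).
have mf : jointly_measurable (fun y => ((b y)%:R : R)%:E).
  by move=> d' S F mF; exact: (bool_measurable (mb _ _ _ mF)).
apply: (ge0_integral_resample_cst X_meas H_indep (J := [set x]%SET) mf) => //.
apply: filterS IH => w' det0.
set A := mixed L (fun e => H w' e.1 e.2) in det0.
pose D : 'M[R[i]]_(M, N) := delta_mx x.1 x.2.
have AE w : mixed (x :: L) (resample (fun e w => H w e.1 e.2) [set x]%SET w w') =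
    A + (H w x.1 x.2 - V x.1 x.2) *: D.
  apply/matrixP => i j; rewrite !mxE inE /resample inE.
  have [e|ne] /= := eqVneq (i, j) x.
    by move: xL; rewrite -e => /negbTE->; rewrite /= !eqxx mulr1 addrC subrK.
  rewrite (_ : (i == x.1) && (j == x.2) = false) ?mulr0 ?addr0 //.
  by apply: contraNF ne => /andP[/eqP-> /eqP->]; rewrite -surjective_pairing.
have detE t : \det (V ^t* *m (A + t *: D)) =
    (1 - t) * \det (V ^t* *m A) + t * \det (V ^t* *m (A + D)).
  rewrite !mulmxDr -scalemxAr; apply: (det_col_affine (j := x.2)) => i k kj.
  rewrite mxE big1 // => l _; rewrite !mxE (negbTE kj) andbF mulr0 //.
have mbw : measurable_fun setT (fun w => b (resample (fun e w => H w e.1 e.2) [set x]%SET w w')).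
  apply: (mb _ T (fun e w => resample (fun e w => H w e.1 e.2) [set x]%SET w w' e)) => e.
  by rewrite /resample; case: (e \in _); [exact: X_meas|exact: measurable_cst].
apply/(integral_bool_eq0 P mbw).
set p := \det (V ^t* *m A) in detE det0; set q := \det (V ^t* *m (A + D)) in detE.
(* The determinant is p - t (p - q) with p != 0. Its only possible zero is t = p / (p - q), and t is
   the new entry minus that of V. *)
apply: filterS (gaussian_entry_neq x.1 x.2 (V x.1 x.2 + p / (p - q))) => w.
apply: contra; rewrite /b AE detE => /eqP e0.
have pq : p - q != 0.
  apply: contra det0; rewrite subr_eq0 => /eqP epq; move: e0.
  by rewrite -epq -mulrDl subrK mul1r => ->.
set t := H w _ _ - _ in e0.
have : t * (p - q) = p.
  apply/eqP; rewrite -subr_eq0 -oppr_eq0 -e0 -subr_eq0; apply/eqP; ring.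
by move=> tp; rewrite -[X in _ + X / _]tp mulfK // addrC subrK.
Qed.

Lemma gaussian_matrix_generic : {ae P, forall w, V ^t* *m H w \in unitmx}.
Proof.
apply: filterS (mixed_det_neq0 (enum_uniq {: 'I_M * 'I_N})) => w.
rewrite unitmxE unitfE (_ : mixed _ _ = H w) //.
by apply/matrixP => i j; rewrite mxE mem_enum.
Qed.

End generic_determinant.

Lemma gaussian_matrix_second_moment :
  (\int[P]_w (complex.Re (\tr (H w *m (H w) ^t*)))%:E <= ((M * N)%:R : R)%:E)%E.
Proof.
have E w : (complex.Re (\tr (H w *m (H w) ^t*)))%:E =
    (\sum_(x : Ix) (matrix_part x w ^+ 2)%:E)%E.
  rewrite sumEFin; congr (_%:E).
  transitivity (\sum_(e : 'I_M * 'I_N) \sum_(b : bool) matrix_part (e, b) w ^+ 2).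
    rewrite -(pair_bigA _ (fun i j => \sum_(b : bool) matrix_part ((i, j), b) w ^+ 2)) /=.
    rewrite /mxtrace Re_sum; apply: eq_bigr => i _; rewrite mxE Re_sum.
    apply: eq_bigr => j _; rewrite !mxE big_bool -normCK normCR2 /matrix_part /=.
    by rewrite addrC.
  by rewrite pair_bigA; apply: eq_bigr => -[e b] _.
have m2 x : measurable_fun setT (fun w => (matrix_part x w ^+ 2)%:E).
  by apply/measurable_EFinP; apply: measurable_funX; exact: matrix_part_meas.
under eq_integral do rewrite E.
rewrite ge0_integral_sum //; last by move=> x w _; rewrite lee_fin sqr_ge0.
have le2 x : (\int[P]_w (matrix_part x w ^+ 2)%:E <= (2^-1 : R)%:E)%E.
  rewrite (integral_normal matrix_part_meas matrix_part_normal x (f := fun y => (y ^+ 2)%:E)).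
  - exact: normal_second_moment_le.
  - by apply/measurable_EFinP; exact: exprn_measurable.
  - by move=> y; rewrite lee_fin sqr_ge0.
apply: le_trans (lee_sum _ (fun x _ => le2 x)) _.
rewrite sumEFin lee_fin sumr_const !card_prod !card_ord card_bool.
by rewrite mulnC mulrnA -[2^-1 *+ 2]mulr_natr mulVf // pnatr_eq0.
Qed.

End gaussian_matrix.

(** * Isotropic quadratic forms *)

Section rank_and_determinant.
Variable C : numClosedFieldType.

Lemma det_sylvester m n (A : 'M[C]_(m, n)) (B : 'M[C]_(n, m)) :
  \det (1%:M + A *m B) = \det (1%:M + B *m A).
Proof.
transitivity (\det (block_mx 1%:M (- A) B 1%:M)).
  transitivity (\det (block_mx (1%:M + A *m B) (- A) 0 1%:M *m block_mx 1%:M 0 B 1%:M)).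
    by rewrite det_mulmx det_ublock det_lblock !det1 !mulr1.
  by rewrite mulmx_block !mulmx1 !mul0mx !mulmx0 !mul1mx !mulNmx addrK !add0r.
transitivity (\det (block_mx 1%:M 0 B 1%:M *m block_mx 1%:M (- A) 0 (1%:M + B *m A))).
  by rewrite mulmx_block !mulmx1 !mul0mx !mulmx0 !mul1mx !mulmxN !addr0 addrC addrK.
by rewrite det_mulmx det_ublock det_lblock !det1 !mul1r.
Qed.

Lemma rank_mul_adj m n (X : 'M[C]_(m, n)) : \rank (X *m X ^t*) = \rank X.
Proof.
rewrite -(mxrank_mul_ker X (X ^t*)).
suff -> : (X :&: kermx (X ^t*))%MS = 0 by rewrite mxrank0 addn0.
set Y := (X :&: kermx (X ^t*))%MS.
have /submxP[D YE] : (Y <= X)%MS by exact: capmxSl.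
have /sub_kermxP Y0 : (Y <= kermx (X ^t*))%MS by exact: capmxSr.
apply: (@adjmx_inj C); rewrite adjmx0; apply: adjmx_mul_eq0.
rewrite trmxCK.
by rewrite {2}YE adjmxM mulmxA Y0 mul0mx.
Qed.

(** [kerprojP] wants a positive semidefinite argument, while joint measurability is tested on
    arbitrary families of matrices. A^H A has the same kernel as A and is always positive
    semidefinite. *)
Definition nullproj n (A : 'M[C]_n) : 'M[C]_n := kerproj (A ^t* *m A).

Lemma psd_adj_mul m n (A : 'M[C]_(m, n)) : psd (A ^t* *m A).
Proof. by have := psd_conj A (@psd1 C m); rewrite mulmx1. Qed.

Lemma nullprojE n (A : 'M[C]_n) : psd A -> nullproj A = kerproj A.
Proof.
move=> psdA; have [sK AK KX] := kerprojP psdA.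
apply/esym/kerproj_uniq => //; first exact: psd_adj_mul.
  by rewrite -mulmxA AK mulmx0.
move=> p X AAX; apply: KX; apply: adjmx_mul_eq0.
by rewrite adjmxM -mulmxA [A ^t* *m _]mulmxA AAX mulmx0.
Qed.

Lemma psd_nullproj n (A : 'M[C]_n) : psd (nullproj A).
Proof.
have pA := psd_adj_mul A; have [sK _ _] := kerprojP pA.
by rewrite /nullproj -(kerproj_idem pA) -{1}sK; exact: psd_adj_mul.
Qed.

Lemma nullproj_conj n (Q A : 'M[C]_n) : Q \is unitarymx -> psd A ->
  nullproj (Q *m A *m Q ^t*) = Q *m nullproj A *m Q ^t*.
Proof.
move=> uQ pA; rewrite !nullprojE ?kerproj_conj //.
by have := psd_conj (Q ^t*) pA; rewrite trmxCK.
Qed.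

End rank_and_determinant.

(** * Measurability of ranks, kernels and selections *)

Section matrix_measurability.
Context d (S : measurableType d) (R : realType).

Lemma mxmeasurable_if m n (b : S -> bool) (F G : S -> 'M[R[i]]_(m, n)) :
  measurable_fun setT b -> mxmeasurable F -> mxmeasurable G ->
  mxmeasurable (fun s => if b s then F s else G s).
Proof.
move=> mb mF mG i j.
rewrite (_ : (fun s => _) = (fun s => if b s then F s i j else G s i j)).
  exact: cmeasurable_if.
by apply/funext => s; case: (b s).
Qed.

Lemma mxmeasurable_nullproj n (F : S -> 'M[R[i]]_n) : mxmeasurable F ->
  mxmeasurable (fun s => nullproj (F s)).
Proof.
move=> mF; apply: mxmeasurable_kerproj => [s|]; first exact: psd_adj_mul.
by apply: mxmeasurable_mul => //; exact: mxmeasurable_adj.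
Qed.

(** The rank is m minus the trace of the projector onto the kernel of F F^H, and that projector is
    measurable. *)
Lemma measurable_rank_eq m n r (F : S -> 'M[R[i]]_(m, n)) : mxmeasurable F ->
  measurable_fun setT (fun s => \rank (F s) == r).
Proof.
move=> mF; have rE s : (\rank (F s) == r) =
    (complex.Re (\tr (kerproj (F s *m (F s) ^t*))) == m%:R - r%:R).
  rewrite kerproj_mxtrace; last exact: psd_mul_adj.
  by rewrite rank_mul_adj Re_nat natrB ?rank_leq_row // (inj_eq (addrI _)) eqr_opp eqr_nat.
under eq_fun do rewrite rE.
apply: measurable_fun_eqr; last exact: measurable_cst.
have [] // : cmeasurable (fun s => \tr (kerproj (F s *m (F s) ^t*))).
apply: cmeasurable_trace; apply: mxmeasurable_kerproj => [s|]; first exact: psd_mul_adj.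
by apply: mxmeasurable_mul => //; exact: mxmeasurable_adj.
Qed.

Lemma measurable_finfun (J : finType) (E : J -> S -> bool) (g : {ffun J -> bool} -> bool) :
  (forall j, measurable_fun setT (E j)) ->
  measurable_fun setT (fun s => g [ffun j => E j s]).
Proof.
move=> mE; apply: (measurable_fun_bool true); rewrite setTI.
have -> : (fun s => g [ffun j => E j s]) @^-1` [set true] =
    \bigcup_(t in [set t | g t]) \bigcap_(j in [set: J]) (E j @^-1` [set t j]).
  apply/seteqP; split=> [s /= gs|s [t /= gt Et]].
    by exists [ffun j => E j s] => // j _ /=; rewrite ffunE.
  by rewrite (_ : [ffun j => E j s] = t) //; apply/ffunP => j; rewrite ffunE; exact: Et.
apply: fin_bigcup_measurable => // t _; apply: fin_bigcap_measurable => // j _.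
by have := mE j measurableT [set t j] I; rewrite setTI.
Qed.

(** The minimiser, ties included, is a function of the finite table of comparisons between the
    values. *)
Lemma measurable_arg_min (J : finType) (j0 j : J) (f : J -> S -> R) :
  (forall j, measurable_fun setT (f j)) ->
  measurable_fun setT (fun s => [arg min_(j < j0) f j s]%O == j).
Proof.
move=> mf.
pose g (t : {ffun J * J -> bool}) :=
  odflt j0 [pick i | [forall k, t (i, k)]] == j.
rewrite (_ : (fun s => _) = (fun s => g [ffun p => f p.1 s <= f p.2 s])).
  by apply: measurable_finfun => p; exact: measurable_fun_ler.
apply/funext => s; rewrite /g /Order.arg_min /extremum; congr (odflt _ _ == _).
by apply: eq_pick => i /=; apply: eq_forallb => k; rewrite ffunE.
Qed.

Lemma mxmeasurable_select m n (J : finType) (j : S -> J) (F : J -> S -> 'M[R[i]]_(m, n)) :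
  (forall k, measurable_fun setT (fun s => j s == k)) ->
  (forall k, mxmeasurable (F k)) -> mxmeasurable (fun s => F (j s) s).
Proof.
move=> mj mF; rewrite (_ : (fun s => _) = (fun s => \sum_k if j s == k then F k s else 0)).
  by apply: mxmeasurable_sum => k _; apply: mxmeasurable_if => //; exact: mxmeasurable_cst.
apply/funext => s; rewrite (bigD1 (j s)) //= eqxx big1 ?addr0 // => k.
by rewrite eq_sym => /negbTE->.
Qed.

End matrix_measurability.

Section isotropy.
Context d (T : measurableType d) (R : realType) (P : probability T R).
Variables (M m : nat) (F : T -> 'M[R[i]]_M) (V : 'M[R[i]]_(M, m)).
Hypotheses (F_meas : mxmeasurable F) (F_psd : forall w, psd (F w)).
Let phi p (X : 'M[R[i]]_(M, p)) : \bar R :=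
  (\int[P]_w (complex.Re (\tr (X ^t* *m F w *m X)))%:E)%E.
Hypothesis F_isotropic : forall u v : 'cV[R[i]]_m,
  normsq u = 1 -> normsq v = 1 -> phi (V *m u) = phi (V *m v).

Lemma retrace_ge0 p (X : 'M[R[i]]_(M, p)) w :
  0 <= complex.Re (\tr (X ^t* *m F w *m X)).
Proof.
have := psd_mxtrace_ge0 (psd_conj X (F_psd w)).
exact: (@ler_normr_normc R 0).
Qed.

Lemma retrace_meas p (X : 'M[R[i]]_(M, p)) :
  measurable_fun setT (fun w => (complex.Re (\tr (X ^t* *m F w *m X)))%:E).
Proof.
apply/measurable_EFinP.
have [] // : cmeasurable (fun w => \tr (X ^t* *m F w *m X)).
apply: cmeasurable_trace; apply: mxmeasurable_mul; last exact: mxmeasurable_cst.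
by apply: mxmeasurable_mul => //; exact: mxmeasurable_cst.
Qed.

Let phi_cols p (X : 'M[R[i]]_(M, p)) : phi X = (\sum_j phi (col j X))%E.
Proof.
rewrite /phi -ge0_integral_sum //; last 2 first.
- by move=> j; exact: retrace_meas.
- by move=> j w _; rewrite lee_fin retrace_ge0.
apply: eq_integral => w _; rewrite sumEFin -Re_sum; congr (complex.Re _)%:E.
apply: eq_bigr => j _; rewrite /mxtrace big_ord1 adj_col_mulE !mxE.
by apply: eq_bigr => k _; rewrite !mxE.
Qed.

(* A quadratic form with equal means in all directions of the range of [V] has
   mean proportional to the squared norm. *)
Lemma isotropic_trace p (C : 'M[R[i]]_(m, p)) : (0 < m)%N ->
  (m%:R%:E * phi (V *m C) = (complex.Re (\tr (C ^t* *m C)))%:E * phi V)%E.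
Proof.
move=> m0; pose a := phi (V *m delta_mx (Ordinal m0) (0 : 'I_1)).
have a0 : (0 <= a)%E by apply: integral_ge0 => w _; rewrite lee_fin retrace_ge0.
have n1 (j : 'I_m) : normsq (delta_mx j 0 : 'cV[R[i]]_m) = 1.
  rewrite normsqE (bigD1 j) //= big1 ?addr0; first by rewrite !mxE !eqxx normr1 expr1n.
  by move=> k kj; rewrite !mxE (negbTE kj) normr0 expr0n.
have phiE (u : 'cV[R[i]]_m) : phi (V *m u) = ((complex.Re (normsq u))%:E * a)%E.
  have [->|u0] := eqVneq u 0.
    rewrite mulmx0 /normsq adjmx0 !mul0mx mxE mul0e /phi; apply: integral0_eq => w _.
    by rewrite mulmx0 mxtrace0.
  pose t := sqrtC (normsq u).
  have t0 : t != 0 by rewrite sqrtC_eq0 normsq_eq0.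
  have tge : 0 <= t by rewrite sqrtC_ge0 normsq_ge0.
  have tt : `|t| ^+ 2 = normsq u by rewrite ger0_norm // sqrtCK.
  have uE : u = t *: (t^-1 *: u) by rewrite scalerA divff // scale1r.
  have u1 : normsq (t^-1 *: u) = 1.
    by rewrite normsqZ -tt -exprMn -normrM mulVf // normr1 expr1n.
  have -> : a = phi (V *m (t^-1 *: u)) by apply: F_isotropic; rewrite ?n1.
  rewrite {1}uE -scalemxAr /phi -tt.
  rewrite -ge0_integralZl //; last 3 first.
  - exact: retrace_meas.
  - by move=> w _; rewrite lee_fin retrace_ge0.
  - by rewrite lee_fin tt (@ler_normr_normc R 0) // normsq_ge0.
  apply: eq_integral => w _; rewrite -EFinM; congr (_%:E).
  set X := V *m _; have -> : (t *: X) ^t* *m F w *m (t *: X) = `|t| ^+ 2 *: (X ^t* *m F w *m X).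
    by rewrite adjmxZ -!scalemxAl -scalemxAr scalerA normCK mulrC.
  by rewrite mxtraceZ normCR2 Re_mul /= mul0r subr0.
have phiV : phi V = (m%:R%:E * a)%E.
  rewrite phi_cols (eq_bigr (fun _ => 1%:E * a)%E) => [|j _].
    by rewrite -ge0_sume_distrl // sumEFin sumr_const card_ord.
  by rewrite colE phiE n1.
rewrite phiV phi_cols (eq_bigr (fun j => (complex.Re (normsq (col j C)))%:E * a)%E).
  rewrite -ge0_sume_distrl; last by move=> j _; rewrite lee_fin (@ler_normr_normc R 0) // normsq_ge0.
  by rewrite sumEFin -Re_sum -mxtrace_adj_mul muleCA.
by move=> j _; rewrite -phiE !colE mulmxA.
Qed.

End isotropy.

(** * Independent conjugation-invariant matrices *)

Local Notation retr A := (complex.Re (\tr A)).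

Section conjugation_invariant_family.
Context d (T : measurableType d) (R : realType) (P : probability T R).
Variables (I : finType) (M : nat) (Y : I -> T -> 'M[R[i]]_M).
Hypothesis Y_meas : forall x, measurable_fun setT (Y x).
Hypothesis Y_indep : mutually_independent P (fun x => sigma_of (Y x)).

Definition conj_on (J : {set I}) (Q : 'M[R[i]]_M) (y : I -> 'M[R[i]]_M) : I -> 'M[R[i]]_M :=
  fun x => if x \in J then Q *m y x *m Q ^t* else y x.

Lemma conj_measurable d' (S : measurableType d') (Q : 'M[R[i]]_M) (F : S -> 'M[R[i]]_M) :
  measurable_fun setT F -> measurable_fun setT (fun s => Q *m F s *m Q ^t*).
Proof.
move=> /mxmeasurableP mF; apply/mxmeasurableP.
by apply: mxmeasurable_mul; [apply: mxmeasurable_mul => //|]; exact: mxmeasurable_cst.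
Qed.

Lemma conj_on_measurable J Q d2 (Z : measurableType d2) (f : (I -> 'M[R[i]]_M) -> Z) :
  jointly_measurable f -> jointly_measurable (fun y => f (conj_on J Q y)).
Proof.
move=> mf d' S F mF.
apply: (mf _ S (fun x s => conj_on J Q (fun x => F x s) x)) => x.
by rewrite /conj_on; case: (x \in J); [exact: conj_measurable|exact: mF].
Qed.

Hypothesis Y_inv : forall x (Q : 'M[R[i]]_M) (phi : 'M[R[i]]_M -> \bar R),
  Q \is unitarymx -> measurable_fun setT phi -> (forall A, 0 <= phi A)%E ->
  (\int[P]_w phi (Q *m Y x w *m Q ^t*) = \int[P]_w phi (Y x w))%E.

Let integral_conj1 x Q (f : (I -> 'M[R[i]]_M) -> \bar R) : Q \is unitarymx ->
  jointly_measurable f -> (forall y, 0 <= f y)%E ->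
  (\int[P]_w f (conj_on [set x] Q (fun x => Y x w)) = \int[P]_w f (fun x => Y x w))%E.
Proof.
move=> uQ mf f0.
rewrite (ge0_integral_resample Y_meas Y_indep [set x] (conj_on_measurable [set x] Q mf)); last first.
  by move=> y; exact: f0.
rewrite (ge0_integral_resample Y_meas Y_indep [set x] mf f0).
apply: eq_integral => w' _.
pose phi A := f (fun z => if z == x then A else Y z w').
have mphi : measurable_fun setT phi.
  apply: (mf _ 'M[R[i]]_M (fun z A => if z == x then A else Y z w')) => z.
  by case: (z == x); [exact: measurable_id|exact: measurable_cst].
transitivity (\int[P]_w phi (Q *m Y x w *m Q ^t*))%E.
  apply: eq_integral => w _; congr f; apply/funext => z; rewrite /conj_on /resample !inE.
  by have [->|] := eqVneq z x.
rewrite (Y_inv x uQ mphi) => [|A]; last exact: f0.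
apply: eq_integral => w _; congr f; apply/funext => z; rewrite /resample !inE.
by have [->|] := eqVneq z x.
Qed.

Lemma integral_conj_on J Q (f : (I -> 'M[R[i]]_M) -> \bar R) : Q \is unitarymx ->
  jointly_measurable f -> (forall y, 0 <= f y)%E ->
  (\int[P]_w f (conj_on J Q (fun x => Y x w)) = \int[P]_w f (fun x => Y x w))%E.
Proof.
move=> uQ; suff main (s : seq I) : uniq s -> forall f : (I -> 'M[R[i]]_M) -> \bar R,
    jointly_measurable f -> (forall y, 0 <= f y)%E ->
    (\int[P]_w f (conj_on [set x in s] Q (fun x => Y x w)) = \int[P]_w f (fun x => Y x w))%E.
  move=> mf f0; rewrite -(main (enum J) (enum_uniq _) f mf f0).
  apply: eq_integral => w _; congr (f (conj_on _ _ _)).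
  by apply/setP => x; rewrite inE mem_enum.
elim: s => [_|x s IH /= /andP[xs us]] {}f mf f0.
  by apply: eq_integral => w _; congr f; apply/funext => x; rewrite /conj_on inE.
rewrite -(integral_conj1 x uQ mf f0).
rewrite -(IH us (fun y => f (conj_on [set x] Q y)) (conj_on_measurable _ _ mf)); last first.
  by move=> y; exact: f0.
apply: eq_integral => w _; congr f; apply/funext => z; rewrite /conj_on !inE.
have [->|_] //= := eqVneq z x.
by rewrite (negbTE xs).
Qed.

End conjugation_invariant_family.

(** * Generic rank of sums of independent matrices *)

Section generic_rank.
Context d (T : measurableType d) (R : realType) (P : probability T R).
Variables (I : finType) (M N : nat) (Y : I -> T -> 'M[R[i]]_M).
Hypothesis Y_meas : forall x, measurable_fun setT (Y x).
Hypothesis Y_indep : mutually_independent P (fun x => sigma_of (Y x)).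
Hypothesis Y_factor : forall x w, exists X : 'M[R[i]]_(M, N), Y x w = X *m X ^t*.
Hypothesis Y_generic : forall x (V : 'M[R[i]]_(M, N)), V ^t* *m V = 1%:M ->
  {ae P, forall w, V ^t* *m Y x w *m V \in unitmx}.

Lemma factor_psd x w : psd (Y x w).
Proof. by have [X ->] := Y_factor x w; exact: psd_mul_adj. Qed.

(** [Y_generic] concerns a fixed frame V. With the other components frozen, the partial sum A still
    has N orthonormal vectors V in its kernel; the resampled next term is almost surely nonsingular
    on them, and [psd_rank_add] adds N to the rank. *)
Lemma generic_rank_sum (s : seq I) (G : 'M[R[i]]_M) : uniq s -> psd G ->
  (\rank G + size s * N <= M)%N ->
  {ae P, forall w, \rank (G + \sum_(x <- s) Y x w)%R = (\rank G + size s * N)%N}.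
Proof.
move=> us pG; elim: s us => [_ _|x s IH /= /andP[xs us] rM].
  by apply: aeW => w; rewrite big_nil addr0 addn0.
have rM' : (\rank G + size s * N + N <= M)%N by rewrite -addnA (addnC _ N) -mulSn.
have {IH} := IH us (leq_trans (leq_addr _ _) rM').
set r := (\rank G + size s * N)%N in rM' * => IH.
have -> : (\rank G + (size s).+1 * N = r + N)%N by rewrite mulSn (addnC N) addnA.
pose b (y : I -> 'M[R[i]]_M) := \rank (G + \sum_(z <- x :: s) y z)%R != (r + N)%N.
have mb : jointly_measurable b.
  move=> d' S F mF; apply: measurable_neg; apply: measurable_rank_eq.
  apply: mxmeasurable_add; first exact: mxmeasurable_cst.
  by apply: mxmeasurable_sum => z _; exact/mxmeasurableP.
have mX := mb _ T Y Y_meas.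
suff : {ae P, forall w, ~~ b (fun x => Y x w)} by apply: filterS => w; rewrite negbK => /eqP.
apply/(integral_bool_eq0 P mX).
have mf : jointly_measurable (fun y => ((b y)%:R : R)%:E).
  by move=> d' S F mF; exact: (bool_measurable (mb _ _ _ mF)).
apply: (ge0_integral_resample_cst Y_meas Y_indep (J := [set x]%SET) mf) => //.
apply: filterS IH => w' rA.
set A := (G + _)%R in rA.
have pA : psd A by apply: (psdD pG); apply: psd_sum => z _; exact: factor_psd.
have [V V1 AV] : exists2 V : 'M[R[i]]_(M, N), V ^t* *m V = 1%:M & A *m V = 0.
  by apply: kerproj_basis => //; rewrite rA.
have mbw : measurable_fun setT (fun w => b (resample Y [set x]%SET w w')).
  apply: (mb _ T (fun e w => resample Y [set x]%SET w w' e)) => e.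
  by rewrite /resample; case: (e \in _); [exact: Y_meas|exact: measurable_cst].
apply/(integral_bool_eq0 P mbw).
apply: filterS (Y_generic x V1) => w VYV; rewrite negbK.
have [X YE] := Y_factor x w.
have VX : V ^t* *m X \in unitmx.
  move: VYV; rewrite YE mulmxA -mulmxA unitmx_mul => /andP[vx _].
  exact: vx.
have sE : (G + \sum_(z <- x :: s) resample Y [set x]%SET w w' z = A + X *m X ^t*)%R.
  rewrite big_cons /resample inE eqxx -YE addrCA addrC; congr (_ + _).
  rewrite /A; congr (_ + _); rewrite !big_seq; apply: eq_bigr => z zs.
  by rewrite inE; have [e|//] := eqVneq z x; rewrite e (negbTE xs) in zs.
by rewrite sE (psd_rank_add pA AV VX) rA.
Qed.

End generic_rank.

(** * Quantization in terms of projectors *)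

Section code_selection.
Variables (R : realType) (M N B : nat).
Local Notation codes := (B.-tuple bool -> 'M[R[i]]_M).

(** When S projects onto the orthogonal complement of the channel, the minimised trace is the
    squared chordal distance, so that this is the quantizer expressed on Gram matrices. *)
Definition code_index (S : 'M[R[i]]_M) (c : codes) : B.-tuple bool :=
  [arg min_(b < [tuple of nseq B false]) retr (S *m c b)]%O.

Lemma eq_code_index S S' (c c' : codes) :
  (forall b, retr (S *m c b) = retr (S' *m c' b)) ->
  code_index S c = code_index S' c'.
Proof.
by move=> e; rewrite /code_index (_ : (fun b => retr (S *m c b)) = (fun b => retr (S' *m c' b))) //; apply/funext.
Qed.

Lemma mxtrace_conj (Q A D : 'M[R[i]]_M) : Q \is unitarymx ->
  \tr ((Q *m A *m Q ^t*) *m (Q *m D *m Q ^t*)) = \tr (A *m D).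
Proof.
move=> uQ; rewrite -!mulmxA mxtrace_mulC -!mulmxA (mulmxA (Q ^t*) Q) (unitarymx_adjl uQ) mul1mx.
by rewrite mulmx1.
Qed.

Lemma code_index_conj (Q S : 'M[R[i]]_M) (c : codes) : Q \is unitarymx ->
  code_index (Q *m S *m Q ^t*) (fun b => Q *m c b *m Q ^t*) = code_index S c.
Proof. by move=> uQ; apply: eq_code_index => b; rewrite mxtrace_conj. Qed.

Lemma mxmeasurable_code d (T : measurableType d) (S : T -> 'M[R[i]]_M) (c : B.-tuple bool -> T -> 'M[R[i]]_M) :
  mxmeasurable S -> (forall b, mxmeasurable (c b)) ->
  mxmeasurable (fun w => c (code_index (S w) (fun b => c b w)) w).
Proof.
move=> mS mc; apply: (mxmeasurable_select (j := fun w => code_index (S w) (fun b => c b w))) => // b.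
apply: (measurable_arg_min _ _ (f := fun b w => retr (S w *m c b w))) => b'.
have [] // : cmeasurable (fun w => \tr (S w *m c b' w)).
by apply: cmeasurable_trace; exact: mxmeasurable_mul.
Qed.

(* The rank condition matches the default value of [chordal_dist]. *)
Definition channel_nullproj (A : 'M[R[i]]_M) : 'M[R[i]]_M :=
  if \rank A == N then nullproj A else 0.

Lemma channel_nullproj_conj Q A : Q \is unitarymx -> psd A ->
  channel_nullproj (Q *m A *m Q ^t*) = Q *m channel_nullproj A *m Q ^t*.
Proof.
move=> uQ pA; rewrite /channel_nullproj nullproj_conj //.
have uQ' : Q ^t* \in unitmx.
  by apply: (mulmx1_unit (unitarymx_adjl uQ)).1.
have uQ1 : Q \in unitmx by apply: (mulmx1_unit (unitarymx_adjl uQ)).2.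
have -> : \rank (Q *m A *m Q ^t*) = \rank A.
  by rewrite mxrankMfree ?row_free_unit // eqmxMfull // row_full_unit.
by case: ifP => _ //; rewrite mulmx0 mul0mx.
Qed.

Lemma mxmeasurable_channel_nullproj d (T : measurableType d) (F : T -> 'M[R[i]]_M) :
  mxmeasurable F -> mxmeasurable (fun w => channel_nullproj (F w)).
Proof.
move=> mF; apply: mxmeasurable_if; last exact: mxmeasurable_cst.
  exact: measurable_rank_eq.
exact: mxmeasurable_nullproj.
Qed.

End code_selection.

Section quantized_interference.
Context d (T : measurableType d) (R : realType) (P : probability T R).
Variables (M N K B : nat).
Let Comp : finType := ('I_K + 'I_K * B.-tuple bool)%type.
Variable Y : Comp -> T -> 'M[R[i]]_M.
Hypothesis Y_meas : forall x, measurable_fun setT (Y x).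
Hypothesis Y_indep : mutually_independent P (fun x => sigma_of (Y x)).
Hypothesis Y_factor : forall x w, exists X : 'M[R[i]]_(M, N), Y x w = X *m X ^t*.
Hypothesis Y_generic : forall x (V : 'M[R[i]]_(M, N)), V ^t* *m V = 1%:M ->
  {ae P, forall w, V ^t* *m Y x w *m V \in unitmx}.
Hypothesis Y_inv : forall x (Q : 'M[R[i]]_M) (phi : 'M[R[i]]_M -> \bar R),
  Q \is unitarymx -> measurable_fun setT phi -> (forall A, 0 <= phi A)%E ->
  (\int[P]_w phi (Q *m Y x w *m Q ^t*) = \int[P]_w phi (Y x w))%E.

Definition sel_index (y : Comp -> 'M[R[i]]_M) (k : 'I_K) : B.-tuple bool :=
  code_index (channel_nullproj N (y (inl k))) (fun b => y (inr (k, b))).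

Definition sel_code (y : Comp -> 'M[R[i]]_M) (k : 'I_K) : 'M[R[i]]_M :=
  y (inr (k, sel_index y k)).

Definition user_of (x : Comp) : 'I_K := match x with inl k => k | inr (k, _) => k end.

Definition comps_of (U : {set 'I_K}) : {set Comp} := [set x | user_of x \in U].

Lemma mxmeasurable_sel_code d' (S : measurableType d') (F : Comp -> S -> 'M[R[i]]_M) k :
  (forall x, measurable_fun setT (F x)) -> mxmeasurable (fun s => sel_code (fun x => F x s) k).
Proof.
move=> mF.
apply: (mxmeasurable_code (c := fun b s => F (inr (k, b)) s)) => [|b]; last exact/mxmeasurableP.
by apply: mxmeasurable_channel_nullproj; exact/mxmeasurableP.
Qed.

Lemma eq_sel_code y y' k : (forall x, user_of x = k -> y x = y' x) ->
  sel_code y k = sel_code y' k.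
Proof.
move=> e; rewrite /sel_code /sel_index (e (inl k)) // e //; congr (y' (inr (k, _))).
by apply: eq_code_index => b; rewrite e.
Qed.

(** The selection only compares traces of products, which are unchanged when the channel and the
    codebook of a user are conjugated together. *)
Lemma sel_code_conj (U : {set 'I_K}) Q y k : Q \is unitarymx -> psd (y (inl k)) -> k \in U ->
  sel_code (conj_on (comps_of U) Q y) k = Q *m sel_code y k *m Q ^t*.
Proof.
move=> uQ py kU; rewrite /sel_code /sel_index.
have eA : conj_on (comps_of U) Q y (inl k) = Q *m y (inl k) *m Q ^t*.
  by rewrite /conj_on inE kU.
have eC b : conj_on (comps_of U) Q y (inr (k, b)) = Q *m y (inr (k, b)) *m Q ^t*.
  by rewrite /conj_on inE kU.
rewrite eC; congr (Q *m y (inr (k, _)) *m Q ^t*).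
rewrite eA (channel_nullproj_conj _ uQ py) -[RHS](code_index_conj _ _ uQ).
by apply: eq_code_index => b; rewrite eC.
Qed.

Lemma sel_code_psd w k : psd (sel_code (fun x => Y x w) k).
Proof. exact: factor_psd. Qed.

(** The selection depends on the channels, but it always agrees with one of finitely many fixed
    choices f of codewords, and the rank is generic for all of them outside a single null set. *)
Lemma generic_rank_sel_code (U : {set 'I_K}) (G : 'M[R[i]]_M) : psd G ->
  (\rank G + #|U| * N <= M)%N ->
  {ae P, forall w, \rank (G + \sum_(k in U) sel_code (fun x => Y x w) k)%R = (\rank G + #|U| * N)%N}.
Proof.
move=> pG rM.
have main (f : {ffun 'I_K -> B.-tuple bool}) :
    {ae P, forall w, \rank (G + \sum_(k in U) Y (inr (k, f k)) w)%R = (\rank G + #|U| * N)%N}.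
  pose s : seq Comp := [seq inr (k, f k) | k <- enum U].
  have us : uniq s by rewrite map_inj_uniq ?enum_uniq // => k l [].
  have := generic_rank_sum Y_meas Y_indep Y_factor Y_generic us pG.
  rewrite size_map -cardE => /(_ rM); apply: filterS => w <-.
  by rewrite big_map big_enum.
apply: filterS (filter_forall (ae_filter_ringOfSetsType P) main) => w /(_ [ffun k => sel_index (fun x => Y x w) k]) <-.
by congr (\rank (G + _)%R); apply: eq_bigr => k _; rewrite ffunE.
Qed.

End quantized_interference.

Lemma orthonormal_row_mx (C : numClosedFieldType) M n p (h : 'M[C]_(M, n)) (u : 'M[C]_(M, p)) :
  h ^t* *m h = 1%:M -> h ^t* *m u = 0 /\ u ^t* *m u = 1%:M ->
  (row_mx h u) ^t* *m row_mx h u = 1%:M.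
Proof.
move=> h1 [hu u1]; rewrite tr_row_mx map_col_mx mul_col_row h1 hu u1.
have -> : u ^t* *m h = 0 by apply: (@adjmx_inj C); rewrite adjmxM trmxCK hu adjmx0.
by rewrite -scalar_mx_block.
Qed.

(** * Energy in the null space of the quantized channels *)

Section interference.
Context d (T : measurableType d) (R : realType) (P : probability T R).
Variables (M N K B : nat).
Let Comp : finType := ('I_K + 'I_K * B.-tuple bool)%type.
Variable Y : Comp -> T -> 'M[R[i]]_M.
Hypothesis Y_meas : forall x, measurable_fun setT (Y x).
Hypothesis Y_indep : mutually_independent P (fun x => sigma_of (Y x)).
Hypothesis Y_factor : forall x w, exists X : 'M[R[i]]_(M, N), Y x w = X *m X ^t*.
Hypothesis Y_generic : forall x (V : 'M[R[i]]_(M, N)), V ^t* *m V = 1%:M ->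
  {ae P, forall w, V ^t* *m Y x w *m V \in unitmx}.
Hypothesis Y_inv : forall x (Q : 'M[R[i]]_M) (phi : 'M[R[i]]_M -> \bar R),
  Q \is unitarymx -> measurable_fun setT phi -> (forall A, 0 <= phi A)%E ->
  (\int[P]_w phi (Q *m Y x w *m Q ^t*) = \int[P]_w phi (Y x w))%E.
Local Notation code := (sel_code N).
Local Notation Yw := (fun w x => Y x w).

Lemma retr_ge0 m (A : 'M[R[i]]_m) : psd A -> 0 <= retr A.
Proof. by move=> /psd_mxtrace_ge0; exact: (@ler_normr_normc R 0). Qed.

Lemma retr_measurable d' (S : measurableType d') m (F : S -> 'M[R[i]]_m) :
  mxmeasurable F -> measurable_fun setT (fun s => (retr (F s))%:E).
Proof.
move=> mF; apply/measurable_EFinP.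
by have [] // : cmeasurable (fun w => \tr (F w)) by exact: cmeasurable_trace.
Qed.

Section null_space.
Variables (U : {set 'I_K}) (h : 'M[R[i]]_(M, N)).
Hypothesis h1 : h ^t* *m h = 1%:M.

(** h is a frozen quantized channel, and U the other users whose quantized channels a given precoder
    has to avoid. *)
Let cov (y : Comp -> 'M[R[i]]_M) := (h *m h ^t* + \sum_(k in U) code y k)%R.
Let F (y : Comp -> 'M[R[i]]_M) := nullproj (cov y).

Let cov_psd w : psd (cov (Yw w)).
Proof.
by apply: psdD; [exact: psd_mul_adj|apply: psd_sum => k _; exact: (sel_code_psd Y_factor)].
Qed.

Let F_meas d' (S : measurableType d') (G : Comp -> S -> 'M[R[i]]_M) :
  (forall x, measurable_fun setT (G x)) -> mxmeasurable (fun s => F (fun x => G x s)).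
Proof.
move=> mG; apply: mxmeasurable_nullproj; apply: mxmeasurable_add; first exact: mxmeasurable_cst.
by apply: mxmeasurable_sum => k _; exact: mxmeasurable_sel_code.
Qed.

Let F_orth w : F (Yw w) *m h = 0.
Proof.
have pc := cov_psd w; have [sF cF _] := kerprojP pc.
have ph : psd (h *m h ^t*) by exact: psd_mul_adj.
have pS : psd (\sum_(k in U) code (Yw w) k).
  by apply: psd_sum => k _; exact: (sel_code_psd Y_factor).
have hF : h *m h ^t* *m kerproj (cov (Yw w)) = 0 by exact: (psd_addl_ker ph pS).
rewrite /F (nullprojE pc); apply: (@adjmx_inj R[i]); rewrite adjmx0 adjmxM sF.
transitivity (h ^t* *m (h *m h ^t* *m kerproj (cov (Yw w)))); last by rewrite hF mulmx0.
by rewrite !mulmxA h1 mul1mx.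
Qed.

Let F_conj w (Q : 'M[R[i]]_M) : Q \is unitarymx -> Q *m h = h ->
  F (conj_on (comps_of B U) Q (Yw w)) = Q *m F (Yw w) *m Q ^t*.
Proof.
move=> uQ Qh; rewrite /F -(nullproj_conj uQ (cov_psd w)); congr nullproj.
rewrite /cov mulmxDr mulmxDl mulmx_sumr mulmx_suml; congr (_ + _)%R.
  by rewrite !mulmxA Qh -mulmxA -adjmxM Qh.
by apply: eq_bigr => k kU; apply: sel_code_conj => //; exact: (factor_psd Y_factor).
Qed.

Let F_trace : (#|U|.+1 * N + N = M)%N -> {ae P, forall w, retr (F (Yw w)) = N%:R}.
Proof.
move=> eM; have rh : \rank (h *m h ^t*) = N by rewrite rank_mul_adj (orthonormal_rank h1).
have := generic_rank_sel_code Y_meas Y_indep Y_factor Y_generic (U := U) (psd_mul_adj h).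
rewrite rh -mulSn => /(_ _)/wrap[|/=]; first by rewrite -eM leq_addr.
apply: filterS => w rw.
by rewrite /F (nullprojE (cov_psd w)) (kerproj_mxtrace (cov_psd w)) rw -eM addKn Re_nat.
Qed.

Let mean p (X : 'M[R[i]]_(M, p)) : \bar R :=
  (\int[P]_w (retr (X ^t* *m F (Yw w) *m X))%:E)%E.

Let mean_conj p (X : 'M[R[i]]_(M, p)) Q : Q \is unitarymx -> Q *m h = h ->
  mean (Q *m X) = mean X.
Proof.
(* The absolute value makes f nonnegative on all families, as [integral_conj_on] asks; on the values
   of Y the trace is nonnegative already. The same device recurs below. *)
move=> uQ Qh; pose f y := (`|retr (X ^t* *m Q ^t* *m F y *m (Q *m X))| : R)%:E.
have mf : jointly_measurable f.
  move=> d' S G mG; apply/measurable_EFinP; apply: measurableT_comp => //.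
  apply/measurable_EFinP; apply: retr_measurable.
  apply: mxmeasurable_mul; last exact: mxmeasurable_cst.
  by apply: mxmeasurable_mul; [exact: mxmeasurable_cst|exact: F_meas].
have fE w : f (Yw w) = (retr ((Q *m X) ^t* *m F (Yw w) *m (Q *m X)))%:E.
  rewrite /f -adjmxM ger0_norm //; apply/retr_ge0/psd_conj/psd_nullproj.
transitivity (\int[P]_w f (Yw w))%E; first by apply: eq_integral => w _; rewrite fE.
rewrite -(integral_conj_on Y_meas Y_indep Y_inv (comps_of B U) uQ mf) => [|y]; last first.
  by rewrite lee_fin normr_ge0.
apply: eq_integral => w _; rewrite /f (F_conj w uQ Qh) ger0_norm.
  by rewrite !mulmxA -(mulmxA (X ^t*)) (unitarymx_adjl uQ) mulmx1
    -(mulmxA _ (Q ^t*)) (unitarymx_adjl uQ) mulmx1.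
rewrite -adjmxM; apply/retr_ge0/psd_conj.
by have := psd_conj (Q ^t*) (psd_nullproj (cov (Yw w))); rewrite trmxCK.
Qed.

(* The kernel of the covariance lies in the orthogonal complement of [h], of
   dimension [M - N]; it has dimension [N] and is isotropic there, as the
   unitary group fixing [h] is transitive on the unit vectors of the complement. *)
Lemma integral_interference p (X : 'M[R[i]]_(M, p)) :
  (0 < N)%N -> (#|U|.+1 * N + N = M)%N ->
  ((#|U|.+1 * N)%:R%:E * \int[P]_w (retr (X ^t* *m F (Yw w) *m X))%:E =
   (retr (X ^t* *m (1%:M - h *m h ^t*) *m X) * N%:R)%:E)%E.
Proof.
move=> N0 eM.
have [|Z' [uZ' hZ' hhZ]] := @unitarymx_complement R[i] N M (h ^t*).
  by apply/unitarymxP; rewrite trmxCK.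
pose Z := Z' ^t*.
have Z1 : Z ^t* *m Z = 1%:M by rewrite /Z trmxCK; exact/unitarymxP.
have hZ : h ^t* *m Z = 0 by [].
have hhZZ : h *m h ^t* + Z *m Z ^t* = 1%:M by rewrite /Z trmxCK -{1}[h]trmxCK.
have eMN : (M - N = #|U|.+1 * N)%N by rewrite -eM addnK.
have FZ w : F (Yw w) = F (Yw w) *m (Z *m Z ^t*).
  by rewrite -[LHS]mulmx1 -hhZZ mulmxDr mulmxA F_orth mul0mx add0r.
have sF w : (F (Yw w)) ^t* = F (Yw w) by have [] := psd_nullproj (cov (Yw w)).
have ZF w : F (Yw w) = (Z *m Z ^t*) *m F (Yw w).
  by move: (F (Yw w)) (FZ w) (sF w) => G GZ sG; rewrite -[LHS]sG [in LHS]GZ !adjmxM trmxCK sG.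
have Zunit u : normsq u = 1 -> h ^t* *m (Z *m u) = 0 /\ (Z *m u) ^t* *m (Z *m u) = 1%:M.
  move=> u1; rewrite (mulmxA (h ^t*)) hZ mul0mx; split=> //.
  rewrite adjmxM -mulmxA (mulmxA (Z ^t*)) Z1 mul1mx.
  by rewrite [LHS]mx11_scalar -[(_ *m _) 0 0]/(normsq u) u1.
have := @isotropic_trace _ T R P M (M - N) (fun w => F (Yw w)) Z.
move=> /(_ (F_meas Y_meas) (fun w => psd_nullproj _)).
move=> /(_ _ p (Z ^t* *m X))/wrap[u v u1 v1|].
  (* Transitivity on frames of N + 1 columns gives a unitary matrix that fixes h and sends Z u to Z
     v. *)
  have [||Q uQ] := @orthonormal_transitive R[i] M (N + 1) (row_mx h (Z *m u)) (row_mx h (Z *m v)).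
  - by apply: orthonormal_row_mx => //; exact: Zunit.
  - by apply: orthonormal_row_mx => //; exact: Zunit.
  rewrite mul_mx_row => /eq_row_mx [Qh Qu].
  have e := mean_conj (Z *m u) uQ Qh.
  rewrite Qu in e.
  exact (esym e).
have m0 : (0 < M - N)%N by rewrite eMN muln_gt0.
rewrite -eMN => /(_ m0).
have -> : (\int[P]_w (retr (Z ^t* *m F (Yw w) *m Z))%:E = N%:R%:E)%E.
  transitivity (\int[P]_w (cst N%:R%:E w : \bar R))%E; last first.
    by rewrite integral_cst // -[RHS]mule1; congr (_ * _)%E; exact: probability_setT.
  apply: ge0_ae_eq_integral => //.
  - apply: retr_measurable; apply: mxmeasurable_mul; last exact: mxmeasurable_cst.
    by apply: mxmeasurable_mul; [exact: mxmeasurable_cst|exact: (F_meas Y_meas)].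
  - by move=> w _; rewrite lee_fin; apply/retr_ge0/psd_conj/psd_nullproj.
  - by move=> w _; rewrite lee_fin ler0n.
  apply: filterS (F_trace eM) => w <- _.
  by rewrite -mulmxA mxtrace_mulC -mulmxA -FZ.
move=> e; rewrite EFinM; apply: etrans (etrans e _).
  congr (_ * _)%E; apply: eq_integral => w _; congr (retr _)%:E.
  by rewrite [in LHS]ZF [in LHS]FZ !adjmxM trmxCK !mulmxA.
congr (_%:E * _)%E; congr (retr _).
by rewrite !adjmxM trmxCK -hhZZ addrC addKr !mulmxA.
Qed.

End null_space.

End interference.

Lemma proj_compl_psd (C : numClosedFieldType) M N (X : 'M[C]_(M, N)) :
  X ^t* *m X = 1%:M -> psd (1%:M - X *m X ^t*).
Proof.
move=> X1; set E := 1%:M - _.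
have sE : E ^t* = E by rewrite /E adjmxD adjmxN adjmx1 adjmxM trmxCK.
have EE : E *m E = E.
  rewrite {2}/E mulmxBr mulmx1 /E mulmxBl mul1mx -mulmxA (mulmxA (X ^t*)) X1 mul1mx.
  by rewrite subrr subr0.
by rewrite -EE -{1}sE; exact: psd_adj_mul.
Qed.

Lemma mule_invl (R : realFieldType) (x : R) (u v : \bar R) : x != 0 ->
  (x%:E * u = v -> u = x^-1%:E * v)%E.
Proof. by move=> x0 <-; rewrite muleA -EFinM mulVf // mul1e. Qed.

(** * Mean interference and mean quantization error *)

Section quantization.
Context d (T : measurableType d) (R : realType) (P : probability T R).
Variables (M N K B : nat).
Let Comp : finType := ('I_K + 'I_K * B.-tuple bool)%type.
Variable Y : Comp -> T -> 'M[R[i]]_M.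
Hypothesis Y_meas : forall x, measurable_fun setT (Y x).
Hypothesis Y_indep : mutually_independent P (fun x => sigma_of (Y x)).
Hypothesis Y_factor : forall x w, exists X : 'M[R[i]]_(M, N), Y x w = X *m X ^t*.
Hypothesis Y_generic : forall x (V : 'M[R[i]]_(M, N)), V ^t* *m V = 1%:M ->
  {ae P, forall w, V ^t* *m Y x w *m V \in unitmx}.
Hypothesis Y_inv : forall x (Q : 'M[R[i]]_M) (phi : 'M[R[i]]_M -> \bar R),
  Q \is unitarymx -> measurable_fun setT phi -> (forall A, 0 <= phi A)%E ->
  (\int[P]_w phi (Q *m Y x w *m Q ^t*) = \int[P]_w phi (Y x w))%E.
Local Notation code := (sel_code N).
Local Notation Yw := (fun w x => Y x w).

Hypothesis Y_orth : forall k b w, exists2 X : 'M[R[i]]_(M, N), X ^t* *m X = 1%:M &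
  Y (inr (k, b)) w = X *m X ^t*.

Lemma retr_abs_measurable (F : (Comp -> 'M[R[i]]_M) -> 'M[R[i]]_M) :
  (forall d' (S : measurableType d') (G : Comp -> S -> 'M[R[i]]_M),
     (forall x, measurable_fun setT (G x)) -> mxmeasurable (fun s => F (fun x => G x s))) ->
  jointly_measurable (fun y => (`|retr (F y)| : R)%:E).
Proof.
move=> mF d' S G mG; apply/measurable_EFinP; apply: measurableT_comp => //.
by apply/measurable_EFinP; apply: retr_measurable; exact: mF.
Qed.

Lemma retr_mul_adjC p (X : 'M[R[i]]_(M, p)) (A : 'M[R[i]]_M) :
  retr (X *m X ^t* *m A) = retr (X ^t* *m A *m X).
Proof. by rewrite -mulmxA mxtrace_mulC. Qed.

(* Given the channel and the codebook of user [i], the precoder of user [j]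
   loses [N] of the [M] directions to the quantized channel of user [i] and is
   isotropic in the other ones. *)
Lemma mean_interference (i j : 'I_K) : i != j -> (0 < N)%N -> (K * N)%N = M ->
  (K.-1%:R%:E * \int[P]_w (retr (Y (inl i) w *m
      nullproj (\sum_(k | k != j) code (Yw w) k)))%:E =
   \int[P]_w (retr (Y (inl i) w *m (1%:M - code (Yw w) i)))%:E)%E.
Proof.
move=> ij N0 eM.
(* User i enters through h, so U has K - 2 elements and (#|U| + 1) N + N = K N = M. *)
pose U : {set 'I_K} := [set~ i] :\ j.
have cU : (#|U|.+1 = K.-1)%N.
  have := cardsD1 j [set~ i]; rewrite !inE eq_sym ij -/U => e.
  by have := cardsC1 i; rewrite e card_ord add1n.
have K0 : (0 < K.-1)%N by rewrite -cU.
have eM' : (#|U|.+1 * N + N = M)%N.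
  by rewrite cU -eM addnC -mulSn prednK //; case: (K) K0.
pose f (y : Comp -> 'M[R[i]]_M) : \bar R := (`|retr (y (inl i) *m nullproj (\sum_(k | k != j) code y k))| : R)%:E.
have mf : jointly_measurable f.
  apply: retr_abs_measurable => d' S G mG; apply: mxmeasurable_mul; first exact/mxmeasurableP.
  by apply: mxmeasurable_nullproj; apply: mxmeasurable_sum => k _; exact: mxmeasurable_sel_code.
have f0 y : (0 <= f y)%E by rewrite lee_fin normr_ge0.
have pY x w : psd (Y x w) by exact: (factor_psd Y_factor).
have fE w : f (Yw w) = (retr (Y (inl i) w *m nullproj (\sum_(k | k != j) code (Yw w) k)))%:E.
  rewrite /f ger0_norm //; have [X ->] := Y_factor (inl i) w.
  by rewrite retr_mul_adjC; apply/retr_ge0/psd_conj/psd_nullproj.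
have -> : (\int[P]_w (retr (Y (inl i) w *m
      nullproj (\sum_(k | k != j) code (Yw w) k)))%:E = \int[P]_w f (Yw w))%E.
  by apply: eq_integral => w _; rewrite fE.
(* The channel and the codebook of user i are frozen at w'; those of all other users are
   integrated. *)
pose J : {set Comp} := comps_of B [set~ i].
rewrite (ge0_integral_resample Y_meas Y_indep J mf f0).
rewrite -ge0_integralZl //; last 2 first.
- exact: (integral_resample_meas P Y_meas J mf f0).
- by move=> w _; apply: integral_ge0.
apply: eq_integral => w' _.
have [X XE] := Y_factor (inl i) w'.
have [h h1 hE] := Y_orth i (sel_index N (Yw w') i) w'.
have ci w : code (resample Y J w w') i = h *m h ^t*.
  rewrite -hE -/(code (Yw w') i); apply: eq_sel_code => x xi.
  by rewrite /resample !inE xi eqxx.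
have ck w k : k != i -> code (resample Y J w w') k = code (Yw w) k.
  move=> ki; apply: eq_sel_code => x xk.
  by rewrite /resample !inE xk ki.
have sumE w : \sum_(k | (k != j) && (k != i)) code (resample Y J w w') k =
    \sum_(k in U) code (Yw w) k.
  by apply: eq_big => [k|k /andP[_ ki]]; [rewrite !inE|rewrite ck].
have fR w : f (resample Y J w w') =
    (retr (X ^t* *m nullproj (h *m h ^t* + \sum_(k in U) code (Yw w) k) *m X))%:E.
  rewrite /f {1}/resample !inE eqxx /= XE retr_mul_adjC (bigD1 i) //= ci.
  rewrite ger0_norm; last by apply/retr_ge0/psd_conj/psd_nullproj.
  by rewrite sumE.
have e := integral_interference Y_meas Y_indep Y_factor Y_generic Y_inv h1 X N0 eM'.
have -> : (\int[P]_w f (resample Y J w w') = \int[P]_w (retr (X ^t* *m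
    nullproj (h *m h ^t* + \sum_(k in U) code (Yw w) k) *m X))%:E)%E.
  by apply: eq_integral => w _; rewrite fR.
rewrite XE retr_mul_adjC.
have -> : code (Yw w') i = h *m h ^t* by exact: hE.
rewrite cU in e; move: e; set u := integral _ _ _ => e.
have u0 : (0 <= u)%E.
  by apply: integral_ge0 => w _; rewrite lee_fin; apply/retr_ge0/psd_conj/psd_nullproj.
have NR : (0 < N%:R :> R) by rewrite ltr0n.
have : (N%:R%:E * (K.-1%:R%:E * u) = N%:R%:E * (retr (X ^t* *m (1%:M - h *m h ^t*) *m X))%:E)%E.
  by rewrite muleA -EFinM -natrM mulnC e -EFinM mulrC.
have NV : ((N%:R^-1)%:E * N%:R%:E = 1 :> \bar R)%E by rewrite -EFinM mulVf ?gt_eqF.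
by move/(congr1 (fun z => (N%:R^-1)%:E * z)%E); rewrite !(muleA (N%:R^-1)%:E) NV !mul1e.
Qed.

Section quantization_error.
Variable i : 'I_K.

(** The selected codeword once the channel is frozen: it enters only through S, and only the
    codebook stays random. *)
Let pick (S : 'M[R[i]]_M) (y : Comp -> 'M[R[i]]_M) : 'M[R[i]]_M :=
  y (inr (i, code_index S (fun b => y (inr (i, b))))).

Let pick_meas S d' (T' : measurableType d') (G : Comp -> T' -> 'M[R[i]]_M) :
  (forall x, measurable_fun setT (G x)) -> mxmeasurable (fun s => pick S (fun x => G x s)).
Proof.
move=> mG; apply: (mxmeasurable_code (S := fun=> S) (c := fun b s => G (inr (i, b)) s)) => [|b].
  exact: mxmeasurable_cst.
exact/mxmeasurableP.
Qed.

Let err_meas S d' (T' : measurableType d') (G : Comp -> T' -> 'M[R[i]]_M) :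
  (forall x, measurable_fun setT (G x)) ->
  mxmeasurable (fun s => 1%:M - pick S (fun x => G x s)).
Proof.
move=> mG; apply: mxmeasurable_add; first exact: mxmeasurable_cst.
under eq_fun do rewrite -scaleN1r.
by apply: mxmeasurable_scale; [exact: cmeasurable_cst|exact: pick_meas].
Qed.

Let err_psd S w : psd (1%:M - pick S (Yw w)).
Proof.
have [X X1 XE] := Y_orth i (code_index S (fun b => Y (inr (i, b)) w)) w.
by rewrite /pick XE; exact: proj_compl_psd.
Qed.

Let mean S p (X : 'M[R[i]]_(M, p)) : \bar R :=
  (\int[P]_w (retr (X ^t* *m (1%:M - pick S (Yw w)) *m X))%:E)%E.

Let mean_conj S p (X : 'M[R[i]]_(M, p)) Q : Q \is unitarymx ->
  mean (Q *m S *m Q ^t*) (Q *m X) = mean S X.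
Proof.
move=> uQ; pose S' := Q *m S *m Q ^t*.
pose f (y : Comp -> 'M[R[i]]_M) : \bar R := (`|retr (X ^t* *m Q ^t* *m (1%:M - pick S' y) *m (Q *m X))| : R)%:E.
have mf : jointly_measurable f.
  move=> d' T' G mG; apply/measurable_EFinP; apply: measurableT_comp => //.
  apply/measurable_EFinP; apply: retr_measurable.
  apply: mxmeasurable_mul; last exact: mxmeasurable_cst.
  by apply: mxmeasurable_mul; [exact: mxmeasurable_cst|exact: err_meas].
have fE w : f (Yw w) = (retr ((Q *m X) ^t* *m (1%:M - pick S' (Yw w)) *m (Q *m X)))%:E.
  rewrite /f -adjmxM ger0_norm //; apply/retr_ge0/psd_conj; exact: err_psd.
transitivity (\int[P]_w f (Yw w))%E; first by apply: eq_integral => w _; rewrite fE.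
rewrite -(integral_conj_on Y_meas Y_indep Y_inv (comps_of B [set i]) uQ mf) => [|y]; last first.
  by rewrite lee_fin normr_ge0.
apply: eq_integral => w _; rewrite /f.
have -> : 1%:M - pick S' (conj_on (comps_of B [set i]) Q (Yw w)) =
    Q *m (1%:M - pick S (Yw w)) *m Q ^t*.
  have cE b : conj_on (comps_of B [set i]) Q (Yw w) (inr (i, b)) = Q *m Y (inr (i, b)) w *m Q ^t*.
    by rewrite /conj_on !inE eqxx.
  have bE : code_index S' (fun b => conj_on (comps_of B [set i]) Q (Yw w) (inr (i, b))) =
      code_index S (fun b => Y (inr (i, b)) w).
    rewrite -(code_index_conj S (fun b => Y (inr (i, b)) w) uQ).
    by apply: eq_code_index => b; rewrite cE.
  by rewrite /pick bE cE mulmxBr mulmx1 mulmxBl (unitarymx_adjr uQ).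
have -> : X ^t* *m Q ^t* *m (Q *m (1%:M - pick S (Yw w)) *m Q ^t*) *m (Q *m X) =
    X ^t* *m (1%:M - pick S (Yw w)) *m X.
  by rewrite !mulmxA -(mulmxA (X ^t*)) (unitarymx_adjl uQ) mulmx1
    -(mulmxA _ (Q ^t*)) (unitarymx_adjl uQ) mulmx1.
by rewrite ger0_norm //; apply/retr_ge0/psd_conj; exact: err_psd.
Qed.

Let compl_conj (Q : 'M[R[i]]_M) (V : 'M[R[i]]_(M, N)) : Q \is unitarymx ->
  Q *m (1%:M - V *m V ^t*) *m Q ^t* = 1%:M - (Q *m V) *m (Q *m V) ^t*.
Proof. by move=> uQ; rewrite mulmxBr mulmxBl mulmx1 (unitarymx_adjr uQ) adjmxM !mulmxA. Qed.

Let mean_cst (V V' : 'M[R[i]]_(M, N)) : V ^t* *m V = 1%:M -> V' ^t* *m V' = 1%:M ->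
  mean (1%:M - V *m V ^t*) V = mean (1%:M - V' *m V' ^t*) V'.
Proof.
move=> V1 V'1; have [Q uQ QV] := orthonormal_transitive V1 V'1.
by rewrite -(mean_conj _ V uQ) (compl_conj V uQ) QV.
Qed.

Let mean_isotropic (V : 'M[R[i]]_(M, N)) p (C : 'M[R[i]]_(N, p)) : (0 < N)%N ->
  V ^t* *m V = 1%:M ->
  (N%:R%:E * mean (1%:M - V *m V ^t*) (V *m C) =
   (retr (C ^t* *m C))%:E * mean (1%:M - V *m V ^t*) V)%E.
Proof.
move=> N0 V1; set S := 1%:M - _.
apply: (isotropic_trace (F := fun w => 1%:M - pick S (Yw w)) (err_meas S Y_meas)
  (fun w => err_psd S w) _ C N0) => u v u1 v1.
have ort (x : 'cV[R[i]]_N) : normsq x = 1 -> x ^t* *m x = 1%:M.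
  by move=> x1; rewrite [LHS]mx11_scalar -[(_ *m _) 0 0]/(normsq x) x1.
(* q turns u into v inside the range of V. A unitary Q with Q V = V q does the same in the whole
   space and leaves V V^H, hence S, unchanged. *)
have [q uq qu] := orthonormal_transitive (ort u u1) (ort v v1).
have Vq1 : (V *m q) ^t* *m (V *m q) = 1%:M.
  by rewrite adjmxM -mulmxA (mulmxA (V ^t*)) V1 mul1mx (unitarymx_adjl uq).
have [Q uQ QV] := orthonormal_transitive V1 Vq1.
have e := mean_conj S (V *m u) uQ.
rewrite (compl_conj V uQ) QV in e.
have SE : V *m q *m (V *m q) ^t* = V *m V ^t*.
  by rewrite adjmxM mulmxA -(mulmxA V) (unitarymx_adjr uq) mulmx1.
rewrite SE mulmxA QV -mulmxA qu in e.
exact (esym e).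
Qed.

Let J : {set Comp} := ~: [set inl i].

Let resample_code w w' : code (resample Y J w w') i =
  pick (channel_nullproj N (Y (inl i) w')) (Yw w).
Proof.
rewrite /sel_code /sel_index /pick /resample !inE eqxx /=.
by rewrite ?inE /=; congr (Y (inr (i, _)) w); apply: eq_code_index => b; rewrite !inE.
Qed.

Let channel_basis : (N <= M)%N -> {ae P, forall w, exists V : 'M[R[i]]_(M, N),
  exists2 C : 'M[R[i]]_N, V ^t* *m V = 1%:M /\
    channel_nullproj N (Y (inl i) w) = 1%:M - V *m V ^t* &
    Y (inl i) w = V *m C *m (V *m C) ^t*}.
Proof.
move=> NM; have := generic_rank_sum Y_meas Y_indep Y_factor Y_generic (s := [:: inl i]) isT (@psd0 R[i] M).
rewrite mxrank0 mul1n => /(_ NM); apply: filterS => w.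
rewrite big_seq1 add0r => rY; have [X XE] := Y_factor (inl i) w.
have rX : \rank X = N by rewrite -rank_mul_adj -XE.
have [V [C [V1 CU] XV]] := gram_schmidt rX.
exists V, C; last by rewrite XE XV.
split=> //; rewrite /channel_nullproj rY eqxx XE (nullprojE (psd_mul_adj X)).
have [|_ <- //] := orthonormal_proj (A := X) V1.
move=> k; apply/in_colspaceP; exists (col k (invmx C)).
by rewrite XV !colE mulmxA mulmxK.
Qed.

(** This is the distortion, by [distortionE], expressed on Gram matrices. *)
Definition mean_error : \bar R :=
  (\int[P]_w (retr (channel_nullproj N (Y (inl i) w) *m code (Yw w) i))%:E)%E.


Let channel_nullproj_psd A : psd (channel_nullproj N (A : 'M[R[i]]_M)).
Proof. by rewrite /channel_nullproj; case: ifP => _; [exact: psd_nullproj|exact: psd0]. Qed.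

(** Two projectors p and q of trace N satisfy tr ((1 - p) q) = N - tr (p q) = tr (p (1 - q)), so
    that the error can be read on the range of the channel. *)
Let err_trace (V : 'M[R[i]]_(M, N)) S w : V ^t* *m V = 1%:M ->
  retr ((1%:M - V *m V ^t*) *m pick S (Yw w)) = retr (V ^t* *m (1%:M - pick S (Yw w)) *m V).
Proof.
move=> V1.
have [X X1 XE] := Y_orth i (code_index S (fun b => Y (inr (i, b)) w)) w.
rewrite /pick XE; set p := X *m X ^t*.
rewrite mulmxBl mul1mx mulmxBr mulmx1 mulmxBl V1 !raddfB /= retr_mul_adjC.
by rewrite /p [\tr (X *m _)]mxtrace_mulC X1.
Qed.

(** By [mean_cst] the mean given the channel does not depend on the subspace of the channel, so any
    frame V may represent it. *)
Let mean_errorE (V : 'M[R[i]]_(M, N)) : (N <= M)%N -> V ^t* *m V = 1%:M ->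
  mean_error = mean (1%:M - V *m V ^t*) V.
Proof.
move=> NM V1.
pose f (y : Comp -> 'M[R[i]]_M) : \bar R :=
  (`|retr (channel_nullproj N (y (inl i)) *m code y i)| : R)%:E.
have mf : jointly_measurable f.
  apply: retr_abs_measurable => d' T' G mG; apply: mxmeasurable_mul.
    by apply: mxmeasurable_channel_nullproj; exact/mxmeasurableP.
  exact: mxmeasurable_sel_code.
have f0 y : (0 <= f y)%E by rewrite lee_fin normr_ge0.
transitivity (\int[P]_w f (Yw w))%E.
  apply: eq_integral => w _; rewrite /f ger0_norm //.
  have [X _ XE] := Y_orth i (sel_index N (Yw w) i) w.
  rewrite /sel_code XE mxtrace_mulC retr_mul_adjC.
  by apply/retr_ge0/psd_conj; exact: channel_nullproj_psd.
apply: (ge0_integral_resample_cst Y_meas Y_indep (J := J) mf f0).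
  by apply: integral_ge0 => w _; rewrite lee_fin; apply/retr_ge0/psd_conj; exact: err_psd.
apply: filterS (channel_basis NM) => w' [V' [C [V'1 SE] _]].
rewrite (mean_cst V1 V'1); apply: eq_integral => w _.
rewrite /f resample_code {1}/resample !inE eqxx /= SE err_trace // ger0_norm //.
by apply/retr_ge0/psd_conj; exact: err_psd.
Qed.

(* The error is isotropic in the range of the channel, with the same mean for
   all the channels. *)
Lemma mean_channel_error : (0 < N)%N -> (N <= M)%N ->
  (N%:R%:E * \int[P]_w (retr (Y (inl i) w *m (1%:M - code (Yw w) i)))%:E =
   mean_error * \int[P]_w (retr (Y (inl i) w))%:E)%E.
Proof.
move=> N0 NM.
pose f (y : Comp -> 'M[R[i]]_M) : \bar R :=
  (`|retr (y (inl i) *m (1%:M - code y i))| : R)%:E.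
have mf : jointly_measurable f.
  apply: retr_abs_measurable => d' T' G mG; apply: mxmeasurable_mul.
    exact/mxmeasurableP.
  apply: mxmeasurable_add; first exact: mxmeasurable_cst.
  under eq_fun do rewrite -scaleN1r.
  by apply: mxmeasurable_scale; [exact: cmeasurable_cst|exact: mxmeasurable_sel_code].
have f0 y : (0 <= f y)%E by rewrite lee_fin normr_ge0.
have -> : (\int[P]_w (retr (Y (inl i) w *m (1%:M - code (Yw w) i)))%:E =
    \int[P]_w f (Yw w))%E.
  apply: eq_integral => w _; rewrite /f ger0_norm //.
  have [X ->] := Y_factor (inl i) w; rewrite retr_mul_adjC.
  by apply/retr_ge0/psd_conj; exact: err_psd.
have e0 : (0 <= mean_error)%E.
  apply: integral_ge0 => w _; rewrite lee_fin.
  have [X _ XE] := Y_orth i (sel_index N (Yw w) i) w.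
  rewrite /sel_code XE mxtrace_mulC retr_mul_adjC.
  by apply/retr_ge0/psd_conj; exact: channel_nullproj_psd.
have mY : measurable_fun setT (fun w => (retr (Y (inl i) w))%:E).
  by apply: retr_measurable; exact/mxmeasurableP.
have Y0 w : (0 <= (retr (Y (inl i) w))%:E)%E.
  by rewrite lee_fin; apply/retr_ge0; exact: (factor_psd Y_factor).
rewrite (ge0_integral_resample Y_meas Y_indep J mf f0).
rewrite -ge0_integralZl //; last 2 first.
- exact: (integral_resample_meas P Y_meas J mf f0).
- by move=> w _; apply: integral_ge0.
rewrite -ge0_integralZl //.
apply: ge0_ae_eq_integral => //.
- apply: emeasurable_funM; first exact: measurable_cst.
  exact: (integral_resample_meas P Y_meas J mf f0).
- by apply: emeasurable_funM => //; exact: measurable_cst.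
- by move=> w _; rewrite mule_ge0 ?lee_fin ?ler0n //; apply: integral_ge0.
- by move=> w _; rewrite mule_ge0.
apply: filterS (channel_basis NM) => w' [V [C [V1 SE] YE]] _.
rewrite (mean_errorE NM V1) [RHS]muleC.
have -> : retr (Y (inl i) w') = retr (C ^t* *m C).
  by rewrite YE mxtrace_mulC adjmxM -mulmxA (mulmxA (V ^t*)) V1 mul1mx.
rewrite -(mean_isotropic C N0 V1); congr (_ * _)%E.
apply: eq_integral => w _.
rewrite /f resample_code SE {1}/resample !inE eqxx /= YE retr_mul_adjC ger0_norm //.
by apply/retr_ge0/psd_conj; exact: err_psd.
Qed.

End quantization_error.

End quantization.

(** * Rates *)

Lemma ln_le_tangent (R : realType) (a y : R) : 0 < a -> 0 < y -> ln y <= ln a + y / a - 1.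
Proof.
move=> a0 y0; have := @le_ln1Dx R (y / a - 1).
rewrite addrCA subrr addr0 ltrBrDr addNr divr_gt0 // => /(_ isT).
by rewrite ln_div ?posrE // lerBlDl addrA.
Qed.

Section log_det.
Variables (R : realType) (n : nat).
Implicit Types S A D : 'M[R[i]]_n.

Lemma real_of_ge0 (z : R[i]) : 0 <= z -> ((complex.Re z)%:C)%C = z.
Proof. by move=> z0; case: z z0 (ger0_Im z0) => x y _ /= ->. Qed.

Lemma det_spectral S (c : R) : psd S -> exists x : 'I_n -> R,
  [/\ forall k, 0 <= x k, retr S = \sum_k x k &
      \det (1%:M + (c%:C)%C *: S) = ((\prod_k (1 + c * x k))%:C)%C].
Proof.
move=> /psd_spectral[U [dg [uU d0 SE]]]; exists (fun k => complex.Re (dg 0 k)); split.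
- by move=> k; exact: (@ler_normr_normc R 0).
- rewrite SE -mulmxA mxtrace_mulC -mulmxA (unitarymx_adjr uU) mulmx1 mxtrace_diag.
  exact: Re_sum.
have -> : 1%:M + (c%:C)%C *: S = U ^t* *m diag_mx (\row_k (1 + (c%:C)%C * dg 0 k)) *m U.
  have -> : diag_mx (\row_k (1 + (c%:C)%C * dg 0 k)) = 1%:M + (c%:C)%C *: diag_mx dg.
    by apply/matrixP => i j; rewrite !mxE; case: eqVneq => _ /=; rewrite ?mulr1n ?mulr0n ?mulr0 ?addr0.
  by rewrite mulmxDr mulmxDl mulmx1 (unitarymx_adjl uU) SE -scalemxAr -scalemxAl.
rewrite !det_mulmx det_diag mulrAC -det_mulmx (unitarymx_adjl uU) det1 mul1r rmorph_prod.
by apply: eq_bigr => k _; rewrite mxE rmorphD rmorphM rmorph1 /= real_of_ge0.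
Qed.

Lemma log2_det_ge0 (c : R) S : 0 <= c -> psd S -> 0 <= log2_det c S.
Proof.
move=> c0 pS; have [x [x0 _ dE]] := det_spectral c pS.
rewrite /log2_det dE /log2 divr_ge0 // ?ln_ge0 // ?ler1n //.
by elim/big_rec: _ => //= k p _ p1; rewrite mulr_ege1 // lerDl mulr_ge0.
Qed.

Lemma log2_det_le (c : R) A D : 0 <= c -> psd A -> psd D ->
  log2_det c A <= log2_det c (A + D).
Proof.
move=> c0 pA pD.
have cC : 0 <= (c%:C)%C by rewrite lecR.
have A1 := psd_det1D (psdZ cC pA).
have AD := psd_det_le (psdZ cC pA) (psdZ cC pD).
move: A1 AD; rewrite /log2_det -addrA -scalerDr => {pA pD}.
move: (\det _) (\det _) => q p A1 AD.
have rp := ler_normr_normc ler01 A1.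
have rq := ler_normr_normc (le_trans ler01 A1) AD.
have p0 : 0 < complex.Re p by apply: lt_le_trans rp; exact: ltr01.
by rewrite /log2 ler_wpM2r ?invr_ge0 ?ln_ge0 ?ler1n // ler_ln // posrE (lt_le_trans p0).
Qed.

(* The logarithm lies below its tangents, here the one at [a]. *)
Lemma log2_det_tangent (a c : R) S : 0 < a -> 0 <= c -> psd S ->
  log2_det c S <= (n%:R * ln a + (n%:R + c * retr S) / a - n%:R) / ln 2.
Proof.
move=> a0 c0 pS; have [x [x0 tS dE]] := det_spectral c pS.
rewrite /log2_det dE /log2 ler_wpM2r ?invr_ge0 ?ln_ge0 ?ler1n //=.
have -> : n%:R * ln a + (n%:R + c * retr S) / a - n%:R =
    \sum_k (ln a + (1 + c * x k) / a - 1).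
  rewrite big_split big_split /= -mulr_suml big_split /= -mulr_sumr tS.
  by rewrite sumrN !sumr_const !card_ord mulr_natl.
have y0 k : 0 < 1 + c * x k by rewrite ltr_wpDr // mulr_ge0.
suff [_ ->] : 0 < \prod_k (1 + c * x k) /\
    ln (\prod_k (1 + c * x k)) = \sum_k ln (1 + c * x k).
  by apply: ler_sum => k _; exact: ln_le_tangent.
apply: (big_rec2 (fun p s => 0 < p /\ ln p = s)); first by rewrite ltr01 ln1.
by move=> k p s _ [p0 <-]; rewrite mulr_gt0 // lnM ?posrE.
Qed.

Lemma measurable_log2_det d (T : measurableType d) (c : R) (F : T -> 'M[R[i]]_n) :
  mxmeasurable F -> measurable_fun setT (fun w => log2_det c (F w)).
Proof.
move=> mF; apply: measurable_funM; last exact: measurable_cst.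
apply: measurableT_comp; first exact: measurable_ln.
have [] // : cmeasurable (fun w => \det (1%:M + (c%:C)%C *: F w)).
apply: cmeasurable_det; apply: mxmeasurable_add; first exact: mxmeasurable_cst.
by apply: mxmeasurable_scale => //; exact: cmeasurable_cst.
Qed.

End log_det.

(** Sylvester's identity trades the N by N determinant for an M by M one that depends on the channel
    and the precoder only through their Gram matrices. *)
Lemma log2_det_received_cov (R : realType) (M N : nat) (c : R) (A V : 'M[R[i]]_(M, N)) :
  log2_det c (received_cov A V) = log2_det c ((V *m V ^t*) *m (A *m A ^t*)).
Proof.
rewrite /log2_det /received_cov; congr (log2 (complex.Re _)).
rewrite -!mulmxA scalemxAr det_sylvester -scalemxAl !mulmxA.
by [].
Qed.

Section rate.
Context d (T : measurableType d) (R : realType) (P : probability T R).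
Variables (I : finType) (M N : nat) (Y : I -> T -> 'M[R[i]]_M).
Hypothesis Y_meas : forall x, measurable_fun setT (Y x).
Hypothesis Y_indep : mutually_independent P (fun x => sigma_of (Y x)).
Hypothesis Y_inv : forall x (Q : 'M[R[i]]_M) (phi : 'M[R[i]]_M -> \bar R),
  Q \is unitarymx -> measurable_fun setT phi -> (forall A, 0 <= phi A)%E ->
  (\int[P]_w phi (Q *m Y x w *m Q ^t*) = \int[P]_w phi (Y x w))%E.
Variables (x : I) (c : R).

Let g (F A : 'M[R[i]]_M) : \bar R := (`|log2_det c (F *m A)| : R)%:E.

Let g_measurable d' (S : measurableType d') (F A : S -> 'M[R[i]]_M) :
  mxmeasurable F -> mxmeasurable A -> measurable_fun setT (fun s => g (F s) (A s)).
Proof.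
move=> mF mA; apply/measurable_EFinP; apply: measurableT_comp => //.
by apply: measurable_log2_det; exact: mxmeasurable_mul.
Qed.

Let g_conj F A Q : Q \is unitarymx -> g (Q *m F *m Q ^t*) A = g F (Q ^t* *m A *m Q).
Proof.
move=> uQ; rewrite /g /log2_det; congr (`|log2 (complex.Re _)|%:E).
have -> : 1%:M + (c%:C)%C *: (F *m (Q ^t* *m A *m Q)) =
    Q ^t* *m (1%:M + (c%:C)%C *: (Q *m F *m Q ^t* *m A)) *m Q.
  rewrite mulmxDr mulmxDl mulmx1 (unitarymx_adjl uQ) -scalemxAr -scalemxAl !mulmxA.
  by rewrite (unitarymx_adjl uQ) mul1mx.
by rewrite !det_mulmx mulrAC -det_mulmx (unitarymx_adjl uQ) det1 mul1r.
Qed.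

(* The mean rate through an independent random [N]-dimensional subspace does not
   depend on the law of the subspace. *)
Lemma mean_rate_subspace (F : (I -> 'M[R[i]]_M) -> 'M[R[i]]_M) (V : 'M[R[i]]_(M, N)) :
  (forall d' (S : measurableType d') (G : I -> S -> 'M[R[i]]_M),
     (forall y, measurable_fun setT (G y)) -> mxmeasurable (fun s => F (fun y => G y s))) ->
  (forall y y', (forall z, z != x -> y z = y' z) -> F y = F y') ->
  V ^t* *m V = 1%:M ->
  {ae P, forall w, exists2 U : 'M[R[i]]_(M, N), U ^t* *m U = 1%:M &
     F (fun z => Y z w) = U *m U ^t*} ->
  (\int[P]_w g (F (fun z => Y z w)) (Y x w) = \int[P]_w g (V *m V ^t*) (Y x w))%E.
Proof.
move=> mF eF V1 FU.
pose f (y : I -> 'M[R[i]]_M) := g (F y) (y x).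
have mf : jointly_measurable f.
  by move=> d' S G mG; apply: g_measurable; [exact: mF|exact/mxmeasurableP].
have f0 y : (0 <= f y)%E by rewrite lee_fin normr_ge0.
apply: (ge0_integral_resample_cst Y_meas Y_indep (J := [set x]%SET) mf f0).
  by apply: integral_ge0 => w _; rewrite lee_fin normr_ge0.
apply: filterS FU => w' [U U1 UE].
have [Q uQ QV] := orthonormal_transitive V1 U1.
pose phi A := g (V *m V ^t*) A.
have mphi : measurable_fun setT phi.
  apply: g_measurable; first exact: mxmeasurable_cst.
  by apply/mxmeasurableP; exact: measurable_id.
have phi0 A : (0 <= phi A)%E by rewrite lee_fin normr_ge0.
have uQ' : Q ^t* \is unitarymx by apply/unitarymxP; rewrite trmxCK; exact: unitarymx_adjl.
(* With the other components frozen, the unitary Q taking V to the subspace is constant; it is moved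
   onto the channel, whose law absorbs it. *)
transitivity (\int[P]_w phi (Q ^t* *m Y x w *m (Q ^t*) ^t*))%E; last exact: (Y_inv x uQ' mphi phi0).
apply: eq_integral => w _; rewrite /phi trmxCK -(g_conj _ _ uQ).
rewrite /f (eF _ (fun z => Y z w')); last first.
  by move=> z zx; rewrite /resample !inE (negbTE zx).
rewrite UE -QV adjmxM !mulmxA; congr (g _ _).
by rewrite /resample !inE eqxx.
Qed.

End rate.

(** * Channels and codewords *)

Section unit_gram.
Variables (C : numClosedFieldType) (M N : nat).

Lemma unitmx_adj (A : 'M[C]_N) : (A ^t* \in unitmx) = (A \in unitmx).
Proof. by rewrite map_unitmx unitmx_tr. Qed.

Lemma unitmx_gram (V X : 'M[C]_(M, N)) :
  (V ^t* *m (X *m X ^t*) *m V \in unitmx) = (X ^t* *m V \in unitmx).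
Proof.
have -> : V ^t* *m (X *m X ^t*) *m V = (X ^t* *m V) ^t* *m (X ^t* *m V).
  by rewrite adjmxM trmxCK !mulmxA.
by rewrite unitmx_mul unitmx_adj andbb.
Qed.

(** Makes the invertibility of W^H h a condition on the two Gram matrices, for which independence
    and measurability are available. *)
Lemma rank_gram_eq (W h : 'M[C]_(M, N)) : W ^t* *m W = 1%:M ->
  (\rank (W *m W ^t* *m (h *m h ^t*)) == N) = (W ^t* *m h \in unitmx).
Proof.
move=> W1; set X := W ^t* *m h.
have -> : W *m W ^t* *m (h *m h ^t*) = W *m X *m h ^t* by rewrite /X !mulmxA.
apply/eqP/idP => [rN|uX].
  rewrite -row_free_unit /row_free eqn_leq rank_leq_row /= -{1}rN.
  by rewrite (leq_trans (mxrankM_maxl _ _)) // mxrankM_maxr.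
apply/eqP; rewrite eqn_leq; apply/andP; split.
  apply: leq_trans (mxrankM_maxr _ _) _.
  exact: rank_leq_row.
have rX : \rank (X ^t*) = N by rewrite mxrank_unit // unitmx_adj.
rewrite -{1}rX; have -> : X ^t* = invmx X *m W ^t* *m (W *m X *m h ^t*) *m W.
  have WYW : W ^t* *m (W *m X *m h ^t*) *m W = X *m X ^t*.
    by rewrite {2}/X adjmxM trmxCK !mulmxA W1 mul1mx.
  by rewrite -!(mulmxA (invmx X)) WYW mulmxA mulVmx // mul1mx.
by apply: leq_trans (mxrankM_maxl _ _) _; exact: mxrankM_maxr.
Qed.

End unit_gram.

Section gram_family.
Context d (T : measurableType d) (R : realType) (P : probability T R).
Variables (M N K B : nat).
Variable H : 'I_K -> T -> 'M[R[i]]_(M, N).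
Variable W : 'I_K -> B.-tuple bool -> T -> 'M[R[i]]_(M, N).
Hypothesis H_gaussian : forall k i j, std_complex_gaussian P (fun w => H k w i j).
Hypothesis W_uniform : forall k b, uniform_grassmannian P (W k b).
Hypothesis HW_indep : mutually_independent P (sources H W).
Let Src : finType := ('I_K * 'I_M * 'I_N + 'I_K * B.-tuple bool)%type.
Let Comp : finType := ('I_K + 'I_K * B.-tuple bool)%type.

(* The quantities in the theorem depend on the channels and the codewords only
   through these matrices, on which unitary matrices act by conjugation. *)
Definition gram (x : Comp) (w : T) : 'M[R[i]]_M :=
  match x with
  | inl k => H k w *m (H k w) ^t*
  | inr (k, b) => W k b w *m (W k b w) ^t*
  end.

Lemma channel_measurable k : mxmeasurable (H k).
Proof. by move=> i j; apply/cmeasurableP; case: (H_gaussian k i j). Qed.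

Lemma codeword_measurable k b : mxmeasurable (W k b).
Proof. by apply/mxmeasurableP; case: (W_uniform k b). Qed.

Lemma mxmeasurable_gram d' (S : measurableType d') (F : S -> 'M[R[i]]_(M, N)) :
  mxmeasurable F -> measurable_fun setT (fun s => F s *m (F s) ^t*).
Proof.
by move=> mF; apply/mxmeasurableP; apply: mxmeasurable_mul => //; exact: mxmeasurable_adj.
Qed.

Lemma gram_meas x : measurable_fun setT (gram x).
Proof.
case: x => [k|[k b]]; apply: mxmeasurable_gram; first exact: channel_measurable.
exact: codeword_measurable.
Qed.

Let source_comp (x : Src) : Comp :=
  match x with inl (k, _, _) => inl k | inr y => inr y end.

Lemma gram_indep : mutually_independent P (fun x => sigma_of (gram x)).
Proof.
apply: (mutually_independent_group (p := source_comp) HW_indep).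
- move=> [[[k i] j]|[k b]]; apply: sigma_of_meas.
    by case: (H_gaussian k i j).
  by case: (W_uniform k b).
- by move=> [[[k i] j]|[k b]]; exact: sigma_of_setT.
- by move=> [[[k i] j]|[k b]]; exact: sigma_of_setI.
move=> x; set J := [set z | _]%SET.
pose S := g_sigma_algebraType (joint_sets (sources H W) J).
have mS (y : Src) : source_comp y = x -> sources H W y `<=` joint_sets (sources H W) J.
  by move=> yx A sA; exists y => //=; rewrite inE yx.
have mX : measurable_fun setT (gram x : S -> 'M[R[i]]_M).
  case: x @J @S mS => [k|[k b]] J S mS; apply: mxmeasurable_gram.
    move=> i j; apply/cmeasurableP => _ A mA.
    by apply: sub_gen_smallest; apply: (mS (inl (k, i, j))) => //; exists A.
  apply/mxmeasurableP => _ A mA.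
  by apply: sub_gen_smallest; apply: (mS (inr (k, b))) => //; exists A.
by move=> _ [A mA <-]; exact: (mX measurableT).
Qed.

Lemma gram_factor x w : exists X : 'M[R[i]]_(M, N), gram x w = X *m X ^t*.
Proof. by case: x => [k|[k b]]; [exists (H k w)|exists (W k b w)]. Qed.

Lemma gram_orth k b w : exists2 X : 'M[R[i]]_(M, N), X ^t* *m X = 1%:M &
  gram (inr (k, b)) w = X *m X ^t*.
Proof. by exists (W k b w) => //; case: (W_uniform k b) => _ + _; apply. Qed.

Lemma channel_entries_indep k :
  mutually_independent P (fun e : 'I_M * 'I_N => sigma_of (fun w => H k w e.1 e.2)).
Proof.
have := mutually_independent_reindex (e := fun e : 'I_M * 'I_N => inl (k, e.1, e.2) : Src) _ HW_indep.
by apply; move=> [? ?] [? ?] [-> ->].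
Qed.

Lemma gram_inv x (Q : 'M[R[i]]_M) (phi : 'M[R[i]]_M -> \bar R) :
  Q \is unitarymx -> measurable_fun setT phi -> (forall A, 0 <= phi A)%E ->
  (\int[P]_w phi (Q *m gram x w *m Q ^t*) = \int[P]_w phi (gram x w))%E.
Proof.
move=> uQ mphi phi0; case: x => [k|[k b]].
  have mg : measurable_fun setT (fun A : 'M[R[i]]_(M, N) => phi (A *m A ^t*)).
    apply: measurableT_comp mphi _; apply: mxmeasurable_gram.
    by apply/mxmeasurableP; exact: measurable_id.
  have := gaussian_matrix_left_invariant (H_gaussian k) (@channel_entries_indep k) uQ mg.
  move=> /(_ (fun _ => phi0 _)) e; rewrite -[RHS]e.
  by apply: eq_integral => w _; rewrite /gram adjmxM !mulmxA.
have [mW oW iW] := W_uniform k b.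
have mQ : measurable_fun setT (fun w => Q *m gram (inr (k, b)) w *m Q ^t*).
  exact: (conj_measurable Q (gram_meas (inr (k, b)))).
pose X : {mfun T >-> 'M[R[i]]_M} :=
  HB.pack (gram (inr (k, b))) (isMeasurableFun.Build _ _ _ _ _ (gram_meas (inr (k, b)))).
pose XQ : {mfun T >-> 'M[R[i]]_M} :=
  HB.pack (fun w => Q *m gram (inr (k, b)) w *m Q ^t*) (isMeasurableFun.Build _ _ _ _ _ mQ).
transitivity (\int[pushforward P XQ]_A phi A)%E.
  by rewrite ge0_integral_pushforward.
transitivity (\int[pushforward P X]_A phi A)%E; last first.
  by rewrite ge0_integral_pushforward.
apply: eq_measure_integral => A mA _.
have := iW Q A uQ mA; rewrite /pushforward /= => e; apply: etrans (etrans _ e) _ => //.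
by congr (P _); apply/seteqP; split=> w /=; rewrite adjmxM !mulmxA.
Qed.

Lemma gram_moment k : (\int[P]_w (retr (gram (inl k) w))%:E <= ((M * N)%:R : R)%:E)%E.
Proof.
exact: gaussian_matrix_second_moment (H_gaussian k).
Qed.

Let channel_generic k (V : 'M[R[i]]_(M, N)) : V ^t* *m V = 1%:M ->
  {ae P, forall w, V ^t* *m H k w \in unitmx}.
Proof.
exact: (gaussian_matrix_generic (H_gaussian k) (@channel_entries_indep k)).
Qed.

(** Invariance alone has to yield generic position. For a fixed codeword the independent Gaussian
    channel is generic, so the pair is almost surely in good position. Seen the other way, for a
    fixed channel spanning U the probability that the codeword fails is [p U], which by transitivity
    is the same for every frame. Hence [p V] equals the probability of failure of the pair, which is
    0. *)
Let codeword_generic k b (V : 'M[R[i]]_(M, N)) : V ^t* *m V = 1%:M ->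
  {ae P, forall w, (W k b w) ^t* *m V \in unitmx}.
Proof.
move=> V1.
have oW w : (W k b w) ^t* *m W k b w = 1%:M by case: (W_uniform k b) => _ + _; apply.
pose bad (A D : 'M[R[i]]_M) := \rank (A *m D) != N.
have mbad d' (S : measurableType d') (F G : S -> 'M[R[i]]_M) :
    mxmeasurable F -> mxmeasurable G -> measurable_fun setT (fun s => bad (F s) (G s)).
  move=> mF mG; apply: measurable_neg; apply: measurable_rank_eq.
  exact: mxmeasurable_mul.
have mgram x : mxmeasurable (gram x) by apply/mxmeasurableP; exact: gram_meas.
have badE h w : bad (gram (inr (k, b)) w) (h *m h ^t*) = ((W k b w) ^t* *m h \notin unitmx).
  by rewrite /bad rank_gram_eq.
pose f (y : Comp -> 'M[R[i]]_M) : \bar R := ((bad (y (inr (k, b))) (y (inl k)))%:R : R)%:E.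
have mf : jointly_measurable f.
  by move=> d' S G mG; apply: bool_measurable; apply: mbad; exact/mxmeasurableP.
have f0 y : (0 <= f y)%E by rewrite lee_fin ler0n.
have f_eq0 : (\int[P]_w f (fun x => gram x w) = 0)%E.
  apply: (ge0_integral_resample_cst gram_meas gram_indep (J := [set inl k]%SET) mf f0) => //.
  apply: aeW => w'.
  have mbw : measurable_fun setT (fun w => bad (gram (inr (k, b)) w') (gram (inl k) w)).
    by apply: mbad => //; exact: mxmeasurable_cst.
  have /(integral_bool_eq0 P mbw) <- : {ae P, forall w, ~~ bad (gram (inr (k, b)) w') (gram (inl k) w)}.
    by apply: filterS (channel_generic k (oW w')) => w; rewrite badE negbK.
  by apply: eq_integral => w _; rewrite /f /resample !inE eqxx.
pose p (U : 'M[R[i]]_(M, N)) := (\int[P]_w (((W k b w) ^t* *m U \notin unitmx)%:R : R)%:E)%E.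
have mp U : measurable_fun setT (fun w => (W k b w) ^t* *m U \notin unitmx).
  have := mbad _ _ _ _ (mgram (inr (k, b))) (@mxmeasurable_cst _ T R _ _ (U *m U ^t*)).
  by under eq_fun do rewrite badE.
have p_cst U U' : U ^t* *m U = 1%:M -> U' ^t* *m U' = 1%:M -> p U = p U'.
  move=> U1 U'1; have [Q uQ QU] := orthonormal_transitive U1 U'1.
  pose phi (A : 'M[R[i]]_M) : \bar R := ((U' ^t* *m A *m U' \notin unitmx)%:R : R)%:E.
  have mphi : measurable_fun setT phi.
    apply: bool_measurable; apply: measurable_neg; under eq_fun do rewrite unitmxE unitfE.
    apply: measurable_neg; apply: cmeasurable_eq0; apply: cmeasurable_det.
    apply: mxmeasurable_mul; last exact: mxmeasurable_cst.
    apply: mxmeasurable_mul; first exact: mxmeasurable_cst.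
    by apply/mxmeasurableP; exact: measurable_id.
  have phi0 A : (0 <= phi A)%E by rewrite lee_fin ler0n.
  have e := gram_inv (inr (k, b)) uQ mphi phi0.
  transitivity (\int[P]_w phi (Q *m gram (inr (k, b)) w *m Q ^t*))%E.
    apply: eq_integral => w _; rewrite /phi -QU adjmxM.
    rewrite !mulmxA -(mulmxA (U ^t*)) (unitarymx_adjl uQ) mulmx1.
    by rewrite -(mulmxA _ (Q ^t*) Q) (unitarymx_adjl uQ) mulmx1 -(mulmxA (U ^t*)) unitmx_gram.
  transitivity (\int[P]_w phi (gram (inr (k, b)) w))%E; first exact: e.
  by apply: eq_integral => w _; rewrite /phi /gram unitmx_gram.
suff : {ae P, forall w, ~~ ((W k b w) ^t* *m V \notin unitmx)}.
  by apply: filterS => w; rewrite negbK.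
apply/(integral_bool_eq0 P (mp V)); rewrite -/(p V) -f_eq0; apply/esym.
apply: (ge0_integral_resample_cst gram_meas gram_indep (J := [set inr (k, b)]%SET) mf f0).
  by apply: integral_ge0 => w _; rewrite lee_fin ler0n.
apply: filterS (channel_generic k V1) => w' uH.
have rH : \rank (H k w') = N.
  apply/eqP; rewrite eqn_leq rank_leq_col -{1}(mxrank_unit uH).
  exact: mxrankM_maxr.
have [U [D [U1 uD] HE]] := gram_schmidt rH.
rewrite (p_cst V U V1 U1); apply: eq_integral => w _.
by rewrite /f /resample !inE eqxx /= badE HE mulmxA unitmx_mul uD andbT.
Qed.

Lemma gram_generic x (V : 'M[R[i]]_(M, N)) : V ^t* *m V = 1%:M ->
  {ae P, forall w, V ^t* *m gram x w *m V \in unitmx}.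
Proof.
move=> V1; case: x => [k|[k b]].
  apply: filterS (channel_generic k V1) => w; rewrite /gram unitmx_gram.
  by rewrite -unitmx_adj adjmxM trmxCK.
by apply: filterS (codeword_generic k b V1) => w; rewrite /gram unitmx_gram.
Qed.

End gram_family.

(** * The rate loss *)

Lemma ratio_le (R : realType) (x M D : R) (e m : \bar R) : 0 < x -> 0 <= D ->
  (x%:E * e = D%:E * m -> m <= (M * x)%:E -> e <= (M * D)%:E)%E.
Proof.
move=> x0 D0 xe mM; have xn0 : x != 0 by rewrite gt_eqF.
have i0 : (0 <= (x^-1)%:E :> \bar R)%E by rewrite lee_fin invr_ge0 ltW.
rewrite (mule_invl xn0 xe).
apply: le_trans (lee_wpmul2l i0 (lee_wpmul2l _ mM)) _; first by rewrite lee_fin.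
rewrite -!EFinM lee_fin le_eqVlt; apply/orP; left; apply/eqP.
by rewrite mulrCA (mulrC M) mulKf // mulrC.
Qed.

(** The mean t of the total rate may be infinite here. Then t - s is infinite too, s being finite,
    and the left-hand side is -oo; otherwise b is finite and the claim is real arithmetic. *)
Lemma rate_difference_le (R : realType) (b t s X : \bar R) :
  (0 <= b -> b <= t -> 0 <= s -> s <= X -> X < +oo -> b - (t - s) <= X)%E.
Proof.
move=> b0 bt s0 sX Xy; have sf : s \is a fin_num.
  by rewrite ge0_fin_numE // (le_lt_trans sX).
case: t bt => [t| |] bt.
- have bf : b \is a fin_num by rewrite ge0_fin_numE // (le_lt_trans bt) // ltry.
  apply: le_trans sX; move: b b0 bt bf s s0 sf => [b| |] // b0 bt _ [s| |] // s0 _.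
  change ((b - (t - s))%:E <= s%:E)%E; rewrite !lee_fin in bt *.
  lra.
- by case: s s0 sX sf => [s| |] // s0 sX _; rewrite addye //= addeNy leNye.
- by move: (le_trans b0 bt).
Qed.

Section tangent_bound.
Context d (T : measurableType d) (R : realType) (P : probability T R).
Variables (n : nat) (S : T -> 'M[R[i]]_n).
Hypotheses (S_meas : mxmeasurable S) (S_psd : forall w, psd (S w)).

Lemma mean_log2_det_le (a c m : R) : 0 < a -> 0 <= c ->
  (\int[P]_w (retr (S w))%:E <= m%:E)%E ->
  (\int[P]_w (log2_det c (S w))%:E <=
   ((n%:R * ln a + (n%:R + c * m) / a - n%:R) / ln 2)%:E)%E.
Proof.
move=> a0 c0 Sm.
have l2 : 0 < ln 2 :> R by rewrite ln_gt0 // ltr1n.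
(* A0 and B0 are the coefficients of the tangent as an affine function of the trace. Both are
   nonnegative, the first by the tangent inequality at y = 1, so that the integral splits with no
   integrability of the trace. *)
pose A0 := n%:R * (ln a + a^-1 - 1) / ln 2.
pose B0 := c / a / ln 2.
have A00 : 0 <= A0.
  rewrite /A0 divr_ge0 ?(ltW l2) // mulr_ge0 //.
  by have := ln_le_tangent a0 ltr01; rewrite ln1 mul1r.
have B00 : 0 <= B0 by rewrite /B0 divr_ge0 ?(ltW l2) // divr_ge0 // ltW.
have AB x : (n%:R * ln a + (n%:R + c * x) / a - n%:R) / ln 2 = A0 + B0 * x.
  by rewrite /A0 /B0; field; rewrite ?gt_eqF.
have mS : measurable_fun setT (fun w => (retr (S w))%:E) by exact: retr_measurable.
have S0 w : 0 <= retr (S w) by exact: retr_ge0.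
apply: (@le_trans _ _ (\int[P]_w (A0%:E + B0%:E * (retr (S w))%:E))%E).
  apply: ge0_le_integral => //.
  - by move=> w _; rewrite lee_fin log2_det_ge0.
  - by apply/measurable_EFinP; exact: measurable_log2_det.
  - apply: emeasurable_funD; first exact: measurable_cst.
    by apply: emeasurable_funM => //; exact: measurable_cst.
  move=> w _; rewrite -EFinM -EFinD lee_fin -AB.
  exact: log2_det_tangent.
rewrite ge0_integralD //; last 2 first.
- by move=> w _; rewrite -EFinM lee_fin mulr_ge0.
- by apply: emeasurable_funM => //; exact: measurable_cst.
rewrite ge0_integralZl //; last by move=> w _; rewrite lee_fin.
have -> : (\int[P]_w (A0%:E : \bar R) = A0%:E)%E.
  by rewrite integral_cst // -[RHS]mule1; congr (_ * _)%E; exact: probability_setT.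
by rewrite AB EFinD EFinM; apply: leeD2l; apply: lee_wpmul2l Sm; rewrite lee_fin.
Qed.

End tangent_bound.

Lemma ge0_ae_eq_integralT d (T : measurableType d) (R : realType) (P : probability T R)
    (f g : T -> \bar R) :
  measurable_fun setT f -> measurable_fun setT g -> (forall w, 0 <= f w)%E ->
  (forall w, 0 <= g w)%E -> {ae P, forall w, f w = g w} ->
  (\int[P]_w f w = \int[P]_w g w)%E.
Proof.
move=> mf mg f0 g0 fg; apply: ge0_ae_eq_integral => //.
by apply: filterS fg => w ->.
Qed.

Lemma ge0_integral_sum_cond d (T : measurableType d) (R : realType) (P : probability T R)
    (I : finType) (Q : pred I) (f : I -> T -> \bar R) :
  (forall j, measurable_fun setT (f j)) -> (forall j w, 0 <= f j w)%E ->
  (\int[P]_w (\sum_(j | Q j) f j w) = \sum_(j | Q j) \int[P]_w f j w)%E.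
Proof.
move=> mf f0; rewrite -[RHS]big_filter -ge0_integral_sum //.
by apply: eq_integral => w _; rewrite big_filter.
Qed.

Lemma retr_sum (R : rcfType) n (I : finType) (Q : pred I) (A : I -> 'M[R[i]]_n) :
  retr (\sum_(j | Q j) A j) = \sum_(j | Q j) retr (A j).
Proof. by rewrite (linear_sum (@mxtrace R[i] n)) Re_sum. Qed.

Lemma pred_natr_neq0 (R : realFieldType) K : (1 < K)%N -> K.-1%:R != 0 :> R.
Proof. by case: K => [|[|K]] // _; rewrite pnatr_eq0. Qed.

(** Since M = K N, the mean energy M D gives N + (rho / K) M D = N (1 + rho D). For the tangent at 1
    + rho D the quotient is thus N and cancels the last term. *)
Lemma tangent_value (R : realType) (M N K : nat) (rho D : R) :
  (K * N)%N = M -> 0 < K%:R :> R -> 0 <= rho * D ->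
  (N%:R * ln (1 + rho * D) + (N%:R + rho / K%:R * (M%:R * D)) / (1 + rho * D) - N%:R) / ln 2 =
  N%:R * log2 (1 + rho * D).
Proof.
move=> KNM K0 rD; have a0 : 0 < 1 + rho * D by rewrite ltr_pwDl.
have -> : M%:R = K%:R * N%:R :> R by rewrite -natrM KNM.
have -> : rho / K%:R * (K%:R * N%:R * D) = N%:R * (rho * D).
  by field; rewrite gt_eqF.
rewrite -[X in (X + N%:R * (_ * _)) / _]mulr1 -mulrDr mulfK ?gt_eqF //.
by rewrite addrK /log2 mulrA.
Qed.

Section block_diagonalization.
Context d (T : measurableType d) (R : realType) (P : probability T R).
Variables (M N K B : nat) (rho : R).
Hypotheses (N_gt0 : (0 < N)%N) (K_gt1 : (1 < K)%N) (KNM : (K * N)%N = M).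
Hypothesis rho_gt0 : 0 < rho.
Variable H : 'I_K -> T -> 'M[R[i]]_(M, N).
Variable W : 'I_K -> B.-tuple bool -> T -> 'M[R[i]]_(M, N).
Hypothesis H_gaussian : forall k i j, std_complex_gaussian P (fun w => H k w i j).
Hypothesis W_uniform : forall k b, uniform_grassmannian P (W k b).
Hypothesis HW_indep : mutually_independent P (sources H W).

Local Notation Y := (gram H W).
Local Notation Yw := (fun w x => gram H W x w).
Local Notation code := (sel_code N).

Let W1 k b w : orthonormal_cols (W k b w).
Proof. by case: (W_uniform k b) => _ + _; apply. Qed.

Let NM : (N <= M)%N.
Proof. by rewrite -KNM leq_pmull // ltnW. Qed.

Let KN : (K.-1 * N = M - N)%N.
Proof. by rewrite -KNM -subn1 mulnBl mul1n. Qed.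

Let Ymeas := gram_meas H_gaussian W_uniform.
Let Yindep := gram_indep H_gaussian W_uniform HW_indep.
Let Yfactor := gram_factor H W.
Let Yorth := gram_orth H W_uniform.
Let Yinv := gram_inv H_gaussian W_uniform HW_indep.
Let Ygeneric := gram_generic H_gaussian W_uniform HW_indep.

Lemma chordal_dist_gram k b w : chordal_dist (H k w) (W k b w) ^+ 2 =
  retr (channel_nullproj N (Y (inl k) w) *m Y (inr (k, b)) w).
Proof.
rewrite chordal_dist_sqr; last exact: W1.
rewrite /channel_nullproj /gram rank_mul_adj nullprojE; last exact: psd_mul_adj.
by case: ifP => _ //; rewrite mul0mx mxtrace0.
Qed.

Lemma Hhat_index w k : Hhat H W w k = W k (sel_index N (Yw w) k) w.
Proof.
rewrite /Hhat /quantize; congr (W k _ w); rewrite /sel_index /code_index.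
by congr (Order.arg_min _ _ _); apply/funext => b; exact: chordal_dist_gram.
Qed.

Lemma Hhat_gram w k : Hhat H W w k *m (Hhat H W w k) ^t* = code (Yw w) k.
Proof. by rewrite Hhat_index. Qed.

Lemma distortionE i : distortion P H W i = mean_error P N Y i.
Proof.
rewrite /distortion unlock; apply: eq_integral => w _.
by rewrite Hhat_index chordal_dist_gram.
Qed.

(** Each squared sine is at most 1, so the distortion lies between 0 and N, and [fine] in the
    theorem loses nothing. *)
Lemma distortion_fin i : exists2 D : R, 0 <= D & distortion P H W i = D%:E.
Proof.
have m : measurable_fun setT (fun w => (chordal_dist (H i w) (Hhat H W w i) ^+ 2)%:E).
  under eq_fun do rewrite Hhat_index chordal_dist_gram.
  apply: retr_measurable; apply: mxmeasurable_mul.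
    by apply: mxmeasurable_channel_nullproj; exact/mxmeasurableP/Ymeas.
  exact: (mxmeasurable_sel_code _ _ Ymeas).
have le w : chordal_dist (H i w) (Hhat H W w i) ^+ 2 <= N%:R.
  rewrite /chordal_dist sqr_sqrtr; last by apply: sumr_ge0 => k _; exact: sqr_ge0.
  rewrite -[N in leRHS]card_ord -sumr_const; apply: ler_sum => k _.
  by rewrite -(cos2Dsin2 (xget 0 (principal_angles (H i w) (Hhat H W w i)) 0 k)) lerDr sqr_ge0.
have D0 : (0 <= distortion P H W i)%E.
  by rewrite /distortion unlock; apply: integral_ge0 => w _; rewrite lee_fin sqr_ge0.
have DN : (distortion P H W i <= N%:R%:E)%E.
  rewrite /distortion unlock.
  apply: (@le_trans _ _ (\int[P]_w (cst N%:R%:E w : \bar R))%E).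
    apply: ge0_le_integral => //.
    - by move=> w _; rewrite lee_fin sqr_ge0.
    - by move=> w _; rewrite lee_fin.
  rewrite integral_cst // -[leRHS]mule1; apply: lee_pmul => //.
  exact: probability_le1.
exists (fine (distortion P H W i)); first exact: fine_ge0.
by rewrite fineK // ge0_fin_numE // (le_lt_trans DN) // ltry.
Qed.

Lemma channels_rank j :
  {ae P, forall w, \rank (\sum_(k | k != j) Y (inl k) w)%R = (M - N)%N}.
Proof.
pose s : seq ('I_K + 'I_K * B.-tuple bool)%type := [seq inl k | k <- enum (predC1 j)].
have us : uniq s by rewrite map_inj_uniq ?enum_uniq // => k l [].
have zs : size s = K.-1 by rewrite size_map -cardE cardC1 card_ord.
have := generic_rank_sum Ymeas Yindep Yfactor Ygeneric us (@psd0 R[i] M).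
rewrite mxrank0 zs KN leq_subr => /(_ isT); apply: filterS => w.
by rewrite add0r add0n big_map big_enum /= => <-; congr (\rank _); exact: eq_bigl.
Qed.

Lemma codes_rank j :
  {ae P, forall w, \rank (\sum_(k | k != j) code (Yw w) k)%R = (M - N)%N}.
Proof.
pose U := [set~ j]%SET.
have := generic_rank_sel_code Ymeas Yindep Yfactor Ygeneric (U := U) (@psd0 R[i] M).
rewrite mxrank0 cardsC1 card_ord KN leq_subr => /(_ isT); apply: filterS => w.
rewrite add0r add0n => <-; congr (\rank _).
by apply: eq_bigl => k; rewrite !inE.
Qed.

Section precoders.
Variables (X : 'I_K -> T -> 'M[R[i]]_(M, N)) (V : T -> 'I_K -> 'M[R[i]]_(M, N)).
Hypothesis V_bd : forall w, block_diagonalizing (fun k => X k w) (V w).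

(* Almost surely the other users leave exactly [N] free dimensions, so that the
   precoder is unique up to a unitary matrix. *)
Lemma precoder_proj (S : T -> 'I_K -> 'M[R[i]]_M) j :
  (forall w k, X k w *m (X k w) ^t* = S w k) ->
  {ae P, forall w, \rank (\sum_(k | k != j) S w k)%R = (M - N)%N} ->
  {ae P, forall w, V w j *m (V w j) ^t* = nullproj (\sum_(k | k != j) S w k)}.
Proof.
move=> XS; apply: filterS => w rS; have [Vj1 Vj0] := V_bd w j.
have pS : psd (\sum_(k | k != j) S w k).
  by apply: psd_sum => k _; rewrite -XS; exact: psd_mul_adj.
rewrite (nullprojE pS); apply: kerproj_orthonormal; [exact: pS|exact: rS|exact: NM|exact: Vj1|].
rewrite mulmx_suml big1 // => k kj.
by rewrite -XS -mulmxA (Vj0 k kj) mulmx0.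
Qed.

End precoders.

Lemma received_cov_psd (A V : 'M[R[i]]_(M, N)) : psd (received_cov A V).
Proof.
have -> : received_cov A V = (V ^t* *m A) ^t* *m (V ^t* *m A).
  by rewrite /received_cov adjmxM trmxCK !mulmxA.
exact: psd_adj_mul.
Qed.

Lemma received_cov_measurable i (V : T -> 'M[R[i]]_(M, N)) : measurable_fun setT V ->
  mxmeasurable (fun w => received_cov (H i w) (V w)).
Proof.
move=> /mxmeasurableP mV; have mH := channel_measurable H_gaussian i.
apply: (mxmeasurable_mul _ mH); apply: mxmeasurable_mul; last exact: mxmeasurable_adj.
by apply: mxmeasurable_mul => //; exact: mxmeasurable_adj.
Qed.

Lemma retr_received_cov i w (V : 'M[R[i]]_(M, N)) :
  retr (received_cov (H i w) V) = retr (Y (inl i) w *m (V *m V ^t*)).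
Proof. by rewrite /received_cov mxtrace_mulC !mulmxA. Qed.

Local Notation c := (rho / K%:R).

Let K_gt0 : 0 < K%:R :> R.
Proof. by rewrite ltr0n ltnW. Qed.

Let c_ge0 : 0 <= c.
Proof. by rewrite divr_ge0 // ltW. Qed.

Section rates.
Variables (prec_BD prec_FB : ('I_K -> 'M[R[i]]_(M, N)) -> 'I_K -> 'M[R[i]]_(M, N)).
Hypothesis prec_BDP : forall G, block_diagonalizing G (prec_BD G).
Hypothesis prec_FBP : forall G, block_diagonalizing G (prec_FB G).
Hypothesis prec_BD_meas : forall j, measurable_fun setT (fun w => prec_BD (fun k => H k w) j).
Hypothesis prec_FB_meas : forall j, measurable_fun setT (fun w => prec_FB (Hhat H W w) j).
Variable i : 'I_K.

Let VB w := prec_BD (fun k => H k w).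
Let VF w := prec_FB (Hhat H W w).

Let VB_proj j : {ae P, forall w,
  VB w j *m (VB w j) ^t* = nullproj (\sum_(k | k != j) Y (inl k) w)}.
Proof.
exact: (precoder_proj (X := H) (V := VB) (fun w => prec_BDP _) (fun _ _ => erefl) (channels_rank j)).
Qed.

Let VF_proj j : {ae P, forall w,
  VF w j *m (VF w j) ^t* = nullproj (\sum_(k | k != j) code (Yw w) k)}.
Proof.
exact: (precoder_proj (X := fun k w => Hhat H W w k) (V := VF) (fun w => prec_FBP _)
  Hhat_gram (codes_rank j)).
Qed.

Let rate (V : T -> 'M[R[i]]_(M, N)) : \bar R :=
  (\int[P]_w (log2_det c (received_cov (H i w) (V w)))%:E)%E.

(** F is the precoding projector as a function of the components other than the channel of user i,
    and V0 an arbitrary frame. The right-hand side does not mention F, so that two kinds of precoder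
    can be compared through it. *)
Let rate_subspace (F : ('I_K + 'I_K * B.-tuple bool -> 'M[R[i]]_M) -> 'M[R[i]]_M)
    (V : T -> 'M[R[i]]_(M, N)) (V0 : 'M[R[i]]_(M, N)) :
  (forall d' (S : measurableType d') (G : _ -> S -> 'M[R[i]]_M),
     (forall y, measurable_fun setT (G y)) -> mxmeasurable (fun s => F (fun y => G y s))) ->
  (forall y y', (forall z, z != inl i -> y z = y' z) -> F y = F y') ->
  V0 ^t* *m V0 = 1%:M -> measurable_fun setT V -> (forall w, (V w) ^t* *m V w = 1%:M) ->
  {ae P, forall w, V w *m (V w) ^t* = F (Yw w)} ->
  rate V = (\int[P]_w (`|log2_det c (V0 *m V0 ^t* *m Y (inl i) w)| : R)%:E)%E.
Proof.
move=> mF eF V01 mV V1 VF'.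
have FU : {ae P, forall w, exists2 U : 'M[R[i]]_(M, N), U ^t* *m U = 1%:M &
     F (Yw w) = U *m U ^t*}.
  by apply: filterS VF' => w <-; exists (V w).
have e := mean_rate_subspace Ymeas Yindep Yinv (x := inl i) c mF eF V01 FU.
apply: etrans _ e; apply: ge0_ae_eq_integral => //.
- apply/measurable_EFinP; apply: measurable_log2_det.
  exact: received_cov_measurable.
- apply/measurable_EFinP; apply: measurableT_comp => //; apply: measurable_log2_det.
  by apply: mxmeasurable_mul; [exact: (mF _ _ _ Ymeas)|exact/mxmeasurableP/Ymeas].
- by move=> w _; rewrite lee_fin log2_det_ge0 //; exact: received_cov_psd.
apply: filterS VF' => w VE _; rewrite -VE -log2_det_received_cov ger0_norm //.
by rewrite log2_det_ge0 //; exact: received_cov_psd.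
Qed.

(* The precoder of user [i] is independent of its own channel, both with perfect
   knowledge and with feedback. *)
Let rate_eq : rate (fun w => VB w i) = rate (fun w => VF w i).
Proof.
have [|V0 V01 _] := @kerproj_basis R[i] M N 0 (@psd0 _ _); first by rewrite mxrank0.
rewrite (rate_subspace (F := fun y => nullproj (\sum_(k | k != i) y (inl k))) _ _ V01); last 5 first.
- move=> d' S G mG; apply: mxmeasurable_nullproj; apply: mxmeasurable_sum => k _.
  exact/mxmeasurableP.
- move=> y y' yy'; congr nullproj; apply: eq_bigr => k ki.
  by apply: yy'; apply: contra ki => /eqP[->].
- exact: prec_BD_meas.
- by move=> w; have [] := prec_BDP (fun k => H k w) i.
- exact: VB_proj.
rewrite (rate_subspace (F := fun y => nullproj (\sum_(k | k != i) code y k)) _ _ V01); last 5 first.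
- move=> d' S G mG; apply: mxmeasurable_nullproj; apply: mxmeasurable_sum => k _.
  exact: mxmeasurable_sel_code.
- move=> y y' yy'; congr nullproj; apply: eq_bigr => k ki.
  apply: eq_sel_code => x xk; apply: yy'.
  by apply: contra ki => /eqP xi; rewrite -xk xi.
- exact: prec_FB_meas.
- by move=> w; have [] := prec_FBP (Hhat H W w) i.
- exact: VF_proj.
by [].
Qed.

Let S w := \sum_(j | j != i) received_cov (H i w) (VF w j).

Let S_meas : mxmeasurable S.
Proof.
by apply: mxmeasurable_sum => j _; apply: received_cov_measurable; exact: prec_FB_meas.
Qed.

Let S_psd w : psd (S w).
Proof. by apply: psd_sum => j _; exact: received_cov_psd. Qed.

Let retr_cov_ge0 w j : 0 <= retr (received_cov (H i w) (VF w j)).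
Proof. by apply: retr_ge0; exact: received_cov_psd. Qed.

Let retr_cov_meas j :
  measurable_fun setT (fun w => (retr (received_cov (H i w) (VF w j)))%:E).
Proof. by apply: retr_measurable; apply: received_cov_measurable; exact: prec_FB_meas. Qed.

Let err := (\int[P]_w (retr (Y (inl i) w *m (1%:M - code (Yw w) i)))%:E)%E.

Let K1_neq0 : K.-1%:R != 0 :> R.
Proof. exact: (pred_natr_neq0 _ K_gt1). Qed.

Let interference_mean j : j != i ->
  (\int[P]_w (retr (received_cov (H i w) (VF w j)))%:E = (K.-1%:R^-1)%:E * err)%E.
Proof.
move=> ji; have ij : i != j by rewrite eq_sym.
have e := mean_interference Ymeas Yindep Yfactor Ygeneric Yinv Yorth ij N_gt0 KNM.
apply: etrans (mule_invl K1_neq0 e).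
apply: ge0_ae_eq_integralT.
- exact: retr_cov_meas.
- apply: retr_measurable; apply: mxmeasurable_mul; first exact/mxmeasurableP/Ymeas.
  apply: mxmeasurable_nullproj; apply: mxmeasurable_sum => k _.
  exact: (mxmeasurable_sel_code _ _ Ymeas).
- by move=> w; rewrite lee_fin; exact: retr_cov_ge0.
- move=> w; rewrite lee_fin; have [X ->] := Yfactor (inl i) w.
  by rewrite retr_mul_adjC; apply/retr_ge0/psd_conj/psd_nullproj.
apply: filterS (VF_proj j) => w VE; rewrite retr_received_cov VE.
reflexivity.
Qed.

Let S_mean : (\int[P]_w (retr (S w))%:E = err)%E.
Proof.
transitivity (\int[P]_w (\sum_(j | j != i) (retr (received_cov (H i w) (VF w j)))%:E))%E.
  apply: eq_integral => w _; rewrite sumEFin /S retr_sum.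
  reflexivity.
rewrite ge0_integral_sum_cond; [|exact: retr_cov_meas|]; last first.
  by move=> j w; rewrite lee_fin; exact: retr_cov_ge0.
rewrite (eq_bigr _ (fun j ji => interference_mean ji)) -ge0_sume_distrl; last first.
  by move=> j _; rewrite lee_fin invr_ge0.
rewrite sumEFin sumr_const cardC1 card_ord -[X in X%:E]mulr_natr (mulVf K1_neq0) mul1e.
reflexivity.
Qed.

Let err_le D : 0 <= D -> distortion P H W i = D%:E -> (err <= (M%:R * D)%:E)%E.
Proof.
move=> D0; rewrite distortionE => DE.
have := mean_channel_error Ymeas Yindep Yfactor Ygeneric Yinv Yorth i N_gt0 NM.
rewrite -/err DE => e.
have NR : 0 < N%:R :> R by rewrite ltr0n.
apply: (ratio_le NR D0 e); rewrite -natrM.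
exact: (gram_moment W H_gaussian i).
Qed.

Let interference_rate D : 0 <= D -> distortion P H W i = D%:E ->
  (\int[P]_w (log2_det c (S w))%:E <= (N%:R * log2 (1 + rho * D))%:E)%E.
Proof.
move=> D0 DE; have rD : 0 <= rho * D by apply: mulr_ge0 D0; exact: (ltW rho_gt0).
rewrite -(tangent_value KNM K_gt0 rD); apply: (mean_log2_det_le S_meas S_psd _ c_ge0).
  by apply: ltr_pwDl rD; exact: ltr01.
by rewrite S_mean; exact: (err_le D0 DE).
Qed.

Lemma rate_loss_le : (rate_BD P H rho VB i - rate_FB P H rho VF i <=
  (N%:R * log2 (1 + rho * fine (distortion P H W i)))%:E)%E.
Proof.
have [D D0 DE] := distortion_fin i; rewrite DE.
have mcov j : mxmeasurable (fun w => received_cov (H i w) (VF w j)).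
  by apply: received_cov_measurable; exact: prec_FB_meas.
have full w : \sum_j received_cov (H i w) (VF w j) = received_cov (H i w) (VF w i) + S w.
  by rewrite (bigD1 i).
have le1 : (rate (fun w => VF w i) <=
    \int[P]_w (log2_det c (\sum_j received_cov (H i w) (VF w j)))%:E)%E.
  apply: ge0_le_integral.
  - exact: measurableT.
  - by move=> w _; rewrite lee_fin; apply: (log2_det_ge0 c_ge0); exact: received_cov_psd.
  - by apply/measurable_EFinP; apply: measurable_log2_det; exact: mcov.
  - apply/measurable_EFinP; apply: measurable_log2_det.
    by apply: mxmeasurable_sum => j _; exact: mcov.
  move=> w _; rewrite lee_fin full; apply: (log2_det_le c_ge0); last exact: S_psd.
  exact: received_cov_psd.
have sX := interference_rate D0 DE.
rewrite -rate_eq in le1; rewrite /rate_BD /rate_FB unlock.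
apply: (rate_difference_le _ le1 _ sX); last exact: ltry.
- by apply: integral_ge0 => w _; rewrite lee_fin; apply: (log2_det_ge0 c_ge0); exact: received_cov_psd.
- by apply: integral_ge0 => w _; rewrite lee_fin; apply: (log2_det_ge0 c_ge0); exact: S_psd.
Qed.

End rates.

End block_diagonalization.

Local Open Scope complex_scope.

Theorem theorem3p1 (R : realType) (d : measure_display) (T : measurableType d)
    (P : probability T R) (M N K B : nat) (rho : R)
    (M_gt0 : (0 < M)%N) (N_gt0 : (0 < N)%N) (K_gt1 : (1 < K)%N)
    (KE : K%:R = M%:R / N%:R :> R) (rho_gt0 : 0 < rho)
    (H : 'I_K -> T -> 'M[R[i]]_(M, N))
    (W : 'I_K -> B.-tuple bool -> T -> 'M[R[i]]_(M, N))
    (H_gaussian : forall k i j, std_complex_gaussian P (fun w => H k w i j))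
    (W_uniform : forall k b, uniform_grassmannian P (W k b))
    (HW_indep : mutually_independent P (sources H W))
    (prec_BD prec_FB : ('I_K -> 'M[R[i]]_(M, N)) -> 'I_K -> 'M[R[i]]_(M, N))
    (prec_BDP : forall G, block_diagonalizing G (prec_BD G))
    (prec_FBP : forall G, block_diagonalizing G (prec_FB G))
    (prec_BD_meas : forall j,
       measurable_fun setT (fun w => prec_BD (fun k => H k w) j))
    (prec_FB_meas : forall j,
       measurable_fun setT (fun w => prec_FB (Hhat H W w) j))
    (i : 'I_K) :
  (rate_BD P H rho (fun w => prec_BD (fun k => H k w)) i
     - rate_FB P H rho (fun w => prec_FB (Hhat H W w)) i
   <= (N%:R * log2 (1 + rho * fine (distortion P H W i)))%:E)%E.
Proof.
have NR : N%:R != 0 :> R by rewrite pnatr_eq0 -lt0n.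
have KNM : (K * N)%N = M.
  by apply/eqP; rewrite -(eqr_nat R) natrM KE divfK.
exact: rate_loss_le.
Qed.
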